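(* Assume the Generalized Riemann Hypothesis (GRH). Let $\chi$ be a primitive Dirichlet character of order $3$ and conductor $q$. Then, as $q\to\infty$, $$\left( \frac{1}{\sqrt{2}} + o(1) \right) \left(\frac{\zeta(3)}{e^{\gamma}\log_2 q}\right)^{1/2} \leq |L(1,\chi)| \leq \left( 2 + o(1) \right) e^\gamma \log_2 q.$$
   Context: $L(s,\chi)=\sum_{n\ge1}\chi(n)n^{-s}$ is the Dirichlet $L$-function, $\gamma$ is the Euler–Mascheroni constant, and $\log_j$ denotes the $j$-fold iterated logarithm (so $\log_2 q=\log\log q$). *)

(* Defs.v *)
From Stdlib Require Import Reals Arith.
From Coquelicot Require Import Coquelicot.
Open Scope R_scope.

Definition npow_neg (n : nat) (s : C) : C :=
  (Rpower (INR n) (- Re s) * cos (Im s * ln (INR n)),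
   - (Rpower (INR n) (- Re s) * sin (Im s * ln (INR n)))).

(* Value of a complex series sum_{n>=1} a n (real and imaginary parts summed
   separately; equals the complex sum whenever that converges). *)
Definition CSeries1 (a : nat -> C) : C :=
  (Series (fun n => Re (a (S n))), Series (fun n => Im (a (S n)))).

(* Dirichlet character modulo q, as a function on nat (values at nonnegative
   integers determine it by periodicity). *)
Definition dirichlet_char (q : nat) (chi : nat -> C) : Prop :=
  (forall n, chi (n + q)%nat = chi n) /\
  (forall m n, chi (m * n)%nat = Cmult (chi m) (chi n)) /\
  chi 1%nat = RtoC 1 /\
  (forall n, chi n = RtoC 0 <-> Nat.gcd n q <> 1%nat).

Definition principal_char (q : nat) (n : nat) : C :=
  if Nat.eqb (Nat.gcd n q) 1 then RtoC 1 else RtoC 0.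

Definition char_pow (chi : nat -> C) (k : nat) : nat -> C :=
  fun n => Cpow (chi n) k.

Definition char_order (q : nat) (chi : nat -> C) (k : nat) : Prop :=
  (0 < k)%nat /\ char_pow chi k = principal_char q /\
  (forall j, (0 < j < k)%nat -> char_pow chi j <> principal_char q).

Definition induced_modulus (q : nat) (chi : nat -> C) (d : nat) : Prop :=
  forall a, Nat.gcd a q = 1%nat -> Nat.modulo a d = Nat.modulo 1 d -> chi a = RtoC 1.

Definition primitive_char (q : nat) (chi : nat -> C) : Prop :=
  forall d, Nat.divide d q -> induced_modulus q chi d -> d = q.

(* L(s,chi) = sum_{n>=1} chi(n) n^{-s} (convergent for Re s > 0 when chi is
   nonprincipal) *)
Definition Lfun (chi : nat -> C) (s : C) : C :=
  CSeries1 (fun n => Cmult (chi n) (npow_neg n s)).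

(* Dirichlet eta function sum_{n>=1} (-1)^{n-1} n^{-s}, (1 - 2^{1-s}) zeta(s) *)
Definition eta_fun (s : C) : C :=
  CSeries1 (fun n => Cmult (RtoC ((-1) ^ (n - 1))) (npow_neg n s)).

(* Generalized Riemann Hypothesis for Dirichlet L-functions: RH for zeta
   (via eta, whose zeros in 1/2 < Re s < 1 are exactly those of zeta) and no
   zeros of L(s,chi) with Re s > 1/2 for nonprincipal chi. *)
Definition GRH : Prop :=
  (forall s : C, 1/2 < Re s < 1 -> eta_fun s <> RtoC 0) /\
  (forall (q : nat) (chi : nat -> C), (1 <= q)%nat -> dirichlet_char q chi ->
     chi <> principal_char q ->
     forall s : C, 1/2 < Re s -> Lfun chi s <> RtoC 0).

Definition zeta3 : R := Series (fun n => / (INR (S n)) ^ 3).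

Definition euler_gamma : R :=
  real (Lim_seq (fun n => sum_f_R0 (fun k => / INR (S k)) n - ln (INR (S n)))).

(* Main.v *)
Require Import Defs.
From Stdlib Require Import Reals Factorial Arith List Permutation Lra Lia Psatz.
From Stdlib Require Import Classical ClassicalEpsilon FunctionalExtensionality.
From Coquelicot Require Import Coquelicot.
From mathcomp Require ssreflect ssrfun ssrbool eqtype ssrnat seq div fintype bigop prime.
From mathcomp Require ssralg poly complex Rstruct.
Open Scope R_scope.

(** Fix a large [A] and expand [log L(s, chi)] in a Taylor series around [s = 1 + A]. Under GRH it
    is analytic in [|s - 1 - A| < A + 1/2], where [|L| = O_A(q)] by partial summation, so a
    Borel-Caratheodory estimate bounds the error made at [s = 1] by stopping after [K] terms by
    [O_A (log q (A / (A + 1/2))^K)]. This is [o(1)] as soon as [K / A > (2 + eps) log log q].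
    The truncated series at [s = 1] is
      [sum_{p, m} chi(p^m) / (m p^m) * P(Poisson(A log p^m) <= K)],
    a smoothly truncated Euler product. For the trivial character the same truncation is computed
    exactly: [log ((s - 1) zeta(s))] contributes [o(1)], and [- log (s - 1)] contributes
    [sum_{k <= K} 1/k - log A = log (K / A) + gamma + o(1)], which replaces Mertens' theorem.
    The upper bound follows from [Re chi <= 1]. For the lower bound, [Re chi(n) >= -1/2] whenever
    [chi(n) <> 0], and [chi(n) = 1] if moreover [n] is a cube: the cubes produce [zeta(3)].

    No contour integral is needed: the Taylor polynomials of a zero-free power series are eventually
    zero-free on a closed disc, and the logarithm of a polynomial is explicit in terms of its roots. *)

(** The constant 2 is the inverse of the distance 1/2 from [s = 1] to the critical line: each Taylor
    term gains a factor [A / (A + 1/2)], and [A log((A + 1/2) / A)] tends to 1/2 as [A] grows, so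
    absorbing [log q] costs [K / A] slightly above [2 log log q]. The truncated sum S(1) of the
    trivial character is then [log(2 log log q) + gamma] up to a small error, and this single upper
    estimate serves both bounds. The Poisson weights are nonnegative, so the truncated sum S(chi)
    satisfies S(chi) <= S(1), and summing Re chi + 1/2 >= 0 gives S(chi) >= (1/2) log zeta(3) -
    (1/2) S(1). This is the origin of the exponent 1/2 and of the factor 1/sqrt 2. Only [log |L|]
    occurs, never a branch of the logarithm: the coefficients are defined by series over prime
    powers, valid near [1 + A], and are identified with those of a polynomial by comparing real
    parts on a small circle. *)

Fixpoint csum (f : nat -> C) (n : nat) : C :=
  match n with O => RtoC 0 | S m => Cplus (csum f m) (f m) end.

(** Listing inverse roots instead of roots normalises the value at [0] to [1] and makes the
    coefficients of the logarithm power sums of the entries. *)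
Fixpoint cprod1 (l : list C) (z : C) : C :=
  match l with nil => RtoC 1 | cons s l' => Cmult (Cminus (RtoC 1) (Cmult s z)) (cprod1 l' z) end.

(** * Factorisation of complex polynomials *)

Module FundamentalTheorem.
Import ssreflect ssrfun ssrbool eqtype ssrnat seq fintype bigop ssralg poly complex Rstruct.
Import GRing.Theory.
Local Open Scope ring_scope.
Notation RC := (complex R).

Definition toRC (z : C) : RC := Complex (fst z) (snd z).
Definition ofRC (z : RC) : C := let: Complex a b := z in (a, b).
Lemma toRCK z : ofRC (toRC z) = z. Proof. by case: z. Qed.
Lemma ofRCK z : toRC (ofRC z) = z. Proof. by case: z. Qed.
Lemma toRC_add x y : toRC (Cplus x y) = toRC x + toRC y. Proof. by case: x y => [a b] [c d]. Qed.
Lemma toRC_mul x y : toRC (Cmult x y) = toRC x * toRC y. Proof. by case: x y => [a b] [c d]. Qed.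
Lemma toRC_opp x : toRC (Copp x) = - toRC x. Proof. by case: x. Qed.
Lemma toRC_pow x n : toRC (Cpow x n) = toRC x ^+ n.
Proof. by elim: n => [|n IH] //; rewrite Cpow_S toRC_mul IH exprS. Qed.
Lemma toRC_inj x y : toRC x = toRC y -> x = y.
Proof. by move=> h; rewrite -(toRCK x) h toRCK. Qed.
Lemma toRC_csum f n : toRC (csum f n) = \sum_(i < n) toRC (f i).
Proof. by elim: n => [|n IH]; rewrite ?big_ord0 // big_ord_recr /= toRC_add IH. Qed.

(** Since [p.[0]] is nonzero no root vanishes, and each factor [z - x] equals
    [- x * (1 - x^-1 * z)]; the constants collect into [p.[0]]. *)
Lemma closed_field_inverse_roots (K : closedFieldType) (p : {poly K}) : p.[0] != 0 ->
  exists rs : seq K, forall z, p.[z] = p.[0] * \prod_(x <- rs) (1 - x * z).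
Proof.
have [rs prs] := closed_field_poly_normal p.
rewrite prs !hornerZ mulf_eq0 negb_or => /andP[_].
rewrite horner_prod => rs0; exists [seq x^-1 | x <- rs] => z.
rewrite !hornerZ -mulrA; congr (_ * _); rewrite !horner_prod.
elim: rs {prs} rs0 => [|x rs IH]; first by rewrite !big_nil mulr1.
rewrite !big_cons mulf_eq0 negb_or => /andP[]; rewrite !hornerXsubC sub0r oppr_eq0 => x0 /IH->.
by rewrite mulrACA mulrDr mulr1 mulrNN mulVKf // [- x + _]addrC.
Qed.

(** The fundamental theorem of algebra, imported from the closed field structure on mathcomp's
    [complex R] through the isomorphism [toRC]. The top coefficients may vanish, so the length of
    [l] is not prescribed. *)
Lemma linear_factors (N : nat) (b : nat -> C) : b O <> RtoC 0 ->
  exists l : list C, forall z,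
    csum (fun k => Cmult (b k) (Cpow z k)) (S N) = Cmult (b O) (cprod1 l z).
Proof.
move=> b0.
set p : {poly (RC : closedFieldType)} := \poly_(i < N.+1) toRC (b i).
have pE z : toRC (csum (fun k => Cmult (b k) (Cpow z k)) (S N)) = p.[toRC z].
  rewrite toRC_csum horner_poly; apply: eq_bigr => i _.
  by rewrite toRC_mul toRC_pow.
have p0 : p.[0] = toRC (b O).
  by rewrite horner_poly big_ord_recl big1 /= ?expr0 ?mulr1 ?addr0 // => i _; rewrite /bump /= exprS mul0r mulr0.
have [|rs prs] := @closed_field_inverse_roots _ p.
  by rewrite p0; apply/eqP => h; apply: b0; apply: toRC_inj; rewrite h.
exists (map ofRC rs) => z; apply: toRC_inj; rewrite pE toRC_mul -p0 prs; congr (_ * _).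
elim: rs {prs} => [|x rs IH]; first by rewrite big_nil.
by rewrite big_cons IH /= toRC_mul toRC_add toRC_opp toRC_mul ofRCK.
Qed.
End FundamentalTheorem.

(** * Finite sums and the logarithm of [|1 - w|] *)

Fixpoint rsum (f : nat -> R) (n : nat) : R :=
  match n with O => 0 | S m => rsum f m + f m end.

Lemma rsum_ext (f g : nat -> R) n :
  (forall k, (k < n)%nat -> f k = g k) -> rsum f n = rsum g n.
Proof.
  induction n as [|n IH]; intros H; simpl; [reflexivity|].
  rewrite IH, H; auto with arith.
Qed.

Lemma rsum_plus f g n : rsum (fun k => f k + g k) n = rsum f n + rsum g n.
Proof. induction n as [|n IH]; simpl; [ring|rewrite IH; ring]. Qed.

Lemma rsum_scal c f n : rsum (fun k => c * f k) n = c * rsum f n.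
Proof. induction n as [|n IH]; simpl; [ring|rewrite IH; ring]. Qed.

Lemma rsum_opp f n : rsum (fun k => - f k) n = - rsum f n.
Proof. induction n as [|n IH]; simpl; [ring|rewrite IH; ring]. Qed.

Lemma rsum_const c n : rsum (fun _ => c) n = INR n * c.
Proof. induction n as [|n IH]; [simpl; ring|]. rewrite S_INR; simpl; rewrite IH; ring. Qed.

Lemma rsum_le f g n :
  (forall k, (k < n)%nat -> f k <= g k) -> rsum f n <= rsum g n.
Proof.
  induction n as [|n IH]; intros H; simpl; [lra|].
  apply Rplus_le_compat; auto with arith.
Qed.

Lemma rsum_zero f n : (forall k, (k < n)%nat -> f k = 0) -> rsum f n = 0.
Proof. intros H; rewrite (rsum_ext f (fun _ => 0)), rsum_const by auto; ring. Qed.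

Lemma rsum_nonneg f n : (forall k, (k < n)%nat -> 0 <= f k) -> 0 <= rsum f n.
Proof. intros H; rewrite <- (rsum_zero (fun _ => 0) n) by auto; apply rsum_le; auto. Qed.

Lemma rsum_abs f n : Rabs (rsum f n) <= rsum (fun k => Rabs (f k)) n.
Proof.
  induction n as [|n IH]; simpl; [rewrite Rabs_R0; lra|].
  eapply Rle_trans; [apply Rabs_triang|lra].
Qed.

Lemma rsum_swap (f : nat -> nat -> R) m n :
  rsum (fun i => rsum (f i) n) m = rsum (fun j => rsum (fun i => f i j) m) n.
Proof.
  induction m as [|m IH]; simpl.
  - symmetry; apply rsum_zero; auto.
  - rewrite IH, <- rsum_plus; reflexivity.
Qed.

Lemma rsum_mono f m n :
  (m <= n)%nat -> (forall k, 0 <= f k) -> rsum f m <= rsum f n.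
Proof. intros Hmn H; induction Hmn; simpl; [lra|]. specialize (H m0); lra. Qed.

Lemma rsum_single f n i :
  (i < n)%nat -> (forall k, (k < n)%nat -> k <> i -> f k = 0) -> rsum f n = f i.
Proof.
  induction n as [|n IH]; intros Hi H; [lia|]; simpl.
  destruct (Nat.eq_dec i n) as [->|Hn].
  - rewrite rsum_zero; [ring|]. intros k Hk; apply H; lia.
  - rewrite IH, (H n); [ring|lia|lia|lia|]. intros k Hk; apply H; lia.
Qed.

Lemma rsum_telescope f n : rsum (fun k => f (S k) - f k) n = f n - f O.
Proof. induction n as [|n IH]; simpl; [ring|rewrite IH; ring]. Qed.

Lemma rsum_shift f n : rsum f (S n) = f O + rsum (fun k => f (S k)) n.
Proof. induction n as [|n IH]; [simpl; ring|]. simpl in *; rewrite IH; ring. Qed.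

Lemma rsum_sum_n (f : nat -> R) n : sum_n f n = rsum f (S n).
Proof.
  induction n as [|n IH].
  - rewrite sum_O; simpl; ring.
  - rewrite sum_Sn, IH; reflexivity.
Qed.

Lemma rsum_geom q n : q <> 1 -> rsum (fun k => q ^ k) n = (1 - q ^ n) / (1 - q).
Proof.
  intros Hq; induction n as [|n IH]; simpl; [field; lra|].
  rewrite IH; field; lra.
Qed.

Lemma rsum_geom_le q n : 0 <= q < 1 -> rsum (fun k => q ^ k) n <= / (1 - q).
Proof.
  intros Hq; rewrite rsum_geom by lra.
  assert (H := pow_le q n (proj1 Hq)).
  apply Rmult_le_reg_r with (1 - q); [lra|]. field_simplify; lra.
Qed.

Lemma csum_ext (f g : nat -> C) n :
  (forall k, (k < n)%nat -> f k = g k) -> csum f n = csum g n.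
Proof.
  induction n as [|n IH]; intros H; simpl; [reflexivity|].
  rewrite IH, H; auto with arith.
Qed.

Lemma csum_plus f g n : csum (fun k => f k + g k)%C n = (csum f n + csum g n)%C.
Proof. induction n as [|n IH]; simpl; [ring|rewrite IH; ring]. Qed.

Lemma csum_minus f g n : csum (fun k => f k - g k)%C n = (csum f n - csum g n)%C.
Proof. induction n as [|n IH]; simpl; [ring|rewrite IH; ring]. Qed.

Lemma csum_scal c f n : csum (fun k => c * f k)%C n = (c * csum f n)%C.
Proof. induction n as [|n IH]; simpl; [ring|rewrite IH; ring]. Qed.

Lemma csum_zero f n : (forall k, (k < n)%nat -> f k = RtoC 0) -> csum f n = RtoC 0.
Proof.
  induction n as [|n IH]; intros H; simpl; [reflexivity|].
  rewrite IH, H by auto; ring.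
Qed.

Lemma csum_swap (f : nat -> nat -> C) m n :
  csum (fun i => csum (f i) n) m = csum (fun j => csum (fun i => f i j) m) n.
Proof.
  induction m as [|m IH]; simpl.
  - symmetry; apply csum_zero; auto.
  - rewrite IH, <- csum_plus; reflexivity.
Qed.

Lemma csum_shift f n : csum f (S n) = (f O + csum (fun k => f (S k)) n)%C.
Proof. induction n as [|n IH]; [simpl; ring|]. simpl in *; rewrite IH; ring. Qed.

Lemma csum_Re f n : Re (csum f n) = rsum (fun k => Re (f k)) n.
Proof. induction n as [|n IH]; simpl; [reflexivity|rewrite <- IH; reflexivity]. Qed.

Lemma csum_Im f n : Im (csum f n) = rsum (fun k => Im (f k)) n.
Proof. induction n as [|n IH]; simpl; [reflexivity|rewrite <- IH; reflexivity]. Qed.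

Lemma csum_RtoC f n : csum (fun k => RtoC (f k)) n = RtoC (rsum f n).
Proof. induction n as [|n IH]; simpl; [reflexivity|rewrite IH, RtoC_plus; reflexivity]. Qed.

Lemma csum_Cmod f n : Cmod (csum f n) <= rsum (fun k => Cmod (f k)) n.
Proof.
  induction n as [|n IH]; simpl; [rewrite Cmod_0; lra|].
  eapply Rle_trans; [apply Cmod_triangle|lra].
Qed.

Lemma csum_geom (w : C) n : (csum (fun k => w ^ k) n * (1 - w) = 1 - w ^ n)%C.
Proof.
  induction n as [|n IH]; simpl; [ring|].
  rewrite Cmult_plus_distr_r, IH; ring.
Qed.

Lemma Cmod_minus_sym (x y : C) : Cmod (x - y) = Cmod (y - x).
Proof. rewrite <- Cmod_opp; f_equal; ring. Qed.

Lemma Re_le_Cmod (x : C) : Re x <= Cmod x.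
Proof. eapply Rle_trans; [apply Rle_abs|apply re_le_Cmod]. Qed.

Lemma Cmod_triangle_minus (x y : C) : Rabs (Cmod x - Cmod y) <= Cmod (x - y).
Proof.
  assert (H1 := Cmod_triangle (x - y) y). assert (H2 := Cmod_triangle (y - x) x).
  rewrite (Cmod_minus_sym y x) in H2.
  replace (x - y + y)%C with x in H1 by ring. replace (y - x + x)%C with y in H2 by ring.
  apply Rabs_le; lra.
Qed.

Lemma ln_dist_le (x y m : R) : 0 < m -> m <= x -> m <= y -> Rabs (ln x - ln y) <= Rabs (x - y) / m.
Proof.
  intros Hm.
  assert (W : forall x y, m <= x -> m <= y -> ln x - ln y <= Rabs (x - y) / m).
  { intros a b Ha Hb. rewrite <- ln_div by lra.
    assert (H : ln (a / b) <= a / b - 1).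
    { assert (H := exp_ineq1_le (ln (a / b))). rewrite exp_ln in H; [lra|].
      apply Rdiv_lt_0_compat; lra. }
    eapply Rle_trans; [exact H|].
    replace (a / b - 1) with ((a - b) / b) by (field; lra).
    apply Rle_trans with (Rabs (a - b) / b).
    - apply Rmult_le_compat_r; [left; apply Rinv_0_lt_compat; lra|apply Rle_abs].
    - apply Rmult_le_compat_l; [apply Rabs_pos|]. apply Rinv_le_contravar; lra. }
  intros Hx Hy; apply Rabs_le; split.
  - rewrite Rabs_minus_sym. specialize (W y x Hy Hx); lra.
  - auto.
Qed.

Lemma ln_Cmod_mult (x y : C) : x <> RtoC 0 -> y <> RtoC 0 ->
  ln (Cmod (x * y)) = ln (Cmod x) + ln (Cmod y).
Proof. intros Hx Hy; rewrite Cmod_mult; apply ln_mult; apply Cmod_gt_0; auto. Qed.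

Lemma one_minus_neq_0 (w : C) : Cmod w < 1 -> (1 - w)%C <> RtoC 0.
Proof.
  intros Hw H. assert (E : w = RtoC 1) by (replace w with (1 - (1 - w))%C by ring; rewrite H; ring).
  rewrite E, Cmod_1 in Hw; lra.
Qed.

Lemma Cmod_one_minus_ge (w : C) : 1 - Cmod w <= Cmod (1 - w).
Proof.
  assert (H := Cmod_triangle (1 - w) w). replace (1 - w + w)%C with (RtoC 1) in H by ring.
  rewrite Cmod_1 in H; lra.
Qed.

(** A purely real argument: along the segment [t * w] with [t] in [0,1], the quantity on the left is
    a differentiable function of [t] vanishing at [0], so the mean value theorem reduces the claim
    to a bound for its derivative. *)
Lemma ln_Cmod_one_minus_expansion (w : C) (K : nat) : Cmod w < 1 ->
  Rabs (ln (Cmod (1 - w)) + rsum (fun k => Re (w ^ S k)%C / INR (S k)) K)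
    <= Cmod w ^ S K / (1 - Cmod w).
Proof.
  intros Hw.
  set (a := Re w); set (b := Im w).
  (* [D t] is the squared modulus of [1 - t * w], which is why its logarithm is halved in [f]. *)
  set (D := fun t => (1 - t * a) ^ 2 + (t * b) ^ 2).
  set (f := fun t => / 2 * ln (D t) + rsum (fun k => Re (w ^ S k)%C / INR (S k) * t ^ S k) K).
  assert (HD : forall t : R, D t = Cmod (1 - t * w) ^ 2).
  { intros t. rewrite Cmod2_alt. unfold D, a, b; destruct w as [x y]; simpl; ring. }
  assert (Htw : forall t, 0 <= t <= 1 -> Cmod (t * w) <= Cmod w).
  { intros t Ht. rewrite Cmod_mult, Cmod_R, Rabs_pos_eq by lra.
    assert (H := Cmod_ge_0 w). nra. }
  assert (HDpos : forall t, 0 <= t <= 1 -> 0 < D t).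
  { intros t Ht. rewrite HD. apply pow_lt.
    apply Rlt_le_trans with (1 - Cmod (t * w)); [specialize (Htw t Ht); lra|apply Cmod_one_minus_ge]. }
  set (f' := fun t => (- a + t * (a ^ 2 + b ^ 2)) / D t + rsum (fun k => Re (w ^ S k)%C * t ^ k) K).
  assert (Hpoly : forall n t, is_derive (fun t => rsum (fun k => Re (w ^ S k)%C / INR (S k) * t ^ S k) n) t
                           (rsum (fun k => Re (w ^ S k)%C * t ^ k) n)).
  { intros n t; induction n as [|n IH].
    - simpl. apply (is_derive_const (V := R_NormedModule)).
    - change (is_derive (fun t0 => plus (rsum (fun k => Re (w ^ S k)%C / INR (S k) * t0 ^ S k) n)
         (Re (w ^ S n)%C / INR (S n) * t0 ^ S n)) t (plus (rsum (fun k => Re (w ^ S k)%C * t ^ k) n)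
          (Re (w ^ S n)%C * t ^ n))).
      apply (is_derive_plus (V := R_NormedModule)); [exact IH|].
      evar_last; [apply is_derive_scal; apply is_derive_pow; apply is_derive_id|].
      unfold one; simpl (pred (S n)). simpl (@Ring.sort _). cbn [Ring.mixin]. 
      change (Re (w ^ S n)%C / INR (S n) * (INR (S n) * 1 * t ^ n) = Re (w ^ S n)%C * t ^ n).
      field. apply not_0_INR; lia. }
  assert (Hder : forall t, 0 <= t <= 1 -> is_derive f t (f' t)).
  { intros t Ht. unfold f, f'.
    apply (is_derive_plus (V := R_NormedModule)); [|apply Hpoly].
    specialize (HDpos t Ht). unfold D in *. auto_derive; [exact HDpos|field; lra]. }
  destruct (MVT_gen f 0 1 f') as [c [Hc E]].
  { intros x Hx. rewrite Rmin_left, Rmax_right in Hx by lra. apply Hder; lra. }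
  { intros x Hx. rewrite Rmin_left, Rmax_right in Hx by lra.
    apply derivable_continuous_pt. exists (f' x). apply is_derive_Reals, Hder; lra. }
  rewrite Rmin_left, Rmax_right in Hc by lra.
  assert (F1 : f 1 = ln (Cmod (1 - w)) + rsum (fun k => Re (w ^ S k)%C / INR (S k)) K).
  { unfold f. rewrite HD. f_equal.
    - replace (1 - 1 * w)%C with (1 - w)%C by ring. rewrite <- Rsqr_pow2.
      unfold Rsqr. assert (0 < Cmod (1 - w)) by (apply Cmod_gt_0, one_minus_neq_0; auto).
      rewrite ln_mult by auto. field.
    - apply rsum_ext; intros; rewrite pow1; ring. }
  assert (F0 : f 0 = 0).
  { unfold f, D. rewrite rsum_zero.
    - replace ((1 - 0 * a) ^ 2 + (0 * b) ^ 2) with 1 by ring. rewrite ln_1; ring.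
    - intros k _; rewrite pow_ne_zero by lia; ring. }
  rewrite <- F1. replace (f 1) with (f' c) by lra.
  assert (Hcw : (1 - c * w)%C <> RtoC 0).
  { apply one_minus_neq_0. specialize (Htw c Hc); lra. }
  (* The derivative of the logarithm is [- Re (w / (1 - c * w))]; the finite geometric sum cancels
     all of it except the term of order [K]. *)
  assert (F' : f' c = - Re (w ^ S K * RtoC (c ^ K) / (1 - c * w))%C).
  { unfold f'.
    assert (G : csum (fun k => w ^ S k * RtoC (c ^ k))%C K = ((w - w ^ S K * RtoC (c ^ K)) / (1 - c * w))%C).
    { rewrite (csum_ext _ (fun k => w * (c * w) ^ k)%C).
      2:{ intros k _. rewrite Cpow_mult_l, RtoC_pow, Cpow_S; ring. }
      rewrite csum_scal. assert (G := csum_geom (c * w) K).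
      change (csum (fun k => ((c * w) ^ k)%C) K) with (csum (Cpow (c * w)%C) K) in *.
      set (X := csum (Cpow (c * w)%C) K) in *.
      transitivity (w * (X * (1 - c * w)) / (1 - c * w))%C; [field; exact Hcw|].
      rewrite G, Cpow_mult_l, RtoC_pow, Cpow_S. field. exact Hcw. }
    rewrite (rsum_ext _ (fun k => Re (w ^ S k * RtoC (c ^ k))%C)).
    2:{ intros k _. generalize (w ^ S k)%C; intros [x y]; simpl; ring. }
    rewrite <- csum_Re, G.
    replace ((w - w ^ S K * RtoC (c ^ K)) / (1 - c * w))%C with
      (w / (1 - c * w) + - (w ^ S K * RtoC (c ^ K) / (1 - c * w)))%C by (field; exact Hcw).
    assert (R1 : forall x y : C, Re (x + - y)%C = Re x - Re y) by (intros [] []; simpl; ring).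
    rewrite R1. cut ((- a + c * (a ^ 2 + b ^ 2)) / D c = - Re (w / (1 - c * w))%C); [lra|].
    specialize (HDpos c Hc). unfold D, a, b in *. destruct w as [x y]; simpl in *. field.
    nra. }
  rewrite F', Rabs_Ropp. eapply Rle_trans; [apply re_le_Cmod|].
  rewrite Cmod_div by exact Hcw. rewrite Cmod_mult, Cmod_pow, Cmod_R.
  assert (H1 : Rabs (c ^ K) <= 1).
  { rewrite Rabs_pos_eq by (apply pow_le; lra). rewrite <- (pow1 K). apply pow_incr; lra. }
  assert (H2 := Cmod_one_minus_ge (c * w)). specialize (Htw c Hc).
  assert (H3 : 0 <= Cmod w ^ S K) by (apply pow_le, Cmod_ge_0).
  apply Rmult_le_compat.
  - apply Rmult_le_pos; [exact H3|apply Rabs_pos].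
  - left; apply Rinv_0_lt_compat; lra.
  - assert (H4 := Rabs_pos (c ^ K)). nra.
  - apply Rinv_le_contravar; lra.
Qed.

(** * Coefficient bounds from a one-sided bound on the real part *)

Definition cis (t : R) : C := (cos t, sin t).

Lemma cis_pow t n : (cis t ^ n)%C = cis (INR n * t).
Proof.
  induction n as [|n IH].
  - unfold cis; simpl. rewrite Rmult_0_l, cos_0, sin_0; reflexivity.
  - rewrite Cpow_S, IH, S_INR, Rmult_plus_distr_r, Rmult_1_l. unfold cis.
    rewrite (Rplus_comm (INR n * t) t), cos_plus, sin_plus. unfold Cmult; simpl.
    f_equal; ring.
Qed.

Lemma Cmod_cis t : Cmod (cis t) = 1.
Proof.
  assert (H := sin2_cos2 t). unfold Rsqr in H. unfold Cmod, cis; simpl.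
  replace (cos t * (cos t * 1) + sin t * (sin t * 1)) with 1 by lra. apply sqrt_1.
Qed.

Lemma cis_neq_1 t : 0 < t < 2 * PI -> cis t <> RtoC 1.
Proof.
  intros Ht E. injection E as E _.
  replace t with (2 * (t / 2)) in E by field. rewrite cos_2a_sin in E.
  assert (H := sin_gt_0 (t / 2)). assert (0 < sin (t / 2)) by (apply H; lra). nra.
Qed.

Lemma root_of_unity_power_sum (M e : nat) : (0 < e < M)%nat ->
  csum (fun j => ((cis (2 * PI / INR M) ^ e) ^ j)%C) M = RtoC 0.
Proof.
  intros He. assert (HM : 0 < INR M) by (apply lt_0_INR; lia).
  set (w := (cis (2 * PI / INR M) ^ e)%C).
  assert (Hw : (1 - w)%C <> RtoC 0).
  { intros E. apply (cis_neq_1 (INR e * (2 * PI / INR M))).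
    - assert (HPI := PI_RGT_0). assert (0 < INR e) by (apply lt_0_INR; lia).
      assert (INR e < INR M) by (apply lt_INR; lia). split.
      + apply Rmult_lt_0_compat; [lra|]. apply Rdiv_lt_0_compat; lra.
      + replace (INR e * (2 * PI / INR M)) with (2 * PI * (INR e / INR M)) by (field; lra).
        rewrite <- (Rmult_1_r (2 * PI)) at 2. apply Rmult_lt_compat_l; [lra|].
        apply Rmult_lt_reg_r with (INR M); [lra|]. unfold Rdiv.
        rewrite Rmult_assoc, Rinv_l by lra. lra.
    - rewrite <- cis_pow. fold w. replace w with (1 - (1 - w))%C by ring. rewrite E; ring. }
  assert (G := csum_geom w M).
  assert (H1 : (w ^ M)%C = RtoC 1).
  { unfold w. rewrite <- Cpow_mult_r, cis_pow, mult_INR.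
    replace (INR e * INR M * (2 * PI / INR M)) with (0 + 2 * INR e * PI) by (field; lra).
    unfold cis. rewrite cos_period, sin_period, cos_0, sin_0. reflexivity. }
  rewrite H1 in G. change (csum (Cpow w) M = RtoC 0). change (csum (fun k => (w ^ k)%C) M) with (csum (Cpow w) M) in G.
  transitivity (csum (Cpow w) M * (1 - w) / (1 - w))%C; [field; exact Hw|].
  rewrite G. field; exact Hw.
Qed.

(** The index is shifted: [a k] belongs to degree [k + 1], and there is no constant term. *)
Definition psum1 (a : nat -> C) (z : C) (K : nat) : C := csum (fun k => a k * z ^ S k)%C K.

Lemma Re_mult_Re (x y : C) : Re x * Re y = / 2 * (Re (x * y)%C + Re (x * Cconj y)%C).
Proof. destruct x, y; simpl; field. Qed.

Lemma Re_mult_scal (c : R) (x : C) : Re (c * x)%C = c * Re x.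
Proof. destruct x; simpl; ring. Qed.

(* Average over the (2K+1)-th roots of unity against the nonnegative weight
   [1 + Re (u z^(k+1))]: this isolates the k-th coefficient. *)
Lemma coeff_bound_of_Re_bound (a : nat -> C) (r B : R) (K k : nat) :
  0 < r -> (k < K)%nat ->
  (forall z, Cmod z = r -> Re (psum1 a z K) <= B) ->
  Cmod (a k) * r ^ S k <= 2 * B.
Proof.
  intros Hr Hk HB.
  (* All exponents that occur, [l + 1] and [(l + 1) + (k + 1)], lie strictly between [0] and [M], so
     they average to zero; the same holds for the differences [l - k] modulo [M] unless [l = k]. *)
  set (M := (2 * K + 1)%nat). set (w := cis (2 * PI / INR M)).
  assert (HM : 0 < INR M) by (apply lt_0_INR; unfold M; lia).
  assert (Hw1 : Cmod w = 1) by apply Cmod_cis.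
  (* A vanishing coefficient has no phase. In that case [0 <= B] is what has to be shown, and the
     unweighted average gives it because there is no constant term. *)
  destruct (Ceq_dec (a k) 0) as [Ha|Ha].
  { rewrite Ha, Cmod_0, Rmult_0_l.
    assert (HS : rsum (fun j => Re (psum1 a (r * w ^ j)%C K)) M <= rsum (fun _ => B) M).
    { apply rsum_le; intros j _. apply HB.
      rewrite Cmod_mult, Cmod_R, Cmod_pow, Hw1, pow1, Rabs_pos_eq; lra. }
    rewrite rsum_const in HS.
    rewrite <- csum_Re in HS. unfold psum1 in HS. rewrite csum_swap, csum_zero in HS.
    - simpl in HS. apply Rmult_le_reg_l with (INR M); [lra|]. lra.
    - intros l Hl. 
      rewrite (csum_ext _ (fun j => (a l * RtoC (r ^ S l)) * ((w ^ S l) ^ j)))%C.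
      + rewrite csum_scal. unfold w. rewrite root_of_unity_power_sum by (unfold M; lia). ring.
      + intros j _. rewrite Cpow_mult_l, RtoC_pow, <- !Cpow_mult_r, (Nat.mul_comm (S l) j). ring. }
  assert (Hm : 0 < Cmod (a k)) by (apply Cmod_gt_0; auto).
  (* With the phase of [a k] in the weight, the surviving half-term is
     [Re (a k * Cconj u) / 2 = Cmod (a k) / 2], times [r ^ S k]. *)
  set (u := (a k / Cmod (a k))%C).
  assert (Hu : Cmod u = 1).
  { unfold u. rewrite Cmod_div, Cmod_R, Rabs_pos_eq by (try lra; intros E; injection E; lra). field; lra. }
  set (W := fun j => 1 + Re (u * (w ^ S k) ^ j)%C).
  assert (HW : forall j, 0 <= W j).
  { intros j. unfold W. assert (H := re_le_Cmod (u * (w ^ S k) ^ j)%C).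
    rewrite Cmod_mult, !Cmod_pow, Hu, Hw1, !pow1 in H. apply Rabs_le_between in H. lra. }
  assert (HSW : rsum W M = INR M).
  { unfold W. rewrite rsum_plus, rsum_const, <- csum_Re, csum_scal.
    unfold w. rewrite root_of_unity_power_sum by (unfold M; lia).
    replace (u * 0)%C with (RtoC 0) by ring. simpl; ring. }
  assert (HS : rsum (fun j => Re (psum1 a (r * w ^ j)%C K) * W j) M <= B * INR M).
  { rewrite <- HSW, <- rsum_scal. apply rsum_le; intros j _.
    apply Rmult_le_compat_r; [apply HW|]. apply HB.
    rewrite Cmod_mult, Cmod_R, Cmod_pow, Hw1, pow1, Rabs_pos_eq; lra. }
  (* Negative frequencies are rewritten as natural powers of [w]. *)
  assert (Hconj : Cconj w = (w ^ (M - 1))%C).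
  { unfold w. rewrite cis_pow, minus_INR by (unfold M; lia). simpl (INR 1).
    replace ((INR M - 1) * (2 * PI / INR M)) with (- (2 * PI / INR M) + 2 * INR 1 * PI) by (simpl; field; lra).
    unfold cis. rewrite cos_period, sin_period, cos_neg, sin_neg. reflexivity. }
  assert (HwM : (w ^ M)%C = RtoC 1).
  { unfold w. rewrite cis_pow. replace (INR M * (2 * PI / INR M)) with (0 + 2 * INR 1 * PI) by (simpl; field; lra).
    unfold cis. rewrite cos_period, sin_period, cos_0, sin_0. reflexivity. }
  assert (T : forall l, (l < K)%nat ->
     rsum (fun j => Re (a l * (r * w ^ j) ^ S l)%C * W j) M =
     if Nat.eq_dec l k then INR M / 2 * (Cmod (a k) * r ^ S k) else 0).
  { intros l Hl.
    rewrite (rsum_ext _ (fun j => Re ((a l * RtoC (r ^ S l)) * (w ^ S l) ^ j)%C +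
        / 2 * (Re ((a l * RtoC (r ^ S l) * u) * (w ^ (S l + S k)) ^ j)%C +
               Re ((a l * RtoC (r ^ S l) * Cconj u) * (w ^ (S l + (M - 1) * S k)) ^ j)%C))).
    2:{ intros j _. unfold W.
        replace ((a l * (r * w ^ j) ^ S l))%C with ((a l * RtoC (r ^ S l)) * (w ^ S l) ^ j)%C.
        2:{ rewrite Cpow_mult_l, RtoC_pow, <- !Cpow_mult_r, (Nat.mul_comm (S l) j). ring. }
        rewrite Rmult_plus_distr_l, Rmult_1_r, Re_mult_Re. do 4 f_equal.
        - rewrite Cpow_add_r, !Cpow_mult_l. ring.
        - rewrite Cmult_conj, !Cpow_conj, Hconj, Cpow_add_r, Cpow_mult_r, !Cpow_mult_l. ring. }
    rewrite rsum_plus, rsum_scal, rsum_plus, <- !csum_Re, !csum_scal.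
    unfold w at 1 2. rewrite !root_of_unity_power_sum by (unfold M; lia).
    destruct (Nat.eq_dec l k) as [->|Hlk].
    - replace (S k + (M - 1) * S k)%nat with (M * S k)%nat by (unfold M; lia).
      rewrite Cpow_mult_r, HwM, Cpow_1_l.
      rewrite (csum_ext _ (fun _ => RtoC 1)) by (intros; apply Cpow_1_l).
      rewrite csum_RtoC, rsum_const, Rmult_1_r.
      assert (E : (a k * RtoC (r ^ S k) * Cconj u * INR M)%C = RtoC (Cmod (a k) * r ^ S k * INR M)).
      { unfold u. replace (Cconj (a k / Cmod (a k)))%C with (Cconj (a k) / Cmod (a k))%C.
        2:{ destruct (a k) as [x y]; simpl in *. unfold Cdiv, Cmult, Cconj, Cinv; simpl. f_equal; field; nra. }
        generalize (r ^ S k); intros X. rewrite !RtoC_mult.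
        transitivity (a k * Cconj (a k) / Cmod (a k) * RtoC X * INR M)%C.
        - field. intros E; injection E; lra.
        - rewrite <- Cmod2_conj, (RtoC_pow (Cmod (a k))). field. intros E; injection E; lra. }
      rewrite E, !Cmult_0_r.
      change (0 + / 2 * (0 + Cmod (a k) * r ^ S k * INR M) = INR M / 2 * (Cmod (a k) * r ^ S k)). field.
    - assert (E : (w ^ (S l + (M - 1) * S k))%C = (w ^ (if (k <? l)%nat then l - k else M - (k - l)))%C).
      { destruct (Nat.ltb_spec k l).
        - replace (S l + (M - 1) * S k)%nat with (l - k + M * S k)%nat by (unfold M; lia).
          rewrite Cpow_add_r, Cpow_mult_r, HwM, Cpow_1_l; ring.
        - replace (S l + (M - 1) * S k)%nat with (M - (k - l) + M * k)%nat by (unfold M; lia).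
          rewrite Cpow_add_r, Cpow_mult_r, HwM, Cpow_1_l; ring. }
      rewrite E. unfold w. rewrite root_of_unity_power_sum.
      + rewrite !Cmult_0_r. simpl; ring.
      + destruct (Nat.ltb_spec k l); unfold M; lia. }
  rewrite (rsum_ext _ (fun j => rsum (fun l => Re (a l * (r * w ^ j) ^ S l)%C * W j) K)) in HS.
  2:{ intros j _. unfold psum1. rewrite csum_Re, Rmult_comm, <- rsum_scal. apply rsum_ext; intros; ring. }
  rewrite rsum_swap, (rsum_ext _ _ _ T), (rsum_single _ _ k) in HS; [|exact Hk|].
  - destruct (Nat.eq_dec k k); [|lia]. apply Rmult_le_reg_l with (INR M / 2); [lra|]. lra.
  - intros l _ Hl; destruct (Nat.eq_dec l k); [lia|reflexivity].
Qed.

(** * Taylor remainders of the logarithm of a zero-free power series *)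

Lemma geom_eventually_small (c q eta : R) : 0 <= q < 1 -> 0 < eta ->
  exists K0, forall K, (K0 <= K)%nat -> c * q ^ K <= eta.
Proof.
  intros Hq He.
  destruct (pow_lt_1_zero q) with (y := eta / (Rabs c + 1)) as [K0 HK0].
  - rewrite Rabs_pos_eq; lra.
  - apply Rdiv_lt_0_compat; [lra|]. assert (H := Rabs_pos c); lra.
  - exists K0; intros K HK. specialize (HK0 K HK).
    rewrite Rabs_pos_eq in HK0 by (apply pow_le; lra).
    assert (Hc := Rabs_pos c). assert (Hc' := Rle_abs c). assert (Hp := pow_le q K (proj1 Hq)).
    apply Rle_trans with ((Rabs c + 1) * q ^ K); [nra|].
    apply Rle_trans with ((Rabs c + 1) * (eta / (Rabs c + 1))); [apply Rmult_le_compat_l; lra|].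
    right; field; lra.
Qed.

Lemma csum_tail_geom (f : nat -> C) (c q : R) (K K' : nat) : 0 <= c -> 0 <= q < 1 ->
  (forall k, Cmod (f k) <= c * q ^ k) -> (K <= K')%nat ->
  Cmod (csum f K' - csum f K) <= c * q ^ K / (1 - q).
Proof.
  intros Hc Hq Hf HK.
  assert (H : Cmod (csum f K' - csum f K) <= c * (q ^ K - q ^ K') / (1 - q)).
  { induction HK as [|K' HK IH].
    - replace (csum f K - csum f K)%C with (RtoC 0) by ring. rewrite Cmod_0.
      right; field; lra.
    - simpl csum. replace (csum f K' + f K' - csum f K)%C with ((csum f K' - csum f K) + f K')%C by ring.
      eapply Rle_trans; [apply Cmod_triangle|]. specialize (Hf K').
      replace (c * (q ^ K - q ^ S K') / (1 - q)) with (c * (q ^ K - q ^ K') / (1 - q) + c * q ^ K') by (simpl; field; lra).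
      lra. }
  eapply Rle_trans; [exact H|]. apply Rmult_le_compat_r; [left; apply Rinv_0_lt_compat; lra|].
  apply Rmult_le_compat_l; [exact Hc|]. assert (Hp := pow_le q K' (proj1 Hq)); lra.
Qed.

(** Minus the [(k+1)]-st power sum of the inverse roots, over [k + 1]: the coefficient of
    [z ^ (k+1)] in the logarithm of [cprod1 l]. *)
Fixpoint logcoef (l : list C) (k : nat) : C :=
  match l with nil => RtoC 0 | cons s l' => (logcoef l' k - s ^ S k / INR (S k))%C end.

Lemma INR_S_neq_0 k : RtoC (INR (S k)) <> RtoC 0.
Proof. intros E; apply RtoC_inj in E. revert E. apply not_0_INR; lia. Qed.

(** The one-factor expansion is summed over the list. The error grows with the number of roots, so
    this only yields qualitative convergence; a bound free of the degree comes from
    [cprod1_logcoef_bound]. *)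
Lemma ln_Cmod_cprod1_expansion (l : list C) (r th : R) (z : C) (K : nat) :
  0 <= th < 1 -> 0 <= r -> Cmod z <= r -> (forall s, In s l -> Cmod s * r <= th) ->
  cprod1 l z <> RtoC 0 /\
  Rabs (ln (Cmod (cprod1 l z)) - Re (psum1 (logcoef l) z K)) <= INR (length l) * (th ^ S K / (1 - th)).
Proof.
  intros Hth Hr Hz. induction l as [|s l IH]; intros Hl.
  - split; [intros E; injection E; lra|]. simpl cprod1. rewrite Cmod_1, ln_1.
    unfold psum1. rewrite csum_zero by (intros; simpl; ring). simpl. rewrite Rminus_0_r, Rabs_R0; lra.
  - destruct IH as [IH1 IH2]; [intros; apply Hl; right; auto|].
    assert (Hs : Cmod (s * z) <= th).
    { rewrite Cmod_mult. apply Rle_trans with (Cmod s * r); [|apply Hl; left; auto].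
      apply Rmult_le_compat_l; [apply Cmod_ge_0|auto]. }
    assert (H1 : (1 - s * z)%C <> RtoC 0) by (apply one_minus_neq_0; lra).
    split; [simpl; apply Cmult_neq_0; auto|].
    simpl cprod1. rewrite ln_Cmod_mult by auto.
    assert (E : Re (psum1 (logcoef (s :: l)) z K) =
                Re (psum1 (logcoef l) z K) - rsum (fun k => Re ((s * z) ^ S k)%C / INR (S k)) K).
    { unfold psum1. rewrite !csum_Re, <- (Ropp_involutive (rsum (fun k => _ / _) K)), <- rsum_opp.
      unfold Rminus. rewrite Ropp_involutive, <- rsum_plus. apply rsum_ext; intros k _.
      change (logcoef (s :: l) k) with (logcoef l k - s ^ S k / INR (S k))%C. rewrite Cpow_mult_l.
      replace (((logcoef l k - s ^ S k / INR (S k)) * z ^ S k))%C with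
        (logcoef l k * z ^ S k + RtoC (- / INR (S k)) * (s ^ S k * z ^ S k))%C.
      2:{ rewrite RtoC_opp, RtoC_inv by (apply not_0_INR; lia). field. apply INR_S_neq_0. }
      generalize (s ^ S k * z ^ S k)%C (logcoef l k * z ^ S k)%C. intros [x1 x2] [y1 y2].
      change (y1 + (- / INR (S k) * x1 - 0 * x2) = y1 + - (x1 / INR (S k))). unfold Rdiv; ring. }
    rewrite E. simpl length. rewrite S_INR.
    assert (H2 := ln_Cmod_one_minus_expansion (s * z) K ltac:(lra)).
    assert (H3 : Cmod (s * z) ^ S K / (1 - Cmod (s * z)) <= th ^ S K / (1 - th)).
    { assert (H := Cmod_ge_0 (s * z)). apply Rmult_le_compat.
      - apply pow_le; auto.
      - left; apply Rinv_0_lt_compat; lra.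
      - apply pow_incr; lra.
      - apply Rinv_le_contravar; lra. }
    match goal with |- Rabs ?X <= _ => replace X with
      ((ln (Cmod (1 - s * z)) + rsum (fun k => Re ((s * z) ^ S k)%C / INR (S k)) K) +
       (ln (Cmod (cprod1 l z)) - Re (psum1 (logcoef l) z K))) by ring end.
    eapply Rle_trans; [apply Rabs_triang|]. lra.
Qed.

(** There are finitely many roots, all outside the closed disc, hence a common margin: [th] is the
    maximum of the [Cmod s * r]. *)
Lemma cprod1_nonvanishing_inverse_roots (l : list C) (r : R) : 0 < r ->
  (forall z, Cmod z <= r -> cprod1 l z <> RtoC 0) ->
  exists th, 0 <= th < 1 /\ forall s, In s l -> Cmod s * r <= th.
Proof.
  intros Hr. induction l as [|s l IH]; intros H.
  - exists 0; split; [lra|]. intros s [].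
  - destruct IH as [th [Hth IH]].
    { intros z Hz E. apply (H z Hz). simpl. rewrite E; ring. }
    assert (Hs : Cmod s * r < 1).
    { apply Rnot_le_lt; intros Hs.
      assert (Hs0 : s <> RtoC 0) by (intros E; rewrite E, Cmod_0 in Hs; lra).
      assert (Hm : 0 < Cmod s) by (apply Cmod_gt_0; auto).
      apply (H (/ s)%C).
      - rewrite Cmod_inv by auto. apply Rmult_le_reg_l with (Cmod s); [auto|]. rewrite Rinv_r; lra.
      - simpl. replace (1 - s * / s)%C with (RtoC 0) by (field; auto). ring. }
    exists (Rmax th (Cmod s * r)). split.
    + split; [apply Rle_trans with th; [lra|apply Rmax_l]|apply Rmax_lub_lt; lra].
    + intros t [<-|Ht]; [apply Rmax_r|]. eapply Rle_trans; [apply IH, Ht|apply Rmax_l].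
Qed.

Lemma cprod1_log_approximation (l : list C) (r : R) : 0 < r ->
  (forall z, Cmod z <= r -> cprod1 l z <> RtoC 0) ->
  forall eta, 0 < eta -> exists K0, forall K, (K0 <= K)%nat -> forall z, Cmod z <= r ->
    Rabs (ln (Cmod (cprod1 l z)) - Re (psum1 (logcoef l) z K)) <= eta.
Proof.
  intros Hr H eta He.
  destruct (cprod1_nonvanishing_inverse_roots l r Hr H) as [th [Hth Hl]].
  destruct (geom_eventually_small (INR (length l) / (1 - th)) th eta Hth He) as [K0 HK0].
  exists K0; intros K HK z Hz.
  eapply Rle_trans; [apply (ln_Cmod_cprod1_expansion l r th z K); auto; lra|].
  replace (INR (length l) * (th ^ S K / (1 - th))) with (INR (length l) / (1 - th) * th ^ S K) by (field; lra).
  apply HK0; lia.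
Qed.

(** The Borel-Caratheodory step. Long partial sums have real part at most [B + eta / 2] on the
    circle, so the averaging bound applies to them; letting [eta] tend to [0] removes every trace of
    the degree. *)
Lemma cprod1_logcoef_bound (l : list C) (r B : R) : 0 < r ->
  (forall z, Cmod z <= r -> cprod1 l z <> RtoC 0) ->
  (forall z, Cmod z <= r -> ln (Cmod (cprod1 l z)) <= B) ->
  forall k, Cmod (logcoef l k) * r ^ S k <= 2 * B.
Proof.
  intros Hr H HB k. apply le_epsilon; intros eta He.
  destruct (cprod1_log_approximation l r Hr H (eta / 2) ltac:(lra)) as [K0 HK0].
  replace (2 * B + eta) with (2 * (B + eta / 2)) by field.
  apply (coeff_bound_of_Re_bound _ r _ (max K0 (S k)) k); [auto|lia|].
  intros z Hz. specialize (HK0 (max K0 (S k)) ltac:(lia) z ltac:(lra)).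
  specialize (HB z ltac:(lra)). apply Rabs_le_between in HK0. lra.
Qed.

Lemma psum1_tail (a : nat -> C) (r B A : R) (z : C) (K K' : nat) :
  0 <= A < r -> 0 <= B -> Cmod z <= A -> (forall k, Cmod (a k) * r ^ S k <= 2 * B) -> (K <= K')%nat ->
  Cmod (psum1 a z K' - psum1 a z K) <= 2 * B * ((A / r) ^ S K / (1 - A / r)).
Proof.
  intros HA HB Hz Ha HK.
  assert (Hq : 0 <= A / r < 1).
  { split; [apply Rmult_le_pos; [lra|left; apply Rinv_0_lt_compat; lra]|].
    apply Rmult_lt_reg_r with r; [lra|]. unfold Rdiv. rewrite Rmult_assoc, Rinv_l; lra. }
  replace (2 * B * ((A / r) ^ S K / (1 - A / r))) with ((2 * B * (A / r)) * (A / r) ^ K / (1 - A / r))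
    by (simpl; field; split; lra).
  apply csum_tail_geom; auto.
  - apply Rmult_le_pos; lra.
  - intros k. rewrite Cmod_mult, Cmod_pow. specialize (Ha k).
    assert (Hrk : 0 < r ^ S k) by (apply pow_lt; lra).
    apply Rle_trans with (Cmod (a k) * A ^ S k).
    { apply Rmult_le_compat_l; [apply Cmod_ge_0|]. apply pow_incr; split; [apply Cmod_ge_0|auto]. }
    replace (2 * B * (A / r) * (A / r) ^ k) with (2 * B * (A / r) ^ S k) by (simpl; ring).
    unfold Rdiv. rewrite Rpow_mult_distr, pow_inv.
    replace (Cmod (a k) * A ^ S k) with ((Cmod (a k) * r ^ S k) * (A ^ S k * / r ^ S k)) by (field; lra).
    apply Rmult_le_compat_r; [|exact Ha].
    apply Rmult_le_pos; [apply pow_le; lra|left; apply Rinv_0_lt_compat; auto].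
Qed.

(** Stopping at [K] is compared with stopping at a much larger [K'], where the logarithm is already
    reached within [eta]. The terms in between are controlled by the coefficient bound alone, so the
    number of roots does not enter. *)
Lemma cprod1_log_tail (l : list C) (r B A : R) (z : C) (K : nat) : 0 <= A < r ->
  (forall z, Cmod z <= r -> cprod1 l z <> RtoC 0) ->
  (forall z, Cmod z <= r -> ln (Cmod (cprod1 l z)) <= B) ->
  Cmod z <= A ->
  Rabs (ln (Cmod (cprod1 l z)) - Re (psum1 (logcoef l) z K)) <= 2 * B * ((A / r) ^ S K / (1 - A / r)).
Proof.
  intros HA H HB Hz. assert (Hr : 0 < r) by lra.
  assert (Hc := cprod1_logcoef_bound l r B Hr H HB).
  assert (HB0 : 0 <= B).
  { specialize (Hc O). assert (0 <= Cmod (logcoef l 0) * r ^ 1); [|lra].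
    apply Rmult_le_pos; [apply Cmod_ge_0|apply pow_le; lra]. }
  apply le_epsilon; intros eta He.
  destruct (cprod1_log_approximation l r Hr H eta He) as [K0 HK0].
  set (K' := max K0 K). specialize (HK0 K' ltac:(lia) z ltac:(lra)).
  assert (T := psum1_tail (logcoef l) r B A z K K' HA HB0 Hz Hc ltac:(lia)).
  assert (R1 := re_le_Cmod (psum1 (logcoef l) z K' - psum1 (logcoef l) z K)%C).
  replace (Re (psum1 (logcoef l) z K' - psum1 (logcoef l) z K)%C) with
    (Re (psum1 (logcoef l) z K') - Re (psum1 (logcoef l) z K)) in R1.
  2:{ destruct (psum1 (logcoef l) z K'), (psum1 (logcoef l) z K); simpl; ring. }
  match goal with |- Rabs ?X <= _ => replace X with
    ((ln (Cmod (cprod1 l z)) - Re (psum1 (logcoef l) z K')) + (Re (psum1 (logcoef l) z K') - Re (psum1 (logcoef l) z K))) by ring end.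
  eapply Rle_trans; [apply Rabs_triang|]. lra.
Qed.

(** * Power series on a disc: uniform truncation, continuity, lower bounds, logarithms *)

Definition psum (b : nat -> C) (z : C) (N : nat) : C := csum (fun k => b k * z ^ k)%C N.

Lemma Cpow_lipschitz (r : R) (k : nat) : 0 <= r ->
  exists L, 0 <= L /\ forall z z', Cmod z <= r -> Cmod z' <= r -> Cmod (z ^ k - z' ^ k)%C <= L * Cmod (z - z').
Proof.
  intros Hr. induction k as [|k [L [HL IH]]].
  - exists 0; split; [lra|]. intros. simpl. replace (1 - 1)%C with (RtoC 0) by ring. rewrite Cmod_0; lra.
  - exists (r * L + r ^ k). split; [apply Rplus_le_le_0_compat; [apply Rmult_le_pos; auto|apply pow_le; auto]|].
    intros z z' Hz Hz'. rewrite !Cpow_S.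
    replace (z * z ^ k - z' * z' ^ k)%C with (z * (z ^ k - z' ^ k) + (z - z') * z' ^ k)%C by ring.
    eapply Rle_trans; [apply Cmod_triangle|]. rewrite !Cmod_mult, Cmod_pow.
    specialize (IH z z' Hz Hz').
    assert (Cmod z' ^ k <= r ^ k) by (apply pow_incr; split; [apply Cmod_ge_0|auto]).
    assert (H1 := Cmod_ge_0 z). assert (H2 := Cmod_ge_0 (z - z')).
    assert (H3 := Cmod_ge_0 (z ^ k - z' ^ k)). nra.
Qed.

Lemma psum_lipschitz (b : nat -> C) (r : R) (N : nat) : 0 <= r ->
  exists L, 0 <= L /\ forall z z', Cmod z <= r -> Cmod z' <= r -> Cmod (psum b z N - psum b z' N) <= L * Cmod (z - z').
Proof.
  intros Hr. induction N as [|N [L [HL IH]]].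
  - exists 0; split; [lra|]. intros. unfold psum; simpl. replace (0 - 0)%C with (RtoC 0) by ring. rewrite Cmod_0; lra.
  - destruct (Cpow_lipschitz r N Hr) as [L' [HL' H]].
    exists (L + Cmod (b N) * L'). split; [apply Rplus_le_le_0_compat; [auto|apply Rmult_le_pos; [apply Cmod_ge_0|auto]]|].
    intros z z' Hz Hz'. unfold psum in *; simpl.
    replace (csum (fun k => b k * z ^ k) N + b N * z ^ N - (csum (fun k => b k * z' ^ k) N + b N * z' ^ N))%C
     with ((csum (fun k => b k * z ^ k) N - csum (fun k => b k * z' ^ k) N) + b N * (z ^ N - z' ^ N))%C by ring.
    eapply Rle_trans; [apply Cmod_triangle|]. rewrite Cmod_mult.
    specialize (IH z z' Hz Hz'). specialize (H z z' Hz Hz').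
    assert (H1 := Cmod_ge_0 (b N)). nra.
Qed.

(* The last clause states with an explicit rate that [g] is the sum of the series [b]. *)
Definition power_sum_on (b : nat -> C) (C0 rho : R) (g : C -> C) : Prop :=
  0 < rho /\ 0 <= C0 /\ (forall k, Cmod (b k) * rho ^ k <= C0) /\
  forall z N, Cmod z < rho ->
    Cmod (g z - psum b z N) <= C0 * (Cmod z / rho) ^ N / (1 - Cmod z / rho).

Lemma ratio_bounds (x rho : R) : 0 < rho -> 0 <= x < rho -> 0 <= x / rho < 1.
Proof.
  intros Hr Hx. split; [apply Rmult_le_pos; [lra|left; apply Rinv_0_lt_compat; lra]|].
  apply Rmult_lt_reg_r with rho; [lra|]. unfold Rdiv. rewrite Rmult_assoc, Rinv_l; lra.
Qed.

Lemma power_sum_uniform b C0 rho g r : power_sum_on b C0 rho g -> 0 <= r < rho ->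
  forall eta, 0 < eta -> exists N0, forall N, (N0 <= N)%nat -> forall z, Cmod z <= r ->
    Cmod (g z - psum b z N) <= eta.
Proof.
  intros [Hrho [HC [Hb Hg]]] Hr eta He.
  assert (Hq := ratio_bounds r rho Hrho Hr).
  destruct (geom_eventually_small (C0 / (1 - r / rho)) (r / rho) eta Hq He) as [N0 HN0].
  exists N0; intros N HN z Hz. eapply Rle_trans; [apply Hg; lra|].
  eapply Rle_trans; [|apply (HN0 N HN)].
  assert (Hz0 := Cmod_ge_0 z). assert (Hqz := ratio_bounds (Cmod z) rho Hrho ltac:(lra)).
  assert (Hzr : Cmod z / rho <= r / rho) by (apply Rmult_le_compat_r; [left; apply Rinv_0_lt_compat; lra|lra]).
  replace (C0 / (1 - r / rho) * (r / rho) ^ N) with (C0 * (r / rho) ^ N / (1 - r / rho)) by (field; split; lra).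
  apply Rmult_le_compat.
  - apply Rmult_le_pos; [lra|apply pow_le; lra].
  - left; apply Rinv_0_lt_compat; lra.
  - apply Rmult_le_compat_l; [lra|apply pow_incr; lra].
  - apply Rinv_le_contravar; lra.
Qed.

Lemma power_sum_continuous b C0 rho g r : power_sum_on b C0 rho g -> 0 <= r < rho ->
  forall eta, 0 < eta -> exists d, 0 < d /\ forall z z', Cmod z <= r -> Cmod z' <= r ->
    Cmod (z - z') <= d -> Cmod (g z - g z') <= eta.
Proof.
  intros Hg Hr eta He.
  destruct (power_sum_uniform b C0 rho g r Hg Hr (eta / 3) ltac:(lra)) as [N HN].
  destruct (psum_lipschitz b r N ltac:(lra)) as [L [HL Hlip]].
  exists (eta / 3 / (L + 1)). split; [apply Rdiv_lt_0_compat; lra|].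
  intros z z' Hz Hz' Hd.
  assert (H1 := HN N ltac:(lia) z Hz). assert (H2 := HN N ltac:(lia) z' Hz').
  specialize (Hlip z z' Hz Hz').
  assert (H3 : L * Cmod (z - z') <= eta / 3).
  { apply Rle_trans with ((L + 1) * (eta / 3 / (L + 1))); [|right; field; lra].
    apply Rmult_le_compat; try lra. apply Cmod_ge_0. }
  replace (g z - g z')%C with ((g z - psum b z N) + ((psum b z N - psum b z' N) - (g z' - psum b z' N)))%C by ring.
  eapply Rle_trans; [apply Cmod_triangle|].
  assert (H4 := Cmod_triangle (psum b z N - psum b z' N) (- (g z' - psum b z' N))).
  rewrite Cmod_opp in H4. unfold Cminus at 1. unfold Cminus in *. lra.
Qed.

Lemma disc_lower_bound b C0 rho g r : power_sum_on b C0 rho g -> 0 <= r < rho ->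
  (forall z, Cmod z <= r -> g z <> RtoC 0) ->
  exists m, 0 < m /\ forall z, Cmod z <= r -> m <= Cmod (g z).
Proof.
  intros Hg Hr Hnz.
  (* A single number [d] is both the half-width of a box around [uv] and a lower bound for the
     modulus of [g] on the part of the box inside the disc. The uniform value supplied by
     compactness is then the desired [m]. *)
  assert (Hd : forall uv : R * R, exists d : posreal, forall x y,
    Rabs (x - fst uv) < d -> Rabs (y - snd uv) < d -> Cmod (x, y) <= r -> d <= Cmod (g (x, y))).
  { intros [u v]; simpl.
    assert (Hbox : forall x y d, Rabs (x - u) < d -> Rabs (y - v) < d -> Cmod ((x, y) - (u, v)) <= 2 * d).
    { intros x y d H1 H2. eapply Rle_trans; [apply Cmod_2Rmax|]. simpl.
      assert (Rmax (Rabs (x + - u)) (Rabs (y + - v)) <= d) by (apply Rmax_lub; left; auto).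
      assert (0 <= Rmax (Rabs (x + - u)) (Rabs (y + - v))).
      { eapply Rle_trans; [apply Rabs_pos|apply Rmax_l]. }
      assert (sqrt 2 <= 2). { rewrite <- (sqrt_Rsqr 2) at 2 by lra. apply sqrt_le_1_alt. unfold Rsqr; lra. }
      assert (H5 := sqrt_pos 2). nra. }
    destruct (Rle_lt_dec (Cmod (u, v)) r) as [H|H].
    - assert (Hm : 0 < Cmod (g (u, v))) by (apply Cmod_gt_0, Hnz, H).
      destruct (power_sum_continuous b C0 rho g r Hg Hr (Cmod (g (u, v)) / 2) ltac:(lra)) as [d [Hd Hc]].
      assert (Hp : 0 < Rmin (d / 2) (Cmod (g (u, v)) / 2)) by (apply Rmin_pos; lra).
      exists (mkposreal _ Hp); simpl; intros x y Hx Hy Hxy.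
      specialize (Hbox x y (d / 2)).
      assert (Hm1 := Rmin_l (d / 2) (Cmod (g (u, v)) / 2)). assert (Hm2 := Rmin_r (d / 2) (Cmod (g (u, v)) / 2)).
      specialize (Hc (x, y) (u, v) Hxy H ltac:(lra)).
      assert (T := Cmod_triangle_minus (g (x, y)) (g (u, v))). apply Rabs_le_between in T. lra.
    (* For a centre outside the disc the box is small enough to miss the disc, and the condition is
       vacuous. *)
    - assert (Hp : 0 < (Cmod (u, v) - r) / 4) by lra.
      exists (mkposreal _ Hp); simpl; intros x y Hx Hy Hxy.
      specialize (Hbox x y _ Hx Hy).
      assert (T := Cmod_triangle_minus (x, y) (u, v)). apply Rabs_le_between in T. lra. }
  set (delta := fun u v => proj1_sig (constructive_indefinite_description _ (Hd (u, v)))).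
  destruct (compactness_value_2d (- r) r (- r) r delta) as [d H].
  exists d; split; [apply cond_pos|]. intros [x y] Hz.
  assert (Hm := Rmax_Cmod (x, y)). simpl in Hm.
  assert (H1 : Rabs x <= r) by (eapply Rle_trans; [apply Rmax_l|eapply Rle_trans; [exact Hm|exact Hz]]).
  assert (H2 : Rabs y <= r) by (eapply Rle_trans; [apply Rmax_r|eapply Rle_trans; [exact Hm|exact Hz]]).
  apply Rabs_le_between in H1. apply Rabs_le_between in H2.
  specialize (H x y H1 H2). apply NNPP in H.
  destruct H as [u [v [_ [_ [Hx [Hy Hdd]]]]]].
  unfold delta in *.
  destruct (constructive_indefinite_description _ (Hd (u, v))) as [d' Hd']; simpl in *.
  eapply Rle_trans; [exact Hdd|]. apply Hd'; auto.
Qed.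

Lemma psum_bound b C0 rho r z N : 0 < rho -> 0 <= C0 -> (forall k, Cmod (b k) * rho ^ k <= C0) ->
  0 <= r < rho -> Cmod z <= r -> Cmod (psum b z N) <= C0 / (1 - r / rho).
Proof.
  intros Hrho HC Hb Hr Hz. assert (Hq := ratio_bounds r rho Hrho Hr).
  assert (H := csum_tail_geom (fun k => b k * z ^ k)%C C0 (r / rho) 0 N HC Hq).
  simpl in H. replace (csum (fun k => b k * z ^ k) N - 0)%C with (psum b z N) in H by (unfold psum; ring).
  rewrite Rmult_1_r in H. apply H; [|lia]. clear H.
  intros k. rewrite Cmod_mult, Cmod_pow.
  assert (Hk : 0 < rho ^ k) by (apply pow_lt; auto).
  apply Rle_trans with (Cmod (b k) * r ^ k).
  { apply Rmult_le_compat_l; [apply Cmod_ge_0|]. apply pow_incr; split; [apply Cmod_ge_0|auto]. }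
  unfold Rdiv. rewrite Rpow_mult_distr, pow_inv.
  replace (Cmod (b k) * r ^ k) with ((Cmod (b k) * rho ^ k) * (r ^ k * / rho ^ k)) by (field; lra).
  apply Rmult_le_compat_r; [|apply Hb].
  apply Rmult_le_pos; [apply pow_le; lra|left; apply Rinv_0_lt_compat; auto].
Qed.

Lemma psum1_minus a b z K : psum1 (fun k => a k - b k)%C z K = (psum1 a z K - psum1 b z K)%C.
Proof. unfold psum1. rewrite <- csum_minus. apply csum_ext; intros; ring. Qed.

Lemma Re_minus (x y : C) : Re (x - y)%C = Re x - Re y.
Proof. destruct x, y; simpl; ring. Qed.

Lemma psum1_diff_bound (a : nat -> C) (z : C) (K : nat) (c r0 A : R) :
  0 < r0 -> Cmod z <= A -> (forall k, (k < K)%nat -> Cmod (a k) * r0 ^ S k <= c) ->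
  Cmod (psum1 a z K) <= c * rsum (fun k => (A / r0) ^ S k) K.
Proof.
  intros Hr Hz Ha. eapply Rle_trans; [apply csum_Cmod|]. rewrite <- rsum_scal.
  apply rsum_le; intros k Hk. rewrite Cmod_mult, Cmod_pow.
  assert (Hk' : 0 < r0 ^ S k) by (apply pow_lt; auto). assert (H0 := Cmod_ge_0 z).
  apply Rle_trans with (Cmod (a k) * A ^ S k).
  { apply Rmult_le_compat_l; [apply Cmod_ge_0|]. apply pow_incr; split; [apply Cmod_ge_0|auto]. }
  unfold Rdiv. rewrite Rpow_mult_distr, pow_inv.
  replace (Cmod (a k) * A ^ S k) with ((Cmod (a k) * r0 ^ S k) * (A ^ S k * / r0 ^ S k)) by (field; lra).
  apply Rmult_le_compat_r; [|apply Ha, Hk].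
  apply Rmult_le_pos; [apply pow_le; lra|left; apply Rinv_0_lt_compat; auto].
Qed.

(* The truncations of [g] are polynomials without zeros on [|z| <= r] once they are long enough,
   so their logarithms are explicit power sums of inverse roots. *)
Theorem log_taylor_remainder (b a : nat -> C) (C0 rho r r0 : R) (g : C -> C) :
  power_sum_on b C0 rho g -> 0 < r0 <= r -> r < rho ->
  (forall z, Cmod z <= r -> g z <> RtoC 0) ->
  (forall eta, 0 < eta -> exists K0, forall K, (K0 <= K)%nat -> forall z, Cmod z = r0 ->
     Rabs (ln (Cmod (g z)) - ln (Cmod (b O)) - Re (psum1 a z K)) <= eta) ->
  forall (A : R) (x : C) (K : nat), 0 <= A < r -> Cmod x <= A ->
  Rabs (ln (Cmod (g x)) - ln (Cmod (b O)) - Re (psum1 a x K))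
    <= 2 * ln (C0 / (1 - r / rho) / Cmod (b O)) * ((A / r) ^ S K / (1 - A / r)).
Proof.
  intros Hg Hr0 Hr Hnz Ha A x K HA Hx.
  assert (Hg' := Hg). destruct Hg' as [Hrho [HC0 [Hb Hgz]]].
  assert (Hb0 : b O <> RtoC 0).
  { intros E. apply (Hnz (RtoC 0)); [rewrite Cmod_0; lra|].
    specialize (Hgz (RtoC 0) 1%nat ltac:(rewrite Cmod_0; lra)).
    rewrite Cmod_0 in Hgz. unfold psum in Hgz; simpl in Hgz. rewrite E in Hgz.
    replace (C0 * (0 / rho * 1) / (1 - 0 / rho)) with 0 in Hgz by (field; lra).
    replace (g 0 - (0 + 0 * 1))%C with (g (RtoC 0)) in Hgz by ring.
    apply Cmod_eq_0. assert (H := Cmod_ge_0 (g (RtoC 0))); lra. }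
  assert (Hb0m : 0 < Cmod (b O)) by (apply Cmod_gt_0; auto).
  destruct (disc_lower_bound b C0 rho g r Hg ltac:(lra) Hnz) as [m [Hm Hgm]].
  (* All truncations of the series are bounded by [C0 / (1 - r / rho)] on the disc, whatever their
     length, so [B] dominates the logarithm of each normalised truncation. *)
  set (B := ln (C0 / (1 - r / rho) / Cmod (b O))).
  set (S0 := rsum (fun k => (A / r0) ^ S k) K).
  assert (HS0 : 0 <= S0).
  { apply rsum_nonneg; intros; apply pow_le. apply Rmult_le_pos; [lra|left; apply Rinv_0_lt_compat; lra]. }
  apply le_epsilon; intros eps He.
  set (eta := eps / (2 + 6 * S0)).
  assert (Heta : 0 < eta) by (apply Rdiv_lt_0_compat; lra).
  (* Closeness [m / 2] keeps the truncation above [m / 2] in modulus; closeness [eta * (m / 2)] then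
     makes the two logarithms differ by at most [eta]. *)
  destruct (power_sum_uniform b C0 rho g r Hg ltac:(lra) (Rmin (m / 2) (eta * (m / 2)))) as [N0 HN0].
  { apply Rmin_pos; [lra|apply Rmult_lt_0_compat; lra]. }
  destruct (FundamentalTheorem.linear_factors N0 b Hb0) as [l Hl].
  assert (HP : forall z, Cmod z <= r -> Cmod (g z - b O * cprod1 l z) <= Rmin (m / 2) (eta * (m / 2))).
  { intros z Hz. rewrite <- Hl. apply (HN0 (S N0) ltac:(lia) z Hz). }
  assert (HPm : forall z, Cmod z <= r -> m / 2 <= Cmod (b O * cprod1 l z)).
  { intros z Hz. specialize (HP z Hz). specialize (Hgm z Hz).
    assert (H1 := Rmin_l (m / 2) (eta * (m / 2))).
    assert (T := Cmod_triangle_minus (g z) (b O * cprod1 l z)). apply Rabs_le_between in T. lra. }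
  assert (Hlnz : forall z, Cmod z <= r -> cprod1 l z <> RtoC 0).
  { intros z Hz E. specialize (HPm z Hz). rewrite E, Cmult_0_r, Cmod_0 in HPm. lra. }
  assert (Hlng : forall z, Cmod z <= r ->
    Rabs (ln (Cmod (g z)) - ln (Cmod (b O)) - ln (Cmod (cprod1 l z))) <= eta).
  { intros z Hz. replace (ln (Cmod (g z)) - ln (Cmod (b O)) - ln (Cmod (cprod1 l z))) with
      (ln (Cmod (g z)) - ln (Cmod (b O * cprod1 l z))) by (rewrite ln_Cmod_mult by auto; ring).
    specialize (HP z Hz). specialize (HPm z Hz). specialize (Hgm z Hz).
    eapply Rle_trans; [apply (ln_dist_le _ _ (m / 2)); lra|].
    assert (H1 := Rmin_r (m / 2) (eta * (m / 2))).
    apply Rle_trans with (eta * (m / 2) / (m / 2)); [|right; field; lra].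
    apply Rmult_le_compat_r; [left; apply Rinv_0_lt_compat; lra|].
    eapply Rle_trans; [apply Cmod_triangle_minus|lra]. }
  assert (HB : forall z, Cmod z <= r -> ln (Cmod (cprod1 l z)) <= B).
  { intros z Hz. unfold B. apply ln_le; [apply Cmod_gt_0; auto|].
    assert (H := psum_bound b C0 rho r z (S N0) Hrho HC0 Hb ltac:(lra) Hz).
    unfold psum in H. rewrite Hl, Cmod_mult in H.
    apply Rmult_le_reg_l with (Cmod (b O)); [auto|].
    eapply Rle_trans; [exact H|]. right; field; repeat split; lra. }
  (* On the small circle both series approximate logarithms that are themselves close: three errors
     [eta], doubled by [coeff_bound_of_Re_bound]. This transfers the information from radius [r0],
     where [a] is known, to the whole disc. *)
  assert (Hdiff : forall k, (k < K)%nat -> Cmod (logcoef l k - a k) * r0 ^ S k <= 6 * eta).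
  { intros k Hk. destruct (Ha eta Heta) as [K1 HK1].
    destruct (cprod1_log_approximation l r ltac:(lra) Hlnz eta Heta) as [K2 HK2].
    set (K' := max (max K1 K2) K).
    replace (6 * eta) with (2 * (3 * eta)) by ring.
    apply (coeff_bound_of_Re_bound (fun k => logcoef l k - a k)%C r0 (3 * eta) K' k); [lra|lia|].
    intros z Hz. rewrite psum1_minus, Re_minus.
    specialize (HK1 K' ltac:(lia) z Hz). specialize (HK2 K' ltac:(lia) z ltac:(lra)).
    specialize (Hlng z ltac:(lra)).
    apply Rabs_le_between in HK1. apply Rabs_le_between in HK2. apply Rabs_le_between in Hlng. lra. }
  assert (H1 := cprod1_log_tail l r B A x K HA Hlnz HB Hx).
  assert (H2 := Hlng x ltac:(lra)).
  assert (H3 := psum1_diff_bound (fun k => logcoef l k - a k)%C x K (6 * eta) r0 A ltac:(lra) Hx Hdiff).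
  rewrite psum1_minus in H3. fold S0 in H3.
  assert (H4 := re_le_Cmod (psum1 (logcoef l) x K - psum1 a x K)). rewrite Re_minus in H4.
  assert (H5 : eta + 6 * eta * S0 <= eps).
  { replace eps with (eta * (2 + 6 * S0)) by (unfold eta; field; lra). nra. }
  match goal with |- Rabs ?X <= _ => replace X with
    ((ln (Cmod (g x)) - ln (Cmod (b O)) - ln (Cmod (cprod1 l x))) +
     ((ln (Cmod (cprod1 l x)) - Re (psum1 (logcoef l) x K)) + (Re (psum1 (logcoef l) x K) - Re (psum1 a x K)))) by ring end.
  eapply Rle_trans; [apply Rabs_triang|].
  eapply Rle_trans; [apply Rplus_le_compat_l, Rabs_triang|]. lra.
Qed.

(** * The exponential and the Poisson distribution function *)

Definition cexp (w : C) : C := (exp (Re w) * cos (Im w), exp (Re w) * sin (Im w)).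

Lemma cexp_plus (x y : C) : cexp (x + y) = (cexp x * cexp y)%C.
Proof.
  destruct x as [a b], y as [c d]; unfold cexp; simpl.
  rewrite exp_plus, cos_plus, sin_plus. unfold Cmult; simpl. f_equal; ring.
Qed.

Lemma cexp_R (x : R) : cexp (RtoC x) = RtoC (exp x).
Proof. unfold cexp; simpl. rewrite cos_0, sin_0. unfold RtoC; f_equal; ring. Qed.

Lemma Cmod_cexp (w : C) : Cmod (cexp w) = exp (Re w).
Proof.
  assert (E : cexp w = (RtoC (exp (Re w)) * cis (Im w))%C).
  { unfold cexp, cis, Cmult; simpl; f_equal; ring. }
  rewrite E, Cmod_mult, Cmod_cis, Cmod_R, Rabs_pos_eq; [ring|]. left; apply exp_pos.
Qed.

Lemma INR_fact_pos n : 0 < INR (fact n).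
Proof. apply lt_0_INR, lt_O_fact. Qed.

Lemma is_derive_exp_sum (c : nat -> R) n t :
  is_derive (fun t => rsum (fun k => c k / INR (fact k) * t ^ k) (S n)) t
            (rsum (fun k => c (S k) / INR (fact k) * t ^ k) n).
Proof.
  induction n as [|n IH].
  - simpl. auto_derive; [auto|ring].
  - change (is_derive (fun t => plus (rsum (fun k => c k / INR (fact k) * t ^ k) (S n))
        (c (S n) / INR (fact (S n)) * t ^ S n)) t
       (plus (rsum (fun k => c (S k) / INR (fact k) * t ^ k) n) (c (S n) / INR (fact n) * t ^ n))).
    apply (is_derive_plus (V := R_NormedModule)); [exact IH|].
    evar_last; [apply is_derive_scal; apply is_derive_pow; apply is_derive_id|].
    change (c (S n) / INR (fact (S n)) * (INR (S n) * 1 * t ^ n) = c (S n) / INR (fact n) * t ^ n).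
    rewrite fact_simpl, mult_INR. field.
    split; [apply Rgt_not_eq, INR_fact_pos|apply not_0_INR; lia].
Qed.

(** Induction on [n], by differentiation in [t]: the derivative of the claim for [S n] and [u]
    follows from the claim for [n] and [u * w], and both sides agree at [t = 0]. This is why [u] is
    quantified inside. *)
Lemma Re_cexp_taylor_le (w : C) (n : nat) : forall (u : C) (t : R), 0 <= t ->
  Re (u * cexp (t * w))%C - rsum (fun k => Re (u * w ^ k)%C / INR (fact k) * t ^ k) n
   <= Cmod u * ((Cmod w) ^ n / INR (fact n) * t ^ n * exp (t * Cmod w)).
Proof.
  induction n as [|n IH]; intros u t Ht.
  - simpl rsum. simpl fact. rewrite !pow_O.
    replace (Cmod u * (1 / INR 1 * 1 * exp (t * Cmod w))) with (Cmod u * exp (t * Cmod w)) by (simpl; field).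
    rewrite Rminus_0_r. eapply Rle_trans; [apply Re_le_Cmod|].
    rewrite Cmod_mult, Cmod_cexp. apply Rmult_le_compat_l; [apply Cmod_ge_0|].
    rewrite Re_mult_scal. assert (H := Re_le_Cmod w).
    assert (E : t * Re w <= t * Cmod w) by (apply Rmult_le_compat_l; auto).
    destruct E as [E| ->]; [left; apply exp_increasing, E|right; reflexivity].
  - set (F := fun t : R => Re (u * cexp (t * w))%C - rsum (fun k => Re (u * w ^ k)%C / INR (fact k) * t ^ k) (S n)
         - Cmod u * ((Cmod w) ^ S n / INR (fact (S n)) * t ^ S n * exp (t * Cmod w))).
    set (F' := fun t : R => Re (u * w * cexp (t * w))%C - rsum (fun k => Re (u * w ^ S k)%C / INR (fact k) * t ^ k) n
         - Cmod u * (((Cmod w) ^ S n / INR (fact n) * t ^ n + (Cmod w) ^ S n / INR (fact (S n)) * t ^ S n * Cmod w) * exp (t * Cmod w))).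
    assert (HF : forall t, is_derive F t (F' t)).
    { intros s. unfold F, F'.
      apply (is_derive_minus (V := R_NormedModule)); [apply (is_derive_minus (V := R_NormedModule))|].
      - destruct u as [u1 u2], w as [a b].
        apply (is_derive_ext (fun t => u1 * (exp (t * a) * cos (t * b)) - u2 * (exp (t * a) * sin (t * b)))).
        { intros x. unfold cexp; simpl.
          replace (x * a - 0 * b) with (x * a) by ring. replace (x * b + 0 * a) with (x * b) by ring. reflexivity. }
        unfold cexp; simpl.
        replace (s * a - 0 * b) with (s * a) by ring. replace (s * b + 0 * a) with (s * b) by ring.
        auto_derive; [auto|ring].
      - apply (is_derive_exp_sum (fun k => Re (u * w ^ k)%C)).
      - apply is_derive_scal.
        evar_last.
        { apply (is_derive_mult (fun t => (Cmod w) ^ S n / INR (fact (S n)) * t ^ S n) (fun t => exp (t * Cmod w))).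
          - apply is_derive_scal; apply is_derive_pow; apply is_derive_id.
          - auto_derive; [auto|reflexivity].
          - intros; apply Rmult_comm. }
        change ((Cmod w) ^ S n / INR (fact (S n)) * (INR (S n) * 1 * s ^ n) * exp (s * Cmod w) +
                (Cmod w) ^ S n / INR (fact (S n)) * s ^ S n * (1 * Cmod w * exp (s * Cmod w)) =
                ((Cmod w) ^ S n / INR (fact n) * s ^ n + (Cmod w) ^ S n / INR (fact (S n)) * s ^ S n * Cmod w) * exp (s * Cmod w)).
        rewrite fact_simpl, mult_INR. field.
        split; [apply Rgt_not_eq, INR_fact_pos|apply not_0_INR; lia]. }
    assert (HF' : forall t, 0 <= t -> F' t <= 0).
    { intros s Hs. unfold F'. specialize (IH (u * w)%C s Hs).
      rewrite (rsum_ext _ (fun k => Re (u * w ^ S k)%C / INR (fact k) * s ^ k)) in IH.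
      2:{ intros k _. rewrite Cpow_S. do 3 f_equal. ring. }
      rewrite Cmod_mult in IH.
      assert (H1 : 0 <= Cmod u * (Cmod w ^ S n / INR (fact (S n)) * s ^ S n * Cmod w * exp (s * Cmod w))).
      { apply Rmult_le_pos; [apply Cmod_ge_0|]. apply Rmult_le_pos; [|left; apply exp_pos].
        apply Rmult_le_pos; [|apply Cmod_ge_0]. apply Rmult_le_pos; [|apply pow_le; auto].
        apply Rmult_le_pos; [apply pow_le, Cmod_ge_0|left; apply Rinv_0_lt_compat, INR_fact_pos]. }
      assert (E : Cmod u * Cmod w * (Cmod w ^ n / INR (fact n) * s ^ n * exp (s * Cmod w)) =
                  Cmod u * (Cmod w ^ S n / INR (fact n) * s ^ n * exp (s * Cmod w))).
      { simpl (Cmod w ^ S n). unfold Rdiv. ring. }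
      lra. }
    assert (F0 : F 0 = 0).
    { unfold F. rewrite rsum_shift, rsum_zero.
      - rewrite (pow_ne_zero (S n)) by lia.
        replace (0 * w)%C with (RtoC 0) by ring.
        rewrite cexp_R, exp_0, pow_O. change (INR (fact 0)) with 1. change (w ^ 0)%C with (RtoC 1).
        unfold Rdiv. rewrite Rinv_1. ring.
      - intros k _. rewrite (pow_ne_zero (S k)) by lia; ring. }
    destruct Ht as [Ht|Ht].
    + destruct (MVT_gen F 0 t F') as [c [Hc E]].
      { intros; apply HF. }
      { intros x _. apply derivable_continuous_pt. exists (F' x). apply is_derive_Reals, HF. }
      rewrite Rmin_left, Rmax_right in Hc by lra. specialize (HF' c ltac:(lra)).
      unfold F in E at 1. nra.
    + subst t. unfold F in F0. lra.
Qed.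

Lemma cexp_taylor (w : C) (n : nat) :
  Cmod (cexp w - csum (fun k => w ^ k / INR (fact k))%C n) <= Cmod w ^ n / INR (fact n) * exp (Cmod w).
Proof.
  set (R := (cexp w - csum (fun k => w ^ k / INR (fact k))%C n)%C).
  assert (Hf : forall k, RtoC (INR (fact k)) <> RtoC 0).
  { intros k E. apply RtoC_inj in E. assert (H := INR_fact_pos k); lra. }
  assert (Hpos : 0 <= Cmod w ^ n / INR (fact n) * exp (Cmod w)).
  { apply Rmult_le_pos; [|left; apply exp_pos]. apply Rmult_le_pos; [apply pow_le, Cmod_ge_0|].
    left; apply Rinv_0_lt_compat, INR_fact_pos. }
  destruct (Ceq_dec R 0) as [E|E]; [rewrite E, Cmod_0; auto|].
  assert (Hm : 0 < Cmod R) by (apply Cmod_gt_0; auto).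
  (* Taking for [u] the conjugate of the remainder turns the real part into the squared modulus of
     the remainder. *)
  assert (H := Re_cexp_taylor_le w n (Cconj R) 1 ltac:(lra)).
  replace (1 * w)%C with w in H by ring. rewrite Rmult_1_l, pow1, Rmult_1_r, Cmod_conj in H.
  rewrite (rsum_ext _ (fun k => Re (Cconj R * (w ^ k / INR (fact k)))%C)) in H.
  2:{ intros k _. rewrite pow1, Rmult_1_r.
      replace (Cconj R * (w ^ k / INR (fact k)))%C with (RtoC (/ INR (fact k)) * (Cconj R * w ^ k))%C.
      - rewrite Re_mult_scal. unfold Rdiv; ring.
      - rewrite RtoC_inv by (apply Rgt_not_eq, INR_fact_pos). field. apply Hf. }
  rewrite <- csum_Re, csum_scal, <- Re_minus in H.
  replace (Cconj R * cexp w - Cconj R * csum (fun k => w ^ k / INR (fact k)) n)%C with (R * Cconj R)%C in H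
    by (unfold R; ring).
  rewrite <- Cmod2_conj in H.
  change (Re (RtoC (Cmod R ^ 2))) with (Cmod R ^ 2) in H.
  apply Rmult_le_reg_l with (Cmod R); [auto|]. simpl in H. lra.
Qed.

(* The probability that a Poisson variable of mean [x] is less than [K]. *)
Definition pois (K : nat) (x : R) : R := exp (- x) * rsum (fun j => x ^ j / INR (fact j)) K.

Lemma pois_step k x : pois (S k) x - pois k x = exp (- x) * (x ^ k / INR (fact k)).
Proof. unfold pois; simpl; ring. Qed.

Lemma is_derive_pois K x : is_derive (pois (S K)) x (- (exp (- x) * (x ^ K / INR (fact K)))).
Proof.
  unfold pois. evar_last.
  { apply (is_derive_mult (fun x => exp (- x)) (fun x => rsum (fun j => x ^ j / INR (fact j)) (S K))).
    - auto_derive; [auto|reflexivity].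
    - apply (is_derive_ext (fun t => rsum (fun k => (fun _ => 1) k / INR (fact k) * t ^ k) (S K))).
      { intros t; apply rsum_ext; intros; unfold Rdiv; ring. }
      apply (is_derive_exp_sum (fun _ => 1)).
    - intros; apply Rmult_comm. }
  change (- (1) * exp (- x) * rsum (fun j => x ^ j / INR (fact j)) (S K) +
          exp (- x) * rsum (fun k => 1 / INR (fact k) * x ^ k) K = - (exp (- x) * (x ^ K / INR (fact K)))).
  simpl rsum. rewrite (rsum_ext (fun k => 1 / INR (fact k) * x ^ k) (fun j => x ^ j / INR (fact j)))
    by (intros; unfold Rdiv; ring). ring.
Qed.

Lemma exp_term_nonneg k x : 0 <= x -> 0 <= x ^ k / INR (fact k).
Proof. intros Hx. apply Rmult_le_pos; [apply pow_le; auto|left; apply Rinv_0_lt_compat, INR_fact_pos]. Qed.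

Lemma pois_decr K x y : 0 <= x -> x <= y -> pois K y <= pois K x.
Proof.
  intros Hx Hxy. destruct K as [|K]; [unfold pois; simpl; lra|].
  destruct Hxy as [Hxy|Hxy]; [|subst; lra].
  destruct (MVT_gen (pois (S K)) x y (fun x => - (exp (- x) * (x ^ K / INR (fact K))))) as [c [Hc E]].
  { intros; apply is_derive_pois. }
  { intros t _. apply derivable_continuous_pt.
    exists (- (exp (- t) * (t ^ K / INR (fact K)))). apply is_derive_Reals, is_derive_pois. }
  rewrite Rmin_left, Rmax_right in Hc by lra.
  assert (H := exp_pos (- c)). assert (H2 := exp_term_nonneg K c ltac:(lra)).
  assert (H3 := Rmult_le_pos _ _ (Rmult_le_pos _ _ (Rlt_le _ _ H) H2) (Rlt_le _ _ (Rlt_Rminus _ _ Hxy))).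
  lra.
Qed.

Lemma pois_nonneg K x : 0 <= x -> 0 <= pois K x.
Proof.
  intros Hx; apply Rmult_le_pos; [left; apply exp_pos|]. apply rsum_nonneg; intros; apply exp_term_nonneg; auto.
Qed.

Lemma pois_le_1 K x : 0 <= x -> pois K x <= 1.
Proof.
  intros Hx. eapply Rle_trans; [apply (pois_decr K 0 x); lra|].
  unfold pois. rewrite Ropp_0, exp_0. destruct K as [|K]; [simpl; lra|].
  rewrite rsum_shift, rsum_zero; [simpl; lra|].
  intros k _. rewrite pow_ne_zero by lia. unfold Rdiv; ring.
Qed.

(** After multiplication by [exp (- x)] the left side is the probability of one value of a Poisson
    variable, hence at most 1. *)
Lemma exp_term_le_exp k x : 0 <= x -> x ^ k / INR (fact k) <= exp x.
Proof.
  intros Hx. assert (H := pois_step k x). assert (H1 := pois_le_1 (S k) x Hx).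
  assert (H2 := pois_nonneg k x Hx).
  apply Rmult_le_reg_l with (exp (- x)); [apply exp_pos|].
  rewrite <- exp_plus. replace (- x + x) with 0 by ring. rewrite exp_0. lra.
Qed.

(** The factor [exp (- x)] cancels the [exp x] of the Taylor remainder, which leaves the lower bound
    [1 - x ^ K / K!]. *)
Lemma pois_lim_1 x : 0 <= x -> is_lim_seq (fun K => pois K x) 1.
Proof.
  intros Hx.
  apply (is_lim_seq_le_le (fun K => 1 - x ^ K / INR (fact K)) _ (fun _ => 1)).
  - intros K; split; [|apply pois_le_1; auto].
    assert (H := cexp_taylor (RtoC x) K).
    rewrite cexp_R, Cmod_R, Rabs_pos_eq in H by auto.
    rewrite (csum_ext _ (fun k => RtoC (x ^ k / INR (fact k)))) in H.
    2:{ intros k _. unfold Rdiv, Cdiv. rewrite RtoC_mult, RtoC_pow, RtoC_inv; [reflexivity|].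
        apply Rgt_not_eq, INR_fact_pos. }
    rewrite csum_RtoC, <- RtoC_minus, Cmod_R in H. apply Rabs_le_between in H.
    unfold pois. assert (E : exp (- x) * exp x = 1) by (rewrite <- exp_plus; replace (- x + x) with 0 by ring; apply exp_0).
    assert (Hp := exp_pos (- x)). 
    assert (H' : exp (- x) * exp x - exp (- x) * rsum (fun j => x ^ j / INR (fact j)) K
                 <= exp (- x) * exp x * (x ^ K / INR (fact K))).
    { rewrite <- Rmult_minus_distr_l, Rmult_assoc. apply Rmult_le_compat_l; lra. }
    rewrite E in H'. lra.
  - replace (Finite 1) with (Finite (1 - 0)) by (f_equal; ring).
    apply is_lim_seq_minus'; [apply is_lim_seq_const|].
    apply is_lim_seq_Reals. apply (cv_speed_pow_fact x).
  - apply is_lim_seq_const.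
Qed.

(** * Limits of complex sequences *)

Definition Clim (u : nat -> C) (l : C) : Prop :=
  forall eps, 0 < eps -> exists N0, forall n, (N0 <= n)%nat -> Cmod (u n - l) <= eps.

Lemma is_lim_seq_of_eps (u : nat -> R) (l : R) :
  (forall eps, 0 < eps -> exists N0, forall n, (N0 <= n)%nat -> Rabs (u n - l) <= eps) -> is_lim_seq u l.
Proof.
  intros H. apply is_lim_seq_Reals. intros eps He.
  destruct (H (eps / 2) ltac:(lra)) as [N0 HN]. exists N0; intros n Hn.
  unfold R_dist. specialize (HN n Hn). lra.
Qed.

Lemma is_lim_seq_eps (u : nat -> R) (l : R) : is_lim_seq u l ->
  forall eps, 0 < eps -> exists N0, forall n, (N0 <= n)%nat -> Rabs (u n - l) <= eps.
Proof.
  intros H eps He. apply is_lim_seq_Reals in H. destruct (H eps He) as [N0 HN].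
  exists N0; intros n Hn. left; apply (HN n Hn).
Qed.

Lemma Clim_Cmod u l : Clim u l -> is_lim_seq (fun n => Cmod (u n)) (Cmod l).
Proof.
  intros H; apply is_lim_seq_of_eps; intros eps He. destruct (H eps He) as [N0 HN].
  exists N0; intros n Hn. eapply Rle_trans; [apply Cmod_triangle_minus|auto].
Qed.

Lemma Clim_Re u l : Clim u l -> is_lim_seq (fun n => Re (u n)) (Re l).
Proof.
  intros H; apply is_lim_seq_of_eps; intros eps He. destruct (H eps He) as [N0 HN].
  exists N0; intros n Hn. rewrite <- Re_minus. eapply Rle_trans; [apply re_le_Cmod|auto].
Qed.

Lemma Cmod_le_Re_Im (z : C) : Cmod z <= Rabs (Re z) + Rabs (Im z).
Proof.
  destruct z as [a b]. replace (a, b) with (RtoC a + Ci * RtoC b)%C by (unfold RtoC, Ci, Cmult, Cplus; simpl; f_equal; ring).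
  eapply Rle_trans; [apply Cmod_triangle|]. rewrite Cmod_mult, Cmod_Ci, !Cmod_R. simpl.
  replace (a + (0 * b - 1 * 0)) with a by ring. replace (0 + (0 * 0 + 1 * b)) with b by ring. lra.
Qed.

Lemma Im_minus (x y : C) : Im (x - y)%C = Im x - Im y.
Proof. destruct x, y; simpl; ring. Qed.

Lemma Im_le_Cmod (z : C) : Rabs (Im z) <= Cmod z.
Proof. eapply Rle_trans; [|apply Rmax_Cmod]. apply Rmax_r. Qed.

Lemma Clim_Re_Im u l : is_lim_seq (fun n => Re (u n)) (Re l) -> is_lim_seq (fun n => Im (u n)) (Im l) -> Clim u l.
Proof.
  intros H1 H2 eps He.
  destruct (is_lim_seq_eps _ _ H1 (eps / 2) ltac:(lra)) as [N1 HN1].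
  destruct (is_lim_seq_eps _ _ H2 (eps / 2) ltac:(lra)) as [N2 HN2].
  exists (max N1 N2); intros n Hn. eapply Rle_trans; [apply Cmod_le_Re_Im|].
  rewrite Re_minus, Im_minus. specialize (HN1 n ltac:(lia)). specialize (HN2 n ltac:(lia)). lra.
Qed.

Lemma Clim_Im u l : Clim u l -> is_lim_seq (fun n => Im (u n)) (Im l).
Proof.
  intros H; apply is_lim_seq_of_eps; intros eps He. destruct (H eps He) as [N0 HN].
  exists N0; intros n Hn. rewrite <- Im_minus. eapply Rle_trans; [apply Im_le_Cmod|auto].
Qed.

Lemma Clim_unique u l l' : Clim u l -> Clim u l' -> l = l'.
Proof.
  intros H H'. assert (E : Cmod (l - l') <= 0).
  { apply le_epsilon; intros eps He.
    destruct (H (eps / 2) ltac:(lra)) as [N1 HN1]. destruct (H' (eps / 2) ltac:(lra)) as [N2 HN2].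
    specialize (HN1 (max N1 N2) ltac:(lia)). specialize (HN2 (max N1 N2) ltac:(lia)).
    set (x := u (max N1 N2)) in *.
    replace (l - l')%C with (- (x - l) + (x - l'))%C by ring.
    eapply Rle_trans; [apply Cmod_triangle|]. rewrite Cmod_opp. lra. }
  assert (E' : (l - l')%C = RtoC 0) by (apply Cmod_eq_0; assert (H2 := Cmod_ge_0 (l - l')); lra).
  replace l with ((l - l') + l')%C by ring. rewrite E'; ring.
Qed.

Lemma Clim_plus u v l m : Clim u l -> Clim v m -> Clim (fun n => u n + v n)%C (l + m)%C.
Proof.
  intros H H' eps He.
  destruct (H (eps / 2) ltac:(lra)) as [N1 HN1]. destruct (H' (eps / 2) ltac:(lra)) as [N2 HN2].
  exists (max N1 N2); intros n Hn. specialize (HN1 n ltac:(lia)). specialize (HN2 n ltac:(lia)).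
  replace (u n + v n - (l + m))%C with ((u n - l) + (v n - m))%C by ring.
  eapply Rle_trans; [apply Cmod_triangle|]. lra.
Qed.

Lemma Clim_scal c u l : Clim u l -> Clim (fun n => c * u n)%C (c * l)%C.
Proof.
  intros H eps He. assert (Hc := Cmod_ge_0 c).
  destruct (H (eps / (Cmod c + 1))) as [N1 HN1]; [apply Rdiv_lt_0_compat; lra|].
  exists N1; intros n Hn. specialize (HN1 n Hn).
  replace (c * u n - c * l)%C with (c * (u n - l))%C by ring. rewrite Cmod_mult.
  apply Rle_trans with ((Cmod c + 1) * (eps / (Cmod c + 1))); [|right; field; lra].
  apply Rmult_le_compat; try lra. apply Cmod_ge_0.
Qed.

Lemma Clim_ext u v l : (forall n, u n = v n) -> Clim u l -> Clim v l.
Proof. intros E H eps He. destruct (H eps He) as [N HN]. exists N; intros n Hn. rewrite <- E; auto. Qed.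

Lemma Clim_const c : Clim (fun _ => c) c.
Proof. intros eps He. exists O; intros. replace (c - c)%C with (RtoC 0) by ring. rewrite Cmod_0; lra. Qed.

Lemma Clim_subseq u l (phi : nat -> nat) : (forall n, (n <= phi n)%nat) -> Clim u l -> Clim (fun n => u (phi n)) l.
Proof.
  intros Hp H eps He. destruct (H eps He) as [N HN]. exists N; intros n Hn. apply HN.
  specialize (Hp n); lia.
Qed.

Lemma Clim_Cmod_le u l c x : Clim u l -> (exists N0, forall n, (N0 <= n)%nat -> Cmod (u n - x) <= c) -> Cmod (l - x) <= c.
Proof.
  intros H [N0 Hc]. apply le_epsilon; intros eps He. destruct (H eps He) as [N HN].
  specialize (HN (max N N0) ltac:(lia)). specialize (Hc (max N N0) ltac:(lia)).
  replace (l - x)%C with ((u (max N N0) - x) + - (u (max N N0) - l))%C by ring.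
  eapply Rle_trans; [apply Cmod_triangle|]. rewrite Cmod_opp. lra.
Qed.

(** Shaped like [CSeries1] up to the index shift, so that [Lfun] unfolds to it by conversion. *)
Definition cseries (f : nat -> C) : C := (Series (fun n => Re (f n)), Series (fun n => Im (f n))).

Lemma Clim_cseries f l : Clim (csum f) l -> cseries f = l.
Proof.
  intros H. unfold cseries. destruct l as [a b]. f_equal; apply is_series_unique.
  - change (is_lim_seq (sum_n (fun n => Re (f n))) a).
    apply (is_lim_seq_ext (fun n => Re (csum f (S n)))).
    { intros n. rewrite csum_Re, rsum_sum_n; reflexivity. }
    apply -> (is_lim_seq_incr_1 (fun n => Re (csum f n))). apply (Clim_Re _ (a, b) H).
  - change (is_lim_seq (sum_n (fun n => Im (f n))) b).
    apply (is_lim_seq_ext (fun n => Im (csum f (S n)))).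
    { intros n. rewrite csum_Im, rsum_sum_n; reflexivity. }
    apply -> (is_lim_seq_incr_1 (fun n => Im (csum f n))). apply (Clim_Im _ (a, b) H).
Qed.

Lemma ex_series_of_bounded (f : nat -> R) M : (forall n, 0 <= f n) -> (forall N, rsum f N <= M) -> ex_series f.
Proof.
  intros Hf HM.
  destruct (ex_finite_lim_seq_incr (fun n => rsum f (S n)) M) as [l Hl].
  - intros n. simpl. specialize (Hf (S n)). lra.
  - intros n; apply HM.
  - exists l. change (is_lim_seq (sum_n f) l). apply (is_lim_seq_ext (fun n => rsum f (S n))); [|exact Hl].
    intros n; rewrite rsum_sum_n; reflexivity.
Qed.

Lemma Series_lim (f : nat -> R) : ex_series f -> is_lim_seq (rsum f) (Series f).
Proof.
  intros H. apply is_lim_seq_incr_1. apply (is_lim_seq_ext (sum_n f)).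
  - intros n; apply rsum_sum_n.
  - change (is_series f (Series f)). apply Series_correct, H.
Qed.

Lemma cseries_converges f M : (forall N, rsum (fun n => Cmod (f n)) N <= M) -> Clim (csum f) (cseries f).
Proof.
  intros HM.
  assert (H : ex_series (fun n => Cmod (f n))) by (apply (ex_series_of_bounded _ M); auto; intros; apply Cmod_ge_0).
  apply Clim_Re_Im.
  - apply (is_lim_seq_ext (rsum (fun n => Re (f n)))); [intros; rewrite csum_Re; reflexivity|].
    apply Series_lim. apply (ex_series_le (K := R_AbsRing) (V := R_CompleteNormedModule)) with (2 := H).
    intros n; apply re_le_Cmod.
  - apply (is_lim_seq_ext (rsum (fun n => Im (f n)))); [intros; rewrite csum_Im; reflexivity|].
    apply Series_lim. apply (ex_series_le (K := R_AbsRing) (V := R_CompleteNormedModule)) with (2 := H).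
    intros n; apply Im_le_Cmod.
Qed.

Lemma coeff_geom_bound (x c rho r : R) (z : C) k : 0 < rho -> 0 <= x -> x * rho ^ k <= c -> Cmod z <= r ->
  x * Cmod z ^ k <= c * (r / rho) ^ k.
Proof.
  intros Hrho Hx Hb Hz. assert (Hk : 0 < rho ^ k) by (apply pow_lt; auto).
  assert (H0 := Cmod_ge_0 z).
  apply Rle_trans with (x * r ^ k).
  { apply Rmult_le_compat_l; [auto|]. apply pow_incr; split; auto. }
  unfold Rdiv. rewrite Rpow_mult_distr, pow_inv.
  replace (x * r ^ k) with ((x * rho ^ k) * (r ^ k * / rho ^ k)) by (field; lra).
  apply Rmult_le_compat_r; [|auto].
  apply Rmult_le_pos; [apply pow_le; lra|left; apply Rinv_0_lt_compat; auto].
Qed.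

Lemma psum_tail b C0 rho z K K' : 0 < rho -> 0 <= C0 -> (forall k, Cmod (b k) * rho ^ k <= C0) ->
  Cmod z < rho -> (K <= K')%nat ->
  Cmod (psum b z K' - psum b z K) <= C0 * (Cmod z / rho) ^ K / (1 - Cmod z / rho).
Proof.
  intros Hrho HC Hb Hz HK. apply csum_tail_geom; auto.
  - apply ratio_bounds; auto. split; [apply Cmod_ge_0|auto].
  - intros k. rewrite Cmod_mult, Cmod_pow. apply coeff_geom_bound; auto; try lra. apply Cmod_ge_0.
Qed.

Lemma power_sum_on_cseries b C0 rho : 0 < rho -> 0 <= C0 -> (forall k, Cmod (b k) * rho ^ k <= C0) ->
  power_sum_on b C0 rho (fun z => cseries (fun k => b k * z ^ k)%C).
Proof.
  intros Hrho HC Hb. split; [auto|split; [auto|split; [auto|]]].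
  intros z N Hz. assert (Hq := ratio_bounds (Cmod z) rho Hrho (conj (Cmod_ge_0 z) Hz)).
  apply (Clim_Cmod_le (psum b z)).
  - apply (cseries_converges _ (C0 / (1 - Cmod z / rho))). intros M.
    apply Rle_trans with (rsum (fun k => C0 * (Cmod z / rho) ^ k) M).
    + apply rsum_le; intros k _. rewrite Cmod_mult, Cmod_pow. apply coeff_geom_bound; auto; try lra. apply Cmod_ge_0.
    + rewrite rsum_scal. apply Rmult_le_compat_l; [auto|]. apply rsum_geom_le; auto.
  - exists N; intros n Hn. apply psum_tail; auto.
Qed.

(** An exchange of limits: the bound [C0] is uniform in [N], so all tails beyond a fixed [K] are
    small together, and the first [K] coefficients converge. It is applied with [D N] a finite
    Dirichlet sum, an entire function whose coefficients [b k N] converge with [N]. *)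
Lemma power_series_tannery (b : nat -> nat -> C) (beta : nat -> C) (D : nat -> C) (C0 rho : R) (z : C) :
  0 < rho -> 0 <= C0 -> Cmod z < rho ->
  (forall k, Clim (b k) (beta k)) ->
  (forall k N, Cmod (b k N) * rho ^ k <= C0) ->
  (forall N, Clim (psum (fun k => b k N) z) (D N)) ->
  Clim D (cseries (fun k => beta k * z ^ k)%C).
Proof.
  intros Hrho HC Hz Hb HbC HD eps He.
  assert (Hq := ratio_bounds (Cmod z) rho Hrho (conj (Cmod_ge_0 z) Hz)).
  assert (HbetaC : forall k, Cmod (beta k) * rho ^ k <= C0).
  { intros k. assert (Hk : 0 < rho ^ k) by (apply pow_lt; auto).
    apply Rmult_le_reg_r with (/ rho ^ k); [apply Rinv_0_lt_compat; auto|].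
    rewrite Rmult_assoc, Rinv_r, Rmult_1_r by lra.
    replace (beta k) with (beta k - 0)%C by ring.
    apply (Clim_Cmod_le (b k)); [apply Hb|]. exists O; intros n _. replace (b k n - 0)%C with (b k n) by ring.
    apply Rmult_le_reg_r with (rho ^ k); [auto|]. rewrite Rmult_assoc, Rinv_l, Rmult_1_r by lra. apply HbC. }
  destruct (geom_eventually_small (C0 / (1 - Cmod z / rho)) (Cmod z / rho) (eps / 3) Hq ltac:(lra)) as [K HK].
  specialize (HK K ltac:(lia)).
  replace (C0 / (1 - Cmod z / rho) * (Cmod z / rho) ^ K) with (C0 * (Cmod z / rho) ^ K / (1 - Cmod z / rho)) in HK by (unfold Rdiv; ring).
  assert (Hpart : Clim (fun N => psum (fun k => b k N) z K) (psum beta z K)).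
  { clear HK. induction K as [|K IH]; [apply (Clim_const (RtoC 0))|].
    unfold psum in *; simpl. apply Clim_plus; [exact IH|].
    apply (Clim_ext (fun N => z ^ K * b K N)%C); [intros; ring|].
    replace (beta K * z ^ K)%C with (z ^ K * beta K)%C by ring. apply Clim_scal, Hb. }
  destruct (Hpart (eps / 3) ltac:(lra)) as [N0 HN0].
  exists N0; intros N HN. specialize (HN0 N HN).
  assert (H1 : Cmod (D N - psum (fun k => b k N) z K) <= eps / 3).
  { eapply Rle_trans; [|exact HK]. apply (Clim_Cmod_le _ _ _ _ (HD N)).
    exists K; intros n Hn. apply psum_tail; auto. }
  destruct (power_sum_on_cseries beta C0 rho Hrho HC HbetaC) as [_ [_ [_ H2]]].
  specialize (H2 z K Hz). 
  set (g := cseries (fun k => beta k * z ^ k)%C) in *.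
  replace (D N - g)%C with ((D N - psum (fun k => b k N) z K) + ((psum (fun k => b k N) z K - psum beta z K) + - (g - psum beta z K)))%C by ring.
  eapply Rle_trans; [apply Cmod_triangle|]. eapply Rle_trans; [apply Rplus_le_compat_l, Cmod_triangle|].
  rewrite Cmod_opp. lra.
Qed.

(** * Dirichlet series as power series *)

(* Sums are indexed from 0: below, the index [n] stands for the integer [n + 1]. *)
Definition lnS (n : nat) : R := ln (INR (S n)).

Lemma INR_S_ge_1 n : 1 <= INR (S n).
Proof. rewrite S_INR. assert (H := pos_INR n). lra. Qed.

Lemma exp_le x y : x <= y -> exp x <= exp y.
Proof. intros [H| ->]; [left; apply exp_increasing, H|lra]. Qed.

Lemma lnS_nonneg n : 0 <= lnS n.
Proof. unfold lnS. rewrite <- ln_1. apply ln_le; [lra|apply INR_S_ge_1]. Qed.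

Lemma lnS_mono m n : (m <= n)%nat -> lnS m <= lnS n.
Proof. intros H. apply ln_le; [assert (H1 := INR_S_ge_1 m); lra|]. apply le_INR; lia. Qed.

Definition npowR (sigma : R) (n : nat) : R := exp (- sigma * lnS n).

Lemma npowR_pos sigma n : 0 < npowR sigma n.
Proof. apply exp_pos. Qed.

Lemma npowR_0 sigma : npowR sigma 0 = 1.
Proof. unfold npowR, lnS. simpl INR. rewrite ln_1, Rmult_0_r. apply exp_0. Qed.

Lemma npowR_mono sigma tau n : sigma <= tau -> npowR tau n <= npowR sigma n.
Proof. intros H. apply exp_le. assert (H1 := lnS_nonneg n). nra. Qed.

(** The integral comparison, by the mean value theorem for [x^(1 - sigma)] between two consecutive
    integers; summed, it telescopes. *)
Lemma npowR_step sigma n : 1 < sigma -> npowR sigma (S n) <= (npowR (sigma - 1) n - npowR (sigma - 1) (S n)) / (sigma - 1).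
Proof.
  intros Hs. set (F := fun x => exp (- (sigma - 1) * ln x)).
  assert (H1 := INR_S_ge_1 n).
  assert (HS : INR (S (S n)) = INR (S n) + 1) by (rewrite (S_INR (S n)); ring).
  set (F' := fun x => - (sigma - 1) * exp (- sigma * ln x)).
  assert (HF : forall x, 0 < x -> is_derive F x (F' x)).
  { intros x Hx. unfold F, F'. auto_derive; [auto|].
    replace (- sigma * ln x) with (- (sigma - 1) * ln x + - ln x) by ring.
    rewrite exp_plus, exp_Ropp, exp_ln by auto. ring. }
  destruct (MVT_gen F (INR (S n)) (INR (S (S n))) F') as [c [Hc E]].
  { intros x Hx. rewrite Rmin_left, Rmax_right in Hx by lra. apply HF; lra. }
  { intros x Hx. rewrite Rmin_left, Rmax_right in Hx by lra.
    apply derivable_continuous_pt. exists (F' x). apply is_derive_Reals, HF; lra. }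
  rewrite Rmin_left, Rmax_right in Hc by lra.
  change (npowR (sigma - 1) n) with (F (INR (S n))). change (npowR (sigma - 1) (S n)) with (F (INR (S (S n)))).
  replace (F (INR (S n)) - F (INR (S (S n)))) with ((sigma - 1) * exp (- sigma * ln c)).
  2:{ replace (INR (S (S n)) - INR (S n)) with 1 in E by lra. unfold F' in E. lra. }
  replace ((sigma - 1) * exp (- sigma * ln c) / (sigma - 1)) with (exp (- sigma * ln c)) by (field; lra).
  apply exp_le. unfold lnS. assert (ln c <= ln (INR (S (S n)))) by (apply ln_le; lra). nra.
Qed.

Lemma npowR_tail sigma M N : 1 < sigma -> (M <= N)%nat ->
  rsum (npowR sigma) (S N) - rsum (npowR sigma) (S M) <= npowR (sigma - 1) M / (sigma - 1).
Proof.
  intros Hs HMN.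
  assert (H : rsum (npowR sigma) (S N) - rsum (npowR sigma) (S M) <= (npowR (sigma - 1) M - npowR (sigma - 1) N) / (sigma - 1)).
  { induction HMN as [|N HMN IH].
    - rewrite !Rminus_diag. unfold Rdiv; lra.
    - assert (H := npowR_step sigma N Hs). change (rsum (npowR sigma) (S (S N))) with (rsum (npowR sigma) (S N) + npowR sigma (S N)).
      unfold Rdiv in *. lra. }
  eapply Rle_trans; [exact H|]. apply Rmult_le_compat_r; [left; apply Rinv_0_lt_compat; lra|].
  assert (H1 := npowR_pos (sigma - 1) N). lra.
Qed.

Lemma npowR_sum_bound sigma N : 1 < sigma -> rsum (npowR sigma) N <= 1 + / (sigma - 1).
Proof.
  intros Hs. apply Rle_trans with (rsum (npowR sigma) (S N)).
  - simpl. assert (H := npowR_pos sigma N); lra.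
  - assert (H := npowR_tail sigma 0 N Hs ltac:(lia)). simpl (rsum (npowR sigma) 1) in H. rewrite !npowR_0 in H.
    unfold Rdiv in H. lra.
Qed.

Lemma npowR_lim_0 sigma : 0 < sigma -> is_lim_seq (npowR sigma) 0.
Proof.
  intros Hs. unfold npowR, lnS.
  apply (is_lim_comp_seq exp (fun n => - sigma * ln (INR (S n))) m_infty 0).
  - apply is_lim_exp_m.
  - exists O; intros; discriminate.
  - apply (is_lim_seq_ext (fun n => (- sigma) * (ln (INR (S n))))); [intros; ring|].
    replace m_infty with (Rbar_mult (- sigma) p_infty).
    + apply is_lim_seq_scal_l.
      apply (is_lim_comp_seq ln (fun n => INR (S n)) p_infty p_infty).
      * apply is_lim_ln_p.
      * exists O; intros; discriminate.
      * apply -> (is_lim_seq_incr_1 INR). apply is_lim_seq_INR.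
    + simpl. destruct (Rle_dec 0 (- sigma)); [exfalso; lra|]. reflexivity.
Qed.

Definition npowC (s : C) (n : nat) : C := npow_neg (S n) s.

Lemma npow_neg_cexp n s : npow_neg n s = cexp (- s * ln (INR n)).
Proof.
  destruct s as [a b]. unfold npow_neg, cexp, Rpower. simpl.
  replace (- a * ln (INR n) - - b * 0) with (- a * ln (INR n)) by ring.
  replace (- a * 0 + - b * ln (INR n)) with (- (b * ln (INR n))) by ring.
  rewrite cos_neg, sin_neg. f_equal; ring.
Qed.

Lemma npowC_cexp s n : npowC s n = cexp (- s * lnS n).
Proof. apply npow_neg_cexp. Qed.

Lemma Cmod_npowC s n : Cmod (npowC s n) = npowR (Re s) n.
Proof.
  rewrite npowC_cexp, Cmod_cexp. unfold npowR. f_equal. destruct s; simpl; ring.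
Qed.

Lemma npowC_R (s : R) n : npowC s n = RtoC (npowR s n).
Proof.
  rewrite npowC_cexp. replace (- s * lnS n)%C with (RtoC (- s * lnS n)); [apply cexp_R|].
  rewrite RtoC_mult, RtoC_opp; reflexivity.
Qed.

(* For [y = ln x], the k-th Taylor coefficient of [z |-> x^(-z)] at [s] is [(-1)^k hk s k y]. *)
Definition hk (s : R) (k : nat) (y : R) : R := y ^ k / INR (fact k) * exp (- (s * y)).

Lemma hk_nonneg s k y : 0 <= y -> 0 <= hk s k y.
Proof. intros Hy; apply Rmult_le_pos; [apply exp_term_nonneg; auto|left; apply exp_pos]. Qed.

Lemma hk_pois s k y : s ^ k * hk s k y = pois (S k) (s * y) - pois k (s * y).
Proof. rewrite pois_step. unfold hk. rewrite Rpow_mult_distr. unfold Rdiv; ring. Qed.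

Lemma hk_le s k y : 0 < s -> 0 <= y -> s ^ k * hk s k y <= 1.
Proof.
  intros Hs Hy. rewrite hk_pois.
  assert (H0 : 0 <= s * y) by (apply Rmult_le_pos; lra).
  assert (H1 := pois_le_1 (S k) (s * y) H0). assert (H2 := pois_nonneg k (s * y) H0). lra.
Qed.

(* [s^k hk s k] is a difference of the two decreasing functions [pois (S k)] and [pois k]. *)
Lemma hk_variation s k (y y' : nat -> R) N : 0 < s -> (forall n, 0 <= y n) ->
  (forall n, y n <= y' n <= y (S n)) ->
  s ^ k * rsum (fun n => Rabs (hk s k (y' n) - hk s k (y n))) N <= 2.
Proof.
  intros Hs Hy Hyy. rewrite <- rsum_scal.
  apply Rle_trans with (rsum (fun n => (- pois (S k) (s * y (S n)) - - pois (S k) (s * y n)) +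
                                       (- pois k (s * y (S n)) - - pois k (s * y n))) N).
  - apply rsum_le; intros n _.
    assert (Hk : 0 < s ^ k) by (apply pow_lt; auto).
    rewrite <- (Rabs_pos_eq (s ^ k)) at 1 by lra. rewrite <- Rabs_mult, Rmult_minus_distr_l, !hk_pois.
    specialize (Hyy n). specialize (Hy n).
    assert (A1 : 0 <= s * y n) by (apply Rmult_le_pos; lra).
    assert (A2 : s * y n <= s * y' n) by (apply Rmult_le_compat_l; lra).
    assert (A3 : s * y' n <= s * y (S n)) by (apply Rmult_le_compat_l; lra).
    assert (H1 := pois_decr (S k) _ _ A1 A2). assert (H2 := pois_decr (S k) (s * y' n) _ ltac:(lra) A3).
    assert (H3 := pois_decr k _ _ A1 A2). assert (H4 := pois_decr k (s * y' n) _ ltac:(lra) A3).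
    apply Rabs_le; lra.
  - rewrite rsum_plus, (rsum_telescope (fun n => - pois (S k) (s * y n))), (rsum_telescope (fun n => - pois k (s * y n))).
    assert (A1 : forall n, 0 <= s * y n) by (intros; apply Rmult_le_pos; [lra|auto]).
    assert (H1 := pois_le_1 (S k) _ (A1 O)). assert (H2 := pois_le_1 k _ (A1 O)).
    assert (H3 := pois_nonneg (S k) _ (A1 N)). assert (H4 := pois_nonneg k _ (A1 N)). lra.
Qed.

(** Half of the excess [s - 1] absorbs the power of the logarithm; the exponent that is left,
    [(s + 1) / 2], is still above 1. *)
Lemma hk_le_npowR s k n : 1 < s -> hk s k (lnS n) <= (2 / (s - 1)) ^ k * npowR ((s + 1) / 2) n.
Proof.
  intros Hs. assert (Hy := lnS_nonneg n). set (y := lnS n) in *.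
  assert (H := exp_term_le_exp k ((s - 1) / 2 * y) ltac:(nra)).
  unfold hk, npowR. fold y.
  replace (- (s * y)) with (- ((s + 1) / 2) * y + - ((s - 1) / 2 * y)) by field.
  rewrite exp_plus, exp_Ropp.
  rewrite Rpow_mult_distr in H.
  assert (Hp : 0 < ((s - 1) / 2) ^ k) by (apply pow_lt; lra).
  assert (He := exp_pos (- ((s + 1) / 2) * y)). assert (He2 := exp_pos ((s - 1) / 2 * y)).
  replace ((2 / (s - 1)) ^ k) with (/ ((s - 1) / 2) ^ k).
  2:{ rewrite <- pow_inv. f_equal. field. lra. }
  apply Rmult_le_reg_l with (((s - 1) / 2) ^ k); [auto|].
  rewrite <- (Rmult_assoc (((s - 1) / 2) ^ k) (/ _)), Rinv_r, Rmult_1_l by lra.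
  apply Rle_trans with (((s - 1) / 2) ^ k * y ^ k / INR (fact k) * (exp (- ((s + 1) / 2) * y) * / exp ((s - 1) / 2 * y))).
  { right; unfold Rdiv; ring. }
  apply Rle_trans with (exp ((s - 1) / 2 * y) * (exp (- ((s + 1) / 2) * y) * / exp ((s - 1) / 2 * y))).
  - apply Rmult_le_compat_r; [|exact H]. apply Rmult_le_pos; [lra|left; apply Rinv_0_lt_compat; lra].
  - right; field; lra.
Qed.

Lemma hk_sum_bound s k N : 1 < s -> rsum (fun n => hk s k (lnS n)) N <= (2 / (s - 1)) ^ k * (1 + / ((s + 1) / 2 - 1)).
Proof.
  intros Hs. apply Rle_trans with (rsum (fun n => (2 / (s - 1)) ^ k * npowR ((s + 1) / 2) n) N).
  - apply rsum_le; intros; apply hk_le_npowR; auto.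
  - rewrite rsum_scal. apply Rmult_le_compat_l; [apply pow_le; left; apply Rdiv_lt_0_compat; lra|].
    apply npowR_sum_bound; lra.
Qed.

Definition altsgn (k : nat) : R := (-1) ^ k.

Lemma Rabs_altsgn k : Rabs (altsgn k) = 1.
Proof. unfold altsgn. apply pow_1_abs. Qed.

Lemma psum_hk s (z : C) y n :
  psum (fun k => RtoC (altsgn k * hk s k y)) z n = (RtoC (exp (- (s * y))) * csum (fun k => (- z * y) ^ k / INR (fact k))%C n)%C.
Proof.
  unfold psum. rewrite <- csum_scal. apply csum_ext; intros k _.
  unfold hk, altsgn. rewrite !RtoC_mult, RtoC_pow. unfold Rdiv.
  rewrite RtoC_mult, RtoC_inv, RtoC_pow by (apply Rgt_not_eq, INR_fact_pos).
  replace (- z * y)%C with (RtoC (-1) * y * z)%C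
    by (replace (RtoC (-1)) with (- RtoC 1)%C by (rewrite <- RtoC_opp; f_equal; lra); ring).
  rewrite !Cpow_mult_l. unfold Cdiv. ring.
Qed.

Lemma psum_hk_lim s (z : C) y : Clim (psum (fun k => RtoC (altsgn k * hk s k y)) z) (cexp (- (s + z) * y)).
Proof.
  replace (cexp (- (s + z) * y)) with (RtoC (exp (- (s * y))) * cexp (- z * y))%C.
  2:{ rewrite <- cexp_R, <- cexp_plus. f_equal. rewrite RtoC_opp, RtoC_mult. ring. }
  apply (Clim_ext (fun n => RtoC (exp (- (s * y))) * csum (fun k => (- z * y) ^ k / INR (fact k))%C n)%C).
  { intros n; symmetry; apply psum_hk. }
  apply Clim_scal. intros eps He.
  set (w := (- z * y)%C).
  destruct (cv_speed_pow_fact (Cmod w) (eps / exp (Cmod w))) as [N0 HN].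
  { apply Rdiv_lt_0_compat; [lra|apply exp_pos]. }
  exists N0; intros n Hn. rewrite Cmod_minus_sym. eapply Rle_trans; [apply cexp_taylor|].
  specialize (HN n Hn). unfold R_dist in HN. rewrite Rminus_0_r in HN. 
  assert (H1 := Rle_abs (Cmod w ^ n / INR (fact n))). assert (H2 := exp_pos (Cmod w)).
  apply Rle_trans with (eps / exp (Cmod w) * exp (Cmod w)); [|right; field; lra].
  apply Rmult_le_compat_r; lra.
Qed.

(** Partial summation: bounded partial sums are paid for by the last value and the total variation
    of [v]. *)
Lemma abel_bound (f : nat -> C) (v : nat -> R) B N : (forall N, Cmod (csum f N) <= B) ->
  Cmod (csum (fun n => f n * RtoC (v n))%C N) <= B * (Rabs (v N) + rsum (fun n => Rabs (v (S n) - v n)) N).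
Proof.
  intros HB.
  assert (E : csum (fun n => f n * RtoC (v n))%C N =
    (csum f N * RtoC (v N) + csum (fun n => csum f (S n) * RtoC (v n - v (S n))) N)%C).
  { induction N as [|N IH]; simpl csum in *; [ring|]. rewrite IH, !RtoC_minus. ring. }
  rewrite E. eapply Rle_trans; [apply Cmod_triangle|].
  rewrite Rmult_plus_distr_l. apply Rplus_le_compat.
  - rewrite Cmod_mult, Cmod_R. apply Rmult_le_compat_r; [apply Rabs_pos|auto].
  - rewrite <- rsum_scal. eapply Rle_trans; [apply csum_Cmod|]. apply rsum_le; intros n _.
    rewrite Cmod_mult, Cmod_R, Rabs_minus_sym. apply Rmult_le_compat_r; [apply Rabs_pos|auto].
Qed.

(** The [k]-th Taylor coefficient at the point [s] of the Dirichlet series with coefficients [f]. *)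
Definition dcoef (s : R) (f : nat -> C) (k : nat) : C := cseries (fun n => f n * RtoC (altsgn k * hk s k (lnS n)))%C.

Lemma dcoef_lim s f k : 1 < s -> (forall n, Cmod (f n) <= 1) ->
  Clim (csum (fun n => f n * RtoC (altsgn k * hk s k (lnS n)))%C) (dcoef s f k).
Proof.
  intros Hs Hf. apply (cseries_converges _ ((2 / (s - 1)) ^ k * (1 + / ((s + 1) / 2 - 1)))).
  intros N. eapply Rle_trans; [|apply (hk_sum_bound s k N Hs)].
  apply rsum_le; intros n _. rewrite Cmod_mult, Cmod_R, Rabs_mult, Rabs_altsgn, Rmult_1_l.
  rewrite Rabs_pos_eq by (apply hk_nonneg, lnS_nonneg).
  assert (H := hk_nonneg s k (lnS n) (lnS_nonneg n)). specialize (Hf n). nra.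
Qed.

(** Partial summation bounds every [k]-th coefficient by [3 B / s ^ k]: 1 for the last term and 2
    for the variation of [s ^ k * hk s k]. Hence the Taylor series at [s] converges up to the
    imaginary axis, and its sum is the limit of the Dirichlet partial sums there, far outside
    absolute convergence. *)
Theorem dirichlet_power_series (s B : R) (f : nat -> C) : 1 < s -> 0 <= B ->
  (forall n, Cmod (f n) <= 1) -> (forall N, Cmod (csum f N) <= B) ->
  power_sum_on (dcoef s f) (3 * B) s (fun z => cseries (fun k => dcoef s f k * z ^ k)%C) /\
  forall z, Cmod z < s -> Clim (csum (fun n => f n * npowC (s + z) n)%C) (cseries (fun k => dcoef s f k * z ^ k)%C).
Proof.
  intros Hs HB Hf HfB.
  assert (HbC : forall k N, Cmod (csum (fun n => f n * RtoC (altsgn k * hk s k (lnS n)))%C N) * s ^ k <= 3 * B).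
  { intros k N.
    assert (H := abel_bound f (fun n => altsgn k * hk s k (lnS n)) B N HfB).
    assert (Hk : 0 < s ^ k) by (apply pow_lt; lra).
    apply Rle_trans with (B * (s ^ k * hk s k (lnS N) + s ^ k * rsum (fun n => Rabs (hk s k (lnS (S n)) - hk s k (lnS n))) N)).
    - apply Rmult_le_compat_r with (r := s ^ k) in H; [|lra].
      eapply Rle_trans; [exact H|]. right.
      rewrite (rsum_ext _ (fun n => Rabs (hk s k (lnS (S n)) - hk s k (lnS n)))).
      + rewrite Rabs_mult, Rabs_altsgn, (Rabs_pos_eq (hk _ _ _)) by (apply hk_nonneg, lnS_nonneg). ring.
      + intros n _. rewrite <- Rmult_minus_distr_l, Rabs_mult, Rabs_altsgn. ring.
    - assert (H1 := hk_le s k (lnS N) ltac:(lra) (lnS_nonneg N)).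
      assert (H2 := hk_variation s k lnS (fun n => lnS (S n)) N ltac:(lra) lnS_nonneg).
      specialize (H2 (fun n => conj (lnS_mono n (S n) ltac:(lia)) (Rle_refl _))).
      replace (3 * B) with (B * 3) by ring. apply Rmult_le_compat_l; lra. }
  split.
  - apply power_sum_on_cseries; [lra|lra|]. intros k.
    assert (Hk : 0 < s ^ k) by (apply pow_lt; lra).
    apply Rmult_le_reg_r with (/ s ^ k); [apply Rinv_0_lt_compat; auto|].
    rewrite Rmult_assoc, Rinv_r, Rmult_1_r by lra.
    replace (dcoef s f k) with (dcoef s f k - 0)%C by ring.
    apply (Clim_Cmod_le _ _ _ _ (dcoef_lim s f k Hs Hf)). exists O; intros n _.
    match goal with |- Cmod (Cminus ?x (RtoC 0)) <= _ => replace (x - 0)%C with x by ring end.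
    apply Rmult_le_reg_r with (s ^ k); [auto|]. rewrite Rmult_assoc, Rinv_l, Rmult_1_r by lra. apply HbC.
  - intros z Hz.
    apply (power_series_tannery (fun k N => csum (fun n => f n * RtoC (altsgn k * hk s k (lnS n)))%C N) (dcoef s f) _ (3 * B) s z); try lra.
    + intros k; apply dcoef_lim; auto.
    + exact HbC.
    (* A finite Dirichlet sum is entire, so it equals its Taylor series term by term. *)
    + intros N. induction N as [|N IH].
      * apply (Clim_ext (fun _ => RtoC 0)); [|apply Clim_const].
        intros n. unfold psum. rewrite csum_zero; [reflexivity|]. intros; simpl; ring.
      * simpl csum at 2.
        apply (Clim_ext (fun M => psum (fun k => csum (fun n => f n * RtoC (altsgn k * hk s k (lnS n))) N) z M +
                                  f N * psum (fun k => RtoC (altsgn k * hk s k (lnS N))) z M)%C).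
        { intros M. unfold psum. rewrite <- csum_scal, <- csum_plus. apply csum_ext; intros k _. simpl csum. ring. }
        apply Clim_plus; [exact IH|]. rewrite npowC_cexp. apply Clim_scal, psum_hk_lim.
Qed.

(** * Euler products *)

Module Primes.
Import ssreflect ssrfun ssrbool eqtype ssrnat div prime.
Local Open Scope nat_scope.

Lemma divideP d n : reflect (Nat.divide d n) (d %| n).
Proof. by apply: (iffP dvdnP) => -[k ->]; exists k. Qed.

Lemma prime_ge_2 p : prime p = true -> (2 <= p)%coq_nat.
Proof. by move=> /prime_gt1/leP. Qed.

Lemma prime_divisor n : (2 <= n)%coq_nat -> exists p, prime p = true /\ (p <= n)%coq_nat /\ Nat.divide p n.
Proof.
move=> /leP n2; exists (pdiv n); split; first exact: pdiv_prime.
split; first by apply/leP; apply: pdiv_leq; apply: ltnW.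
by apply/divideP; apply: pdiv_dvd.
Qed.

Lemma prime_divide_mul p a b : prime p = true -> Nat.divide p (a * b)%coq_nat -> Nat.divide p a \/ Nat.divide p b.
Proof.
move=> pp /divideP; rewrite (Euclid_dvdM _ _ pp) => /orP[] /divideP; by [left|right].
Qed.

Lemma prime_divide_prime p p' : prime p = true -> prime p' = true -> Nat.divide p p' -> p = p'.
Proof. by move=> pp pp' /divideP; rewrite dvdn_prime2 // => /eqP. Qed.
End Primes.

Notation isprime := (prime.prime).

Fixpoint rough (y n : nat) : bool :=
  match y with
  | O => true
  | S y' => andb (rough y' n) (negb (andb (isprime (S y')) (Nat.eqb (Nat.modulo n (S y')) 0)))
  end.

Lemma rough_S y n : rough (S y) n = andb (rough y n) (negb (andb (isprime (S y)) (Nat.eqb (Nat.modulo n (S y)) 0))).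
Proof. reflexivity. Qed.

Lemma mod_0_divide n d : (Nat.modulo n d =? 0)%nat = true <-> Nat.divide d n.
Proof. rewrite Nat.eqb_eq. apply Nat.Lcm0.mod_divide. Qed.

Lemma rough_spec y n : rough y n = true <-> forall p, (p <= y)%nat -> isprime p = true -> ~ Nat.divide p n.
Proof.
  induction y as [|y IH].
  - split; [|reflexivity]. intros _ p Hp Hpp. apply Primes.prime_ge_2 in Hpp. lia.
  - rewrite rough_S, Bool.andb_true_iff, IH, Bool.negb_true_iff. split.
    + intros [H1 H2] p Hp Hpp Hd. destruct (Nat.eq_dec p (S y)) as [->|Hne]; [|apply (H1 p); auto; lia].
      apply mod_0_divide in Hd. rewrite Hpp, Hd in H2. discriminate.
    + intros H. split; [intros p Hp; apply H; lia|].
      destruct (isprime (S y)) eqn:Ep; [|reflexivity].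
      destruct (Nat.modulo n (S y) =? 0)%nat eqn:Em; [|reflexivity].
      exfalso. apply (H (S y)); auto. apply mod_0_divide; auto.
Qed.

Lemma csum_S f n : csum f (S n) = (csum f n + f n)%C.
Proof. reflexivity. Qed.

Lemma csum_app f m n : csum f (m + n) = (csum f m + csum (fun k => f (m + k)%nat) n)%C.
Proof.
  induction n as [|n IH]; simpl.
  - rewrite Nat.add_0_r; ring.
  - rewrite Nat.add_succ_r; simpl. rewrite IH; ring.
Qed.

Lemma csum_multiples (u : nat -> C) p N : (0 < p)%nat ->
  csum (fun i => if (Nat.modulo (S i) p =? 0)%nat then u (S i) else RtoC 0) (p * N) = csum (fun j => u (p * S j)%nat) N.
Proof.
  intros Hp. induction N as [|N IH]; [rewrite Nat.mul_0_r; reflexivity|].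
  rewrite Nat.mul_succ_r, csum_app, IH. rewrite (csum_S _ N). f_equal.
  destruct p as [|p]; [lia|]. rewrite csum_S, csum_zero.
  - replace (S (S p * N + p)) with (S p * S N)%nat by lia.
    rewrite (proj2 (mod_0_divide (S p * S N) (S p))); [ring|]. exists (S N); lia.
  - intros k Hk. destruct (Nat.modulo (S (S p * N + k)) (S p) =? 0)%nat eqn:E; [|reflexivity].
    apply mod_0_divide in E. destruct E as [c Hc].
    exfalso. assert (c = N \/ c <= N - 1 \/ c >= N + 1)%nat as [->|[H|H]] by lia; nia.
Qed.

Definition cmult_bounded (sigma : R) (f : nat -> C) : Prop :=
  f 1%nat = RtoC 1 /\
  (forall m n, (0 < m)%nat -> (0 < n)%nat -> f (m * n)%nat = (f m * f n)%C) /\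
  (forall n, Cmod (f (S n)) <= npowR sigma n).

Definition sieved (f : nat -> C) (y i : nat) : C := if rough y (S i) then f (S i) else RtoC 0.

(** The reciprocal of the Euler product over the primes up to [y]. *)
Fixpoint rprod (f : nat -> C) (y : nat) : C :=
  match y with
  | O => RtoC 1
  | S y' => if isprime (S y') then ((1 - f (S y')) * rprod f y')%C else rprod f y'
  end.

Section Sieve.
Variables (sigma : R) (f : nat -> C).
Hypothesis Hs : 1 < sigma.
Hypothesis Hf : cmult_bounded sigma f.

Lemma sieved_Cmod y i : Cmod (sieved f y i) <= npowR sigma i.
Proof.
  unfold sieved. destruct (rough y (S i)); [apply Hf|]. rewrite Cmod_0; left; apply npowR_pos.
Qed.

Lemma sieved_lim y : Clim (csum (sieved f y)) (cseries (sieved f y)).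
Proof.
  apply (cseries_converges _ (1 + / (sigma - 1))). intros N.
  eapply Rle_trans; [|apply (npowR_sum_bound sigma N Hs)]. apply rsum_le; intros; apply sieved_Cmod.
Qed.

(** With [p = S y], the terms removed by the sieve are those at [p * m] with [m] free of primes up
    to [y], and by multiplicativity they add up to [f p] times the series before the step. *)
Lemma sieved_step y : isprime (S y) = true -> cseries (sieved f (S y)) = ((1 - f (S y)) * cseries (sieved f y))%C.
Proof.
  intros Hp. destruct Hf as [H1 [Hm Hb]].
  assert (Hpd : forall m, (0 < m)%nat -> rough y (S y * m) = rough y m).
  { intros m Hm0. apply Bool.eq_true_iff_eq. rewrite !rough_spec.
    split; intros H p Hpy Hpp Hd; apply (H p Hpy Hpp).
    - apply Nat.divide_mul_r, Hd.
    - destruct (Primes.prime_divide_mul p (S y) m Hpp Hd) as [Hd'|]; [|auto].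
      apply Primes.prime_divide_prime in Hd'; auto. lia. }
  set (u := fun m => if rough y m then f m else RtoC 0).
  (* Cutting at a multiple of the prime makes the identity exact for partial sums. *)
  assert (E : forall N, csum (sieved f (S y)) (S y * N) =
     (csum (sieved f y) (S y * N) + - f (S y) * csum (sieved f y) N)%C).
  { intros N.
    rewrite (csum_ext (sieved f (S y)) (fun i => sieved f y i - (if (Nat.modulo (S i) (S y) =? 0)%nat then u (S i) else RtoC 0))%C).
    - rewrite csum_minus, (csum_multiples u (S y) N) by lia.
      rewrite (csum_ext (fun j => u (S y * S j)%nat) (fun j => f (S y) * sieved f y j)%C), csum_scal; [ring|].
      intros j _. unfold u, sieved. rewrite Hpd by lia. destruct (rough y (S j)); [|ring].
      rewrite Hm by lia. reflexivity.
    - intros i _. unfold sieved, u. rewrite rough_S, Hp, Bool.andb_true_l.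
      destruct (Nat.modulo (S i) (S y) =? 0)%nat.
      + rewrite Bool.andb_false_r. ring.
      + rewrite Bool.andb_true_r. ring. }
  assert (L1 : Clim (fun N => csum (sieved f (S y)) (S y * N)) (cseries (sieved f (S y)))).
  { apply (Clim_subseq _ _ (fun N => (S y * N)%nat)); [intros; nia|apply sieved_lim]. }
  apply (Clim_unique _ _ _ L1).
  apply (Clim_ext (fun N => csum (sieved f y) (S y * N) + - f (S y) * csum (sieved f y) N)%C).
  { intros; symmetry; apply E. }
  replace ((1 - f (S y)) * cseries (sieved f y))%C with (cseries (sieved f y) + - f (S y) * cseries (sieved f y))%C by ring.
  apply Clim_plus; [|apply Clim_scal, sieved_lim].
  apply (Clim_subseq _ _ (fun N => (S y * N)%nat)); [intros; nia|apply sieved_lim].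
Qed.

Lemma cseries_ext (a b : nat -> C) : (forall n, a n = b n) -> cseries a = cseries b.
Proof. intros H. unfold cseries. f_equal; apply Series_ext; intros; rewrite H; reflexivity. Qed.

Lemma sieved_prod y : cseries (sieved f y) = (rprod f y * cseries (fun i => f (S i)))%C.
Proof.
  induction y as [|y IH].
  - simpl rprod. rewrite Cmult_1_l. reflexivity.
  - simpl rprod. destruct (isprime (S y)) eqn:E.
    + rewrite (sieved_step y E), IH. ring.
    + rewrite <- IH. apply cseries_ext; intros i. unfold sieved. rewrite rough_S, E, Bool.andb_true_r. reflexivity.
Qed.

(** An integer above 1 with no prime factor up to [y + 1] is at least [y + 2], so beyond the term 1
    only a tail survives. *)
Lemma sieved_near_1 y : Cmod (cseries (sieved f (S y)) - 1) <= npowR (sigma - 1) y / (sigma - 1).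
Proof.
  apply (Clim_Cmod_le _ _ _ _ (sieved_lim (S y))). exists (S y); intros N HN.
  destruct N as [|N]; [lia|].
  rewrite csum_shift. unfold sieved at 1.
  replace (rough (S y) 1) with true.
  2:{ symmetry; apply rough_spec. intros p _ Hp Hd. apply Primes.prime_ge_2 in Hp.
      apply Nat.divide_1_r in Hd. lia. }
  rewrite (proj1 Hf).
  match goal with |- Cmod ?x <= _ => replace x with (csum (fun k => sieved f (S y) (S k)) N) by ring end.
  eapply Rle_trans; [apply csum_Cmod|].
  eapply Rle_trans; [|apply (npowR_tail sigma y N Hs ltac:(lia))].
  apply Rle_trans with (rsum (fun k => if (k <? y)%nat then 0 else npowR sigma (S k)) N).
  - apply rsum_le; intros k _. destruct (Nat.ltb_spec k y); [|apply sieved_Cmod].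
    unfold sieved. destruct (rough (S y) (S (S k))) eqn:E; [|rewrite Cmod_0; lra].
    exfalso. destruct (Primes.prime_divisor (S (S k)) ltac:(lia)) as [p [Hp [Hpk Hd]]].
    apply (proj1 (rough_spec _ _) E p); auto. lia.
  - rewrite !(rsum_shift (npowR sigma)).
    assert (G : forall n, (y <= n)%nat -> rsum (fun k => if (k <? y)%nat then 0 else npowR sigma (S k)) n =
      rsum (fun k => npowR sigma (S k)) n - rsum (fun k => npowR sigma (S k)) y).
    { intros n Hn; induction Hn as [|n Hn IHn].
      - rewrite rsum_zero; [ring|]. intros k Hk. destruct (Nat.ltb_spec k y); [reflexivity|lia].
      - simpl. rewrite IHn. destruct (Nat.ltb_spec n y); [lia|ring]. }
    rewrite G by lia. lra.
Qed.

(** If the sum vanished, all sieved sums, being multiples of it, would vanish too; but they tend to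
    1. *)
Lemma euler_nonzero : cseries (fun i => f (S i)) <> RtoC 0.
Proof.
  intros E.
  destruct (is_lim_seq_eps _ _ (npowR_lim_0 (sigma - 1) ltac:(lra)) ((sigma - 1) / 2) ltac:(lra)) as [N HN].
  specialize (HN N ltac:(lia)). rewrite Rminus_0_r, Rabs_pos_eq in HN by (left; apply npowR_pos).
  assert (H := sieved_near_1 N). rewrite sieved_prod, E in H.
  replace (rprod f (S N) * 0 - 1)%C with (- RtoC 1)%C in H by ring. rewrite Cmod_opp, Cmod_1 in H.
  assert (npowR (sigma - 1) N / (sigma - 1) <= (sigma - 1) / 2 / (sigma - 1)).
  { apply Rmult_le_compat_r; [left; apply Rinv_0_lt_compat; lra|auto]. }
  replace ((sigma - 1) / 2 / (sigma - 1)) with (1 / 2) in H0 by (field; lra). lra.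
Qed.
End Sieve.

(** * The logarithm of an Euler product as a sum over prime powers *)

Definition lam_term (n p m : nat) : R :=
  if isprime p then (if (p ^ S m =? n)%nat then / INR (S m) else 0) else 0.

(* [1/m] at a prime power [p^m], and [0] elsewhere: the Dirichlet coefficients of [log zeta]. *)
Definition lam (n : nat) : R := rsum (fun p => rsum (lam_term n p) n) (S n).

Lemma lam_term_nonneg n p m : 0 <= lam_term n p m.
Proof.
  unfold lam_term. destruct (isprime p), (p ^ S m =? n)%nat; try lra.
  left; apply Rinv_0_lt_compat. assert (H := INR_S_ge_1 m); lra.
Qed.

Lemma lam_nonneg n : 0 <= lam n.
Proof. apply rsum_nonneg; intros; apply rsum_nonneg; intros; apply lam_term_nonneg. Qed.

Lemma rsum_extend f a b : (a <= b)%nat -> (forall k, (a <= k)%nat -> f k = 0) -> rsum f a = rsum f b.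
Proof. intros Hab H; induction Hab; [reflexivity|]. simpl; rewrite <- IHHab, H by auto; ring. Qed.

Lemma lam_term_support n p m : lam_term n p m <> 0 -> (p <= n)%nat /\ (m < n)%nat.
Proof.
  unfold lam_term. destruct (isprime p) eqn:Ep; [|lra].
  destruct (Nat.eqb_spec (p ^ S m) n) as [<-|]; [|lra]. intros _.
  apply Primes.prime_ge_2 in Ep. assert (H := Nat.pow_gt_lin_r p (S m) ltac:(lia)).
  split; [|lia]. rewrite <- (Nat.pow_1_r p) at 1. apply Nat.pow_le_mono_r; lia.
Qed.

(** Gives all [n] up to [X] the same summation ranges, so that the order of summation can be
    exchanged. *)
Lemma lam_extend n X : (n <= X)%nat -> lam n = rsum (fun p => rsum (lam_term n p) X) (S X).
Proof.
  intros H. unfold lam.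
  rewrite (rsum_ext _ (fun p => rsum (lam_term n p) X)).
  - apply rsum_extend; [lia|]. intros p Hp. apply rsum_zero; intros m _.
    apply NNPP; intros E; apply lam_term_support in E; lia.
  - intros p _. apply rsum_extend; [lia|]. intros m Hm.
    apply NNPP; intros E; apply lam_term_support in E; lia.
Qed.

(** If [n = p^m] then [n^3 = p^(3m)], and the weight 1/m becomes 1/(3m). *)
Lemma lam_cube n : lam n / 3 <= lam (n ^ 3).
Proof.
  destruct n as [|n]; [simpl; unfold lam; simpl; unfold lam_term; simpl; lra|].
  set (N := S n). assert (HN : (1 <= N)%nat) by (unfold N; lia).
  assert (HN3 : (3 * N <= (3 * N) * N ^ 3)%nat) by (assert (1 <= N ^ 3)%nat by (apply Nat.neq_0_lt_0, Nat.pow_nonzero; lia); nia).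
  rewrite (lam_extend (N ^ 3) ((3 * N) * N ^ 3)) by nia.
  rewrite (lam_extend N ((3 * N) * N ^ 3)) by nia.
  set (X := ((3 * N) * N ^ 3)%nat) in *.
  unfold Rdiv. rewrite Rmult_comm, <- rsum_scal. apply rsum_le; intros p _.
  rewrite <- (rsum_extend (lam_term N p) N X) by
   (try lia; intros m Hm; apply NNPP; intros E; apply lam_term_support in E; lia).
  rewrite <- rsum_scal.
  apply Rle_trans with (rsum (lam_term (N ^ 3) p) (3 * N)).
  2:{ apply rsum_mono; [lia|intros; apply lam_term_nonneg]. }
  (* Only the two summation ranges are generalised, so that the number of exponents can vary while
     the integer stays fixed. *)
  generalize N at 2 4. intros M. induction M as [|M IH]; [simpl; lra|].
  replace (3 * S M)%nat with (S (S (S (3 * M)))) by lia. simpl rsum.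
  assert (H1 := lam_term_nonneg (N ^ 3) p (3 * M)). assert (H2 := lam_term_nonneg (N ^ 3) p (S (3 * M))).
  (* Index [M] stands for the exponent [M + 1]; three times that exponent has index [3 M + 2]. *)
  assert (H3 : / 3 * lam_term N p M <= lam_term (N ^ 3) p (S (S (3 * M)))).
  { unfold lam_term. destruct (isprime p); [|lra].
    destruct (Nat.eqb_spec (p ^ S M) N) as [E|E].
    - replace (S (S (S (3 * M)))) with (S M * 3)%nat by lia. rewrite Nat.pow_mul_r, E, Nat.eqb_refl.
      right. rewrite mult_INR. simpl (INR 3). field. apply not_0_INR; lia.
    - destruct (Nat.eqb_spec (p ^ S (S (S (3 * M)))) (N ^ 3)) as [E'|E']; [|lra].
      rewrite Rmult_0_r. left; apply Rinv_0_lt_compat. assert (H := INR_S_ge_1 (S (S (3 * M)))); lra. }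
  simpl in *. lra.
Qed.

Lemma lam_weighted_sum (F : nat -> R) X :
  rsum (fun i => lam (S i) * F (S i)) X =
  rsum (fun i => if isprime (S i) then
      rsum (fun m => if (S i ^ S m <=? X)%nat then F (S i ^ S m)%nat / INR (S m) else 0) X else 0) X.
Proof.
  rewrite (rsum_ext _ (fun i => rsum (fun p => rsum (fun m => lam_term (S i) p m * F (S i)) X) (S X))).
  2:{ intros i Hi. rewrite (lam_extend (S i) X) by lia. rewrite Rmult_comm, <- rsum_scal.
      apply rsum_ext; intros p _. rewrite <- rsum_scal. apply rsum_ext; intros; ring. }
  rewrite rsum_swap, rsum_shift, rsum_zero, Rplus_0_l.
  2:{ intros i Hi. apply rsum_zero; intros m _. unfold lam_term. change (isprime 0) with false. cbv iota. ring. }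
  apply rsum_ext; intros i Hi. rewrite rsum_swap.
  destruct (isprime (S i)) eqn:Ep.
  - apply rsum_ext; intros m Hm. destruct (Nat.leb_spec (S i ^ S m) X) as [H|H].
    + assert (H0 : (S i ^ S m <> 0)%nat) by (apply Nat.pow_nonzero; lia).
      rewrite (rsum_single _ X (S i ^ S m - 1)).
      * unfold lam_term. rewrite Ep. replace (S (S i ^ S m - 1)) with (S i ^ S m)%nat by lia.
        rewrite Nat.eqb_refl. unfold Rdiv; ring.
      * lia.
      * intros k Hk Hne. unfold lam_term. destruct (Nat.eqb_spec (S i ^ S m) (S k)); [lia|].
        destruct (isprime (S i)); ring.
    + apply rsum_zero; intros k Hk. unfold lam_term. destruct (Nat.eqb_spec (S i ^ S m) (S k)); [lia|].
      destruct (isprime (S i)); ring.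
  - apply rsum_zero; intros m _. apply rsum_zero; intros k _. unfold lam_term. rewrite Ep; ring.
Qed.

Lemma power_bracket p X : (2 <= p)%nat -> (1 <= X)%nat -> exists M, (p ^ M <= X < p ^ S M)%nat.
Proof.
  intros Hp HX. induction X as [|X IH]; [lia|].
  destruct (Nat.eq_dec X 0) as [->|HX0].
  - exists O. simpl. lia.
  - destruct IH as [M HM]; [lia|]. destruct (le_lt_dec (p ^ S M) (S X)) as [H|H].
    + exists (S M). split; [auto|]. assert (p ^ S (S M) = p * p ^ S M)%nat by reflexivity. nia.
    + exists M; lia.
Qed.

Lemma npowR_shift sigma x : INR (S x) * npowR sigma x = npowR (sigma - 1) x.
Proof.
  unfold npowR. assert (H := INR_S_ge_1 x). rewrite <- (exp_ln (INR (S x))) at 1 by lra.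
  rewrite <- exp_plus. f_equal. unfold lnS. ring.
Qed.

Section EulerLog.
Variables (sigma : R) (f : nat -> C).
Hypothesis Hs : 1 < sigma.
Hypothesis Hf : cmult_bounded sigma f.

Lemma cmult_pow p m : (0 < p)%nat -> f (p ^ m)%nat = (f p ^ m)%C.
Proof.
  intros Hp. destruct Hf as [H1 [Hm _]]. induction m as [|m IH]; [exact H1|].
  rewrite Nat.pow_succ_r', Hm, IH; [reflexivity|lia|]. apply Nat.neq_0_lt_0, Nat.pow_nonzero; lia.
Qed.

Lemma Cmod_prime_le_half i : (1 <= i)%nat -> Cmod (f (S i)) <= / 2.
Proof.
  intros Hi. destruct Hf as [_ [_ Hb]]. eapply Rle_trans; [apply Hb|].
  rewrite <- (exp_ln 2) by lra. rewrite <- exp_Ropp. apply exp_le.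
  assert (H : ln 2 <= lnS i).
  { apply ln_le; [lra|]. rewrite S_INR. assert (INR 1 <= INR i) by (apply le_INR; auto). simpl in H; lra. }
  assert (0 < ln 2) by (rewrite <- ln_1; apply ln_increasing; lra). nra.
Qed.

(** If [M] is the largest exponent kept, the expansion error is at most twice the modulus of [f] at
    the next power of the prime. That power exceeds [x + 1], hence the bound. *)
Lemma prime_log_sum i x : isprime (S i) = true -> (i <= x)%nat ->
  Rabs (ln (Cmod (1 - f (S i))) +
        rsum (fun m => if (S i ^ S m <=? S x)%nat then Re (f (S i ^ S m)%nat) / INR (S m) else 0) (S x))
   <= 2 * npowR sigma x.
Proof.
  intros Hp Hi. apply Primes.prime_ge_2 in Hp.
  destruct (power_bracket (S i) (S x) Hp ltac:(lia)) as [M HM].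
  assert (HMx : (M < S x)%nat) by (assert (H := Nat.pow_gt_lin_r (S i) M ltac:(lia)); lia).
  rewrite <- (rsum_extend _ M (S x)).
  2: lia.
  2:{ intros m Hm. destruct (Nat.leb_spec (S i ^ S m) (S x)); [|reflexivity].
      assert (S i ^ S M <= S i ^ S m)%nat by (apply Nat.pow_le_mono_r; lia). lia. }
  rewrite (rsum_ext _ (fun m => Re (f (S i) ^ S m)%C / INR (S m))).
  2:{ intros m Hm. rewrite cmult_pow by lia. destruct (Nat.leb_spec (S i ^ S m) (S x)); [reflexivity|].
      assert (S i ^ S m <= S i ^ M)%nat by (apply Nat.pow_le_mono_r; lia). lia. }
  assert (Hh := Cmod_prime_le_half i ltac:(lia)).
  eapply Rle_trans; [apply ln_Cmod_one_minus_expansion; lra|].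
  assert (H0 := Cmod_ge_0 (f (S i))).
  apply Rle_trans with (npowR sigma x * 2); [|lra].
  apply Rmult_le_compat.
  - apply pow_le; auto.
  - left; apply Rinv_0_lt_compat; lra.
  - rewrite <- Cmod_pow, <- cmult_pow by lia.
    replace (S i ^ S M)%nat with (S (S i ^ S M - 1)) by lia.
    eapply Rle_trans; [apply (proj2 (proj2 Hf))|]. apply exp_le.
    assert (H := lnS_mono x (S i ^ S M - 1) ltac:(lia)). nra.
  - rewrite <- (Rinv_inv 2). apply Rinv_le_contravar; lra.
Qed.

Lemma rprod_log y : rprod f y <> RtoC 0 /\
  ln (Cmod (rprod f y)) = rsum (fun i => if isprime (S i) then ln (Cmod (1 - f (S i))) else 0) y.
Proof.
  induction y as [|y [IH1 IH2]].
  - simpl. rewrite Cmod_1, ln_1. split; [intros E; injection E; lra|reflexivity].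
  - simpl rprod. simpl rsum. destruct (isprime (S y)) eqn:E.
    + apply Primes.prime_ge_2 in E. assert (H := Cmod_prime_le_half y ltac:(lia)).
      assert (H1 : (1 - f (S y))%C <> RtoC 0) by (apply one_minus_neq_0; lra).
      split; [apply Cmult_neq_0; auto|]. rewrite ln_Cmod_mult by auto. rewrite IH2; ring.
    + rewrite <- IH2. split; [auto|ring].
Qed.

(** At most [x + 1] primes, each with error [2 (x+1)^(-sigma)]; the total [2 (x+1)^(1-sigma)] still
    tends to 0. *)
Lemma euler_log_finite x :
  Rabs (ln (Cmod (rprod f (S x))) + rsum (fun i => lam (S i) * Re (f (S i))) (S x)) <= 2 * npowR (sigma - 1) x.
Proof.
  rewrite (proj2 (rprod_log (S x))), (lam_weighted_sum (fun n => Re (f n))), <- rsum_plus.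
  eapply Rle_trans; [apply rsum_abs|].
  apply Rle_trans with (rsum (fun _ => 2 * npowR sigma x) (S x)).
  - apply rsum_le; intros i Hi. destruct (isprime (S i)) eqn:E.
    + apply prime_log_sum; auto; lia.
    + rewrite Rplus_0_r, Rabs_R0. assert (H := npowR_pos sigma x); lra.
  - rewrite rsum_const, <- npowR_shift. right; ring.
Qed.

(** The sieved sum is [rprod] times the full sum and tends to 1, so [ln] of the modulus of [rprod]
    tends to minus the logarithm sought; [euler_log_finite] converts it into the sum over prime
    powers. *)
Theorem euler_log :
  is_lim_seq (rsum (fun i => lam (S i) * Re (f (S i)))) (ln (Cmod (cseries (fun i => f (S i))))).
Proof.
  apply is_lim_seq_incr_1.
  set (E0 := cseries (fun i => f (S i))).
  assert (HE0 : E0 <> RtoC 0) by apply (euler_nonzero sigma f Hs Hf).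
  assert (L : is_lim_seq (fun x => ln (Cmod (cseries (sieved f (S x))))) 0).
  { rewrite <- ln_1. rewrite <- Cmod_1.
    apply (is_lim_seq_continuous ln (fun x => Cmod (cseries (sieved f (S x))))).
    - apply derivable_continuous_pt. exists (/ Cmod 1). apply derivable_pt_lim_ln. rewrite Cmod_1; lra.
    - apply Clim_Cmod. intros eps He.
      destruct (is_lim_seq_eps _ _ (npowR_lim_0 (sigma - 1) ltac:(lra)) (eps * (sigma - 1)) ltac:(nra)) as [N HN].
      exists N; intros n Hn. specialize (HN n Hn).
      rewrite Rminus_0_r, Rabs_pos_eq in HN by (left; apply npowR_pos).
      eapply Rle_trans; [apply (sieved_near_1 sigma f Hs Hf)|].
      apply Rmult_le_reg_r with (sigma - 1); [lra|]. unfold Rdiv. rewrite Rmult_assoc, Rinv_l by lra. lra. }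
  apply is_lim_seq_of_eps. intros eps He.
  destruct (is_lim_seq_eps _ _ L (eps / 2) ltac:(lra)) as [N1 HN1].
  destruct (is_lim_seq_eps _ _ (npowR_lim_0 (sigma - 1) ltac:(lra)) (eps / 4) ltac:(lra)) as [N2 HN2].
  exists (max N1 N2); intros n Hn. specialize (HN1 n ltac:(lia)). specialize (HN2 n ltac:(lia)).
  rewrite Rminus_0_r in HN1, HN2. rewrite (Rabs_pos_eq (npowR _ _)) in HN2 by (left; apply npowR_pos).
  assert (H := euler_log_finite n).
  rewrite (sieved_prod sigma f Hs Hf) in HN1. fold E0 in HN1.
  rewrite ln_Cmod_mult in HN1; [|apply (rprod_log (S n))|exact HE0].
  set (T := rsum (fun i => lam (S i) * Re (f (S i))) (S n)) in *.
  replace (T - ln (Cmod E0)) with ((ln (Cmod (rprod f (S n))) + T) - (ln (Cmod (rprod f (S n))) + ln (Cmod E0))) by ring.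
  eapply Rle_trans; [apply Rabs_triang|]. rewrite Rabs_Ropp. lra.
Qed.
End EulerLog.

(** * Logarithms of Dirichlet series *)

Definition bounded_mult (chi : nat -> C) : Prop :=
  chi 1%nat = RtoC 1 /\ (forall m n, chi (m * n)%nat = (chi m * chi n)%C) /\ forall n, Cmod (chi n) <= 1.

Lemma twist_cmult_bounded chi s : bounded_mult chi -> cmult_bounded (Re s) (fun n => chi n * npow_neg n s)%C.
Proof.
  intros [H1 [Hm Hb]]. split; [|split].
  - rewrite H1, npow_neg_cexp. simpl INR. rewrite ln_1. replace (- s * 0)%C with (RtoC 0) by ring.
    rewrite cexp_R, exp_0. ring.
  - intros m n Hm0 Hn0. rewrite Hm, !npow_neg_cexp, mult_INR, ln_mult by (apply lt_0_INR; auto).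
    rewrite RtoC_plus, Cmult_plus_distr_l, cexp_plus. ring.
  - intros n. rewrite Cmod_mult. fold (npowC s n). rewrite Cmod_npowC.
    specialize (Hb (S n)). assert (H := npowR_pos (Re s) n). nra.
Qed.

Lemma trivial_bounded_mult : bounded_mult (fun _ => RtoC 1).
Proof. split; [reflexivity|split]; [intros; ring|intros; rewrite Cmod_1; lra]. Qed.

Definition dseries (chi : nat -> C) (s : C) : C := cseries (fun n => chi (S n) * npowC s n)%C.

Lemma dseries_nonzero chi s : bounded_mult chi -> 1 < Re s -> dseries chi s <> RtoC 0.
Proof. intros Hc Hs. apply (euler_nonzero (Re s) _ Hs (twist_cmult_bounded chi s Hc)). Qed.

Lemma dseries_log chi s : bounded_mult chi -> 1 < Re s ->
  is_lim_seq (rsum (fun n => lam (S n) * Re (chi (S n) * npowC s n)%C)) (ln (Cmod (dseries chi s))).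
Proof. intros Hc Hs. apply (euler_log (Re s) _ Hs (twist_cmult_bounded chi s Hc)). Qed.

Definition lnzeta (sigma : R) : R := ln (Cmod (dseries (fun _ => RtoC 1) sigma)).

Lemma lnzeta_lim sigma : 1 < sigma -> is_lim_seq (rsum (fun n => lam (S n) * npowR sigma n)) (lnzeta sigma).
Proof.
  intros Hs. apply (is_lim_seq_ext (rsum (fun n => lam (S n) * Re (1 * npowC sigma n)%C))).
  - intros N; apply rsum_ext; intros n _. rewrite Cmult_1_l, npowC_R. reflexivity.
  - apply (dseries_log (fun _ => RtoC 1) (RtoC sigma) trivial_bounded_mult Hs).
Qed.

Lemma lam_npowR_sum_bound sigma N : 1 < sigma -> rsum (fun n => lam (S n) * npowR sigma n) N <= lnzeta sigma.
Proof.
  intros Hs. apply (is_lim_seq_incr_compare (rsum (fun n => lam (S n) * npowR sigma n))); [apply lnzeta_lim, Hs|].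
  intros n. simpl. assert (H := lam_nonneg (S n)). assert (H1 := npowR_pos sigma n). nra.
Qed.

Section Expansion.
Variables (A : R) (chi : nat -> C).
Hypothesis HA : 0 < A.
Hypothesis Hc : bounded_mult chi.

(** The Taylor coefficients at [1 + A] of log L(s, chi), given by their absolutely convergent series
    over prime powers, so that no branch of the logarithm is chosen. *)
Definition logseries_coeff (k : nat) : C :=
  cseries (fun n => RtoC (lam (S n)) * chi (S n) * RtoC (altsgn k * hk (1 + A) k (lnS n)))%C.

Lemma Cmod_lam_chi n (x : R) : Cmod (RtoC (lam (S n)) * chi (S n) * RtoC x)%C <= lam (S n) * Rabs x.
Proof.
  rewrite !Cmod_mult, !Cmod_R, (Rabs_pos_eq (lam _)) by apply lam_nonneg.
  destruct Hc as [_ [_ Hb]]. specialize (Hb (S n)). assert (H := lam_nonneg (S n)).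
  assert (H0 := Cmod_ge_0 (chi (S n))). assert (H1 := Rabs_pos x).
  apply Rmult_le_compat_r; [auto|]. nra.
Qed.

Lemma logseries_coeff_lim k :
  Clim (csum (fun n => RtoC (lam (S n)) * chi (S n) * RtoC (altsgn k * hk (1 + A) k (lnS n)))%C) (logseries_coeff k).
Proof.
  apply (cseries_converges _ ((2 / A) ^ k * lnzeta (1 + A / 2))). intros N.
  eapply Rle_trans; [|apply Rmult_le_compat_l, (lam_npowR_sum_bound (1 + A / 2) N ltac:(lra))].
  2:{ apply pow_le; left; apply Rdiv_lt_0_compat; lra. }
  rewrite <- rsum_scal. apply rsum_le; intros n _.
  eapply Rle_trans; [apply Cmod_lam_chi|].
  rewrite Rabs_mult, Rabs_altsgn, Rmult_1_l, Rabs_pos_eq by (apply hk_nonneg, lnS_nonneg).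
  assert (H := hk_le_npowR (1 + A) k n ltac:(lra)).
  replace (1 + A - 1) with A in H by ring. replace ((1 + A + 1) / 2) with (1 + A / 2) in H by field.
  assert (H0 := lam_nonneg (S n)). nra.
Qed.

Lemma psum_logseries_lim z M :
  Clim (fun N => csum (fun n => RtoC (lam (S n)) * chi (S n) * psum (fun k => RtoC (altsgn k * hk (1 + A) k (lnS n))) z M)%C N)
       (psum logseries_coeff z M).
Proof.
  induction M as [|M IH].
  - apply (Clim_ext (fun _ => RtoC 0)); [|apply (Clim_const (RtoC 0))].
    intros N. symmetry; apply csum_zero; intros n _. unfold psum; simpl; ring.
  - unfold psum; simpl csum.
    apply (Clim_ext (fun N => csum (fun n => RtoC (lam (S n)) * chi (S n) * psum (fun k => RtoC (altsgn k * hk (1 + A) k (lnS n))) z M)%C N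
       + z ^ M * csum (fun n => RtoC (lam (S n)) * chi (S n) * RtoC (altsgn M * hk (1 + A) M (lnS n)))%C N)%C).
    { intros N. rewrite <- csum_scal, <- csum_plus. apply csum_ext; intros n _. unfold psum. ring. }
    apply Clim_plus; [exact IH|]. replace (logseries_coeff M * z ^ M)%C with (z ^ M * logseries_coeff M)%C by ring.
    apply Clim_scal, logseries_coeff_lim.
Qed.

Lemma Re_logseries_coeff_0 : Re (logseries_coeff 0) = ln (Cmod (dseries chi (1 + A))).
Proof.
  assert (L1 := Clim_Re _ _ (logseries_coeff_lim 0)).
  assert (L2 := dseries_log chi (RtoC (1 + A)) Hc ltac:(simpl; lra)).
  rewrite RtoC_plus in L2.
  apply is_lim_seq_unique in L1. apply is_lim_seq_unique in L2.
  rewrite (Lim_seq_ext _ (fun N => Re (csum (fun n => RtoC (lam (S n)) * chi (S n) * RtoC (altsgn 0 * hk (1 + A) 0 (lnS n)))%C N))) in L2.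
  - rewrite L1 in L2. injection L2. auto.
  - intros N. rewrite csum_Re. apply rsum_ext; intros n _.
    rewrite <- RtoC_plus, npowC_R. unfold hk, altsgn, npowR. simpl pow. simpl fact. simpl INR.
    replace (1 * (1 / 1 * exp (- ((1 + A) * lnS n)))) with (exp (- (1 + A) * lnS n)).
    2:{ replace (- ((1 + A) * lnS n)) with (- (1 + A) * lnS n) by ring. field. }
    rewrite <- Cmult_assoc, Re_mult_scal. reflexivity.
Qed.

(** With [v = |z| y], the Taylor remainder is at most [v^K / K! * exp v <= 2^(-K) * exp (3 v)]. The
    radius [A / 6] makes [3 v <= A y / 2], which leaves the exponent [1 + A / 2], where the sum over
    prime powers converges. *)
Lemma log_dseries_expansion z K : Cmod z <= A / 6 ->
  Rabs (ln (Cmod (dseries chi (1 + A + z))) - Re (psum logseries_coeff z K)) <= lnzeta (1 + A / 2) * (/ 2) ^ K.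
Proof.
  intros Hz.
  assert (Hre : 1 < Re (1 + A + z)%C).
  { assert (H := re_le_Cmod z). apply Rabs_le_between in H. destruct z as [a b]; simpl in *. lra. }
  assert (L1 := dseries_log chi (1 + A + z)%C Hc Hre).
  assert (L2 := Clim_Re _ _ (psum_logseries_lim z K)).
  assert (L := is_lim_seq_abs _ _ (is_lim_seq_minus' _ _ _ _ L1 L2)).
  apply (is_lim_seq_le _ (fun _ => lnzeta (1 + A / 2) * (/ 2) ^ K) _ _) with (2 := L) (3 := is_lim_seq_const _).
  intros N. rewrite csum_Re. unfold Rminus. rewrite <- rsum_opp, <- rsum_plus.
  eapply Rle_trans; [apply rsum_abs|].
  rewrite Rmult_comm.
  eapply Rle_trans; [|apply Rmult_le_compat_l, (lam_npowR_sum_bound (1 + A / 2) N ltac:(lra))].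
  2:{ apply pow_le; lra. }
  rewrite <- rsum_scal. apply rsum_le; intros n _.
  set (y := lnS n). assert (Hy : 0 <= y) by apply lnS_nonneg.
  set (P := psum (fun k => RtoC (altsgn k * hk (1 + A) k y)) z K).
  replace (lam (S n) * Re (chi (S n) * npowC (1 + A + z) n)%C + - Re (RtoC (lam (S n)) * chi (S n) * P)%C)
    with (Re (RtoC (lam (S n)) * chi (S n) * (npowC (1 + A + z) n - P))%C).
  2:{ rewrite <- Re_mult_scal.
      replace (RtoC (lam (S n)) * chi (S n) * (npowC (1 + A + z) n - P))%C with
        (RtoC (lam (S n)) * (chi (S n) * npowC (1 + A + z) n) - RtoC (lam (S n)) * chi (S n) * P)%C by ring.
      rewrite Re_minus. ring. }
  eapply Rle_trans; [apply re_le_Cmod|].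
  assert (HP : Cmod (npowC (1 + A + z) n - P) <= (/ 2) ^ K * npowR (1 + A / 2) n).
  { unfold P. rewrite psum_hk, npowC_cexp. fold y.
    replace (cexp (- (1 + A + z) * y)) with (RtoC (exp (- ((1 + A) * y))) * cexp (- z * y))%C.
    2:{ rewrite <- cexp_R, <- cexp_plus. f_equal. rewrite RtoC_opp, RtoC_mult, RtoC_plus. ring. }
    match goal with |- Cmod (Cminus (Cmult ?a ?u) (Cmult ?a ?v)) <= _ =>
      replace (Cminus (Cmult a u) (Cmult a v)) with (Cmult a (Cminus u v)) by ring end.
    rewrite Cmod_mult, Cmod_R, Rabs_pos_eq by (left; apply exp_pos).
    eapply Rle_trans; [apply Rmult_le_compat_l, cexp_taylor; left; apply exp_pos|].
    set (v := Cmod (- z * y)%C).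
    assert (Hv : 0 <= v <= A / 6 * y).
    { split; [apply Cmod_ge_0|]. unfold v. rewrite Cmod_mult, Cmod_opp, Cmod_R, Rabs_pos_eq by auto.
      apply Rmult_le_compat_r; auto. }
    assert (H1 := exp_term_le_exp K (2 * v) ltac:(lra)).
    rewrite Rpow_mult_distr in H1.
    assert (H2 : v ^ K / INR (fact K) <= (/ 2) ^ K * exp (2 * v)).
    { rewrite pow_inv. assert (0 < 2 ^ K) by (apply pow_lt; lra).
      apply Rmult_le_reg_l with (2 ^ K); [auto|]. rewrite <- Rmult_assoc, Rinv_r, Rmult_1_l by lra.
      unfold Rdiv in *. lra. }
    apply Rle_trans with (exp (- ((1 + A) * y)) * ((/ 2) ^ K * exp (2 * v) * exp v)).
    { apply Rmult_le_compat_l; [left; apply exp_pos|]. apply Rmult_le_compat_r; [left; apply exp_pos|auto]. }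
    replace (exp (- ((1 + A) * y)) * ((/ 2) ^ K * exp (2 * v) * exp v)) with ((/ 2) ^ K * exp (- ((1 + A) * y) + 2 * v + v)).
    2:{ rewrite !exp_plus. ring. }
    apply Rmult_le_compat_l; [apply pow_le; lra|]. unfold npowR. fold y. apply exp_le. nra. }
  rewrite !Cmod_mult, Cmod_R, (Rabs_pos_eq (lam _)) by apply lam_nonneg.
  destruct Hc as [_ [_ Hb]]. specialize (Hb (S n)). assert (H := lam_nonneg (S n)).
  assert (H0 := Cmod_ge_0 (chi (S n))). assert (H1 := Cmod_ge_0 (npowC (1 + A + z) n - P)).
  apply Rle_trans with (lam (S n) * ((/ 2) ^ K * npowR (1 + A / 2) n)); [|right; ring].
  rewrite Rmult_assoc. apply Rmult_le_compat_l; [auto|].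
  apply Rle_trans with (1 * Cmod (npowC (1 + A + z) n - P)); [apply Rmult_le_compat_r; auto|lra].
Qed.

Definition pweight (K n : nat) : R := npowR 1 n * pois K (A * lnS n).

(** At [z = - A] the alternating signs cancel, and [exp (- A y)] times a partial exponential sum at
    [A y] is a Poisson probability. The weights are therefore nonnegative, on which both final
    inequalities rest. *)
Lemma psum_hk_at_minus_A n K : psum (fun k => RtoC (altsgn k * hk (1 + A) k (lnS n))) (- A)%C K = RtoC (pweight K n).
Proof.
  rewrite psum_hk. unfold pweight, pois, npowR. set (y := lnS n).
  rewrite (csum_ext _ (fun k => RtoC ((A * y) ^ k / INR (fact k)))).
  - rewrite csum_RtoC, <- RtoC_mult. f_equal. rewrite <- Rmult_assoc, <- exp_plus. f_equal. f_equal. ring.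
  - intros k _. unfold Rdiv, Cdiv. rewrite RtoC_mult, RtoC_pow, RtoC_inv, RtoC_mult by (apply Rgt_not_eq, INR_fact_pos).
    f_equal. f_equal. ring.
Qed.

Lemma psum_logseries_at_minus_A K :
  is_lim_seq (rsum (fun n => lam (S n) * Re (chi (S n)) * pweight K n)) (Re (psum logseries_coeff (- A)%C K)).
Proof.
  apply (is_lim_seq_ext (fun N => Re (csum (fun n => RtoC (lam (S n)) * chi (S n) *
      psum (fun k => RtoC (altsgn k * hk (1 + A) k (lnS n))) (- A)%C K)%C N))).
  - intros N. rewrite csum_Re. apply rsum_ext; intros n _. rewrite psum_hk_at_minus_A.
    replace (RtoC (lam (S n)) * chi (S n) * RtoC (pweight K n))%C with (RtoC (lam (S n) * pweight K n) * chi (S n))%C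
      by (rewrite RtoC_mult; ring).
    rewrite Re_mult_scal. ring.
  - apply Clim_Re, psum_logseries_lim.
Qed.
End Expansion.

(** * Cubic characters *)

Lemma char_mod q chi n : dirichlet_char q chi -> chi (n mod q)%nat = chi n.
Proof.
  (* By convention [n mod 0] is [n]. *)
  intros [Hp _]. destruct q as [|q]; [reflexivity|].
  rewrite (Nat.div_mod_eq n (S q)) at 2. generalize (n / S q)%nat. intros k.
  induction k as [|k IH].
  - rewrite Nat.mul_0_r. reflexivity.
  - replace (S q * S k + n mod S q)%nat with ((S q * k + n mod S q) + S q)%nat by lia.
    rewrite Hp. exact IH.
Qed.

(** * Sums of a character over a period *)

Definition list_csum (l : list C) : C := fold_right Cplus (RtoC 0) l.

Lemma list_csum_app l l' : list_csum (l ++ l') = (list_csum l + list_csum l')%C.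
Proof. induction l as [|x l IH]; simpl; [ring|rewrite IH; ring]. Qed.

Lemma list_csum_perm l l' : Permutation l l' -> list_csum l = list_csum l'.
Proof. induction 1; simpl; try congruence; ring. Qed.

Lemma csum_list_csum f n : csum f n = list_csum (map f (seq 0 n)).
Proof.
  induction n as [|n IH]; [reflexivity|]. rewrite seq_S, map_app, list_csum_app, <- IH. simpl. ring.
Qed.

Lemma residues_permutation a q : (0 < q)%nat -> Nat.gcd a q = 1%nat ->
  Permutation (map (fun n => (a * n) mod q)%nat (seq 0 q)) (seq 0 q).
Proof.
  intros Hq Hg. apply NoDup_Permutation_bis.
  - apply NoDup_map_NoDup_ForallPairs; [|apply seq_NoDup].
    assert (W : forall x y, (x < q)%nat -> (y < q)%nat -> (x <= y)%nat ->
                 ((a * x) mod q = (a * y) mod q)%nat -> x = y).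
    { intros x y Hx Hy Hxy E.
      assert (D : Nat.divide q (a * (y - x))).
      { apply Nat.Lcm0.mod_divide. 
        assert (E1 := Nat.div_mod_eq (a * x) q). assert (E2 := Nat.div_mod_eq (a * y) q).
        replace (a * (y - x))%nat with ((a * y / q - a * x / q) * q)%nat.
        - apply Nat.Div0.mod_mul.
        - rewrite Nat.mul_sub_distr_l, Nat.mul_sub_distr_r. rewrite E in E1. lia. }
      apply Nat.gauss in D; [|rewrite Nat.gcd_comm; auto].
      destruct D as [c Hc]. destruct c; [lia|nia]. }
    intros x y Hx Hy E. apply in_seq in Hx. apply in_seq in Hy.
    destruct (le_lt_dec x y); [apply W; auto; lia|symmetry; apply W; auto; lia].
  - rewrite length_map; auto.
  - intros x Hx. apply in_map_iff in Hx. destruct Hx as [n [<- _]]. apply in_seq.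
    split; [lia|]. apply Nat.mod_upper_bound; lia.
Qed.

(** Multiplication by [a] permutes the residues, so the sum equals [chi a] times itself, with
    [chi a] different from 1. *)
Lemma char_period_sum q chi a : (0 < q)%nat -> dirichlet_char q chi ->
  chi a <> RtoC 0 -> chi a <> RtoC 1 -> csum chi q = RtoC 0.
Proof.
  intros Hq Hd Ha0 Ha1. assert (Hd' := Hd). destruct Hd' as [Hp [Hm [_ Hz]]].
  assert (Hg : Nat.gcd a q = 1%nat).
  { apply NNPP; intros H. apply Ha0. apply Hz; auto. }
  assert (E : (chi a * csum chi q)%C = csum chi q).
  { rewrite <- csum_scal. rewrite (csum_ext _ (fun n => chi ((a * n) mod q)%nat)).
    2:{ intros n _. rewrite char_mod by auto. symmetry; apply Hm. }
    rewrite !csum_list_csum. rewrite <- (map_map (fun n => (a * n) mod q)%nat chi).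
    apply list_csum_perm, Permutation_map, residues_permutation; auto. }
  assert (H1 : (1 - chi a)%C <> RtoC 0).
  { intros H. apply Ha1. replace (chi a) with (1 - (1 - chi a))%C by ring. rewrite H; ring. }
  transitivity ((1 - chi a) * csum chi q / (1 - chi a))%C; [field; auto|].
  replace ((1 - chi a) * csum chi q)%C with (csum chi q - chi a * csum chi q)%C by ring.
  rewrite E. field; auto.
Qed.

Section Cubic.
Variables (q : nat) (chi : nat -> C).
Hypothesis Hq : (0 < q)%nat.
Hypothesis Hd : dirichlet_char q chi.
Hypothesis Ho : char_order q chi 3.

Lemma cubic_cube n : chi n <> RtoC 0 -> (chi n ^ 3)%C = RtoC 1.
Proof.
  intros Hn. destruct Ho as [_ [H3 _]].
  change ((chi n ^ 3)%C) with (char_pow chi 3 n). rewrite H3. unfold principal_char.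
  destruct (Nat.eqb_spec (Nat.gcd n q) 1); [reflexivity|].
  exfalso; apply Hn. apply Hd; auto.
Qed.

Lemma cubic_bounded_mult : bounded_mult chi.
Proof.
  destruct Hd as [_ [Hm [H1 _]]]. split; [auto|split; [auto|]].
  intros n. destruct (Ceq_dec (chi n) 0) as [E|E]; [rewrite E, Cmod_0; lra|].
  assert (H := cubic_cube n E). apply (f_equal Cmod) in H. rewrite Cmod_pow, Cmod_1 in H.
  assert (H0 := Cmod_ge_0 (chi n)). simpl in H.
  apply Rnot_lt_le; intros Hlt. nra.
Qed.

Lemma cubic_nontrivial : exists a, chi a <> RtoC 0 /\ chi a <> RtoC 1.
Proof.
  destruct Ho as [_ [_ H]]. specialize (H 1%nat ltac:(lia)).
  apply NNPP; intros Hn. apply H. apply functional_extensionality; intros n.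
  unfold char_pow, principal_char. rewrite Cpow_1_r.
  destruct (Nat.eqb_spec (Nat.gcd n q) 1) as [E|E].
  - apply NNPP; intros H1. apply Hn. exists n; split; [|auto].
    intros H0. apply Hd in H0. auto.
  - apply Hd; auto.
Qed.

Lemma cubic_not_principal : chi <> principal_char q.
Proof.
  intros E. destruct cubic_nontrivial as [a [H0 H1]]. rewrite E in H0, H1. unfold principal_char in *.
  destruct (Nat.gcd a q =? 1)%nat; auto.
Qed.

Lemma cubic_Re_ge n : chi n <> RtoC 0 -> - / 2 <= Re (chi n).
Proof.
  intros Hn. assert (H := cubic_cube n Hn). destruct (chi n) as [a b]. 
  simpl in H. unfold Cmult in H; simpl in H. injection H as E1 E2. simpl.
  (* The real part of the cube gives [a^3 - 1 = 3 a b^2], the imaginary part [b (3 a^2 - b^2) = 0].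
     Either [b = 0] and [a = 1], or [b^2 = 3 a^2] and [a = - 1/2]. *)
  assert (E3 : (a - 1) * ((a + / 2) ^ 2 + 3 / 4 + (a - 1) * 0) = 3 * a * b ^ 2) by nra.
  assert (E4 : b * (3 * a ^ 2 - b ^ 2) = 0) by nra.
  apply Rmult_integral in E4. destruct E4 as [E4|E4]; [subst b|]; nra.
Qed.

(** Full periods cancel and fewer than [q] terms are left. This trivial bound is good enough because
    only its logarithm enters the error. *)
Lemma cubic_partial_sums N : Cmod (csum (fun n => chi (S n)) N) <= INR q.
Proof.
  destruct cubic_nontrivial as [a [Ha0 Ha1]].
  assert (Hz := char_period_sum q chi a Hq Hd Ha0 Ha1).
  assert (Hb := proj2 (proj2 cubic_bounded_mult)).
  assert (Hper : forall n k, chi (q * k + n)%nat = chi n).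
  { intros n k. induction k as [|k IH]; [rewrite Nat.mul_0_r; reflexivity|].
    replace (q * S k + n)%nat with ((q * k + n) + q)%nat by lia. rewrite (proj1 Hd). exact IH. }
  assert (Hz' : csum (fun n => chi (S n)) q = RtoC 0).
  { assert (E := csum_shift chi q). rewrite csum_S, Hz in E.
    assert (Hq0 : chi q = chi O) by (rewrite <- (Hper O 1%nat); f_equal; lia).
    rewrite Hq0 in E. replace (csum (fun k => chi (S k)) q) with (chi O + csum (fun k => chi (S k)) q - chi O)%C by ring.
    rewrite <- E. ring. }
  assert (Hk : forall k, csum (fun n => chi (S n)) (q * k) = RtoC 0).
  { induction k as [|k IH]; [rewrite Nat.mul_0_r; reflexivity|].
    rewrite Nat.mul_succ_r, csum_app, IH.
    rewrite (csum_ext _ (fun n => chi (S n))), Hz'; [ring|].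
    intros n _. rewrite <- (Hper (S n) k). f_equal; lia. }
  rewrite (Nat.div_mod_eq N q), csum_app, Hk, Cplus_0_l.
  eapply Rle_trans; [apply csum_Cmod|].
  apply Rle_trans with (rsum (fun _ => 1) (N mod q)); [apply rsum_le; intros; apply Hb|].
  rewrite rsum_const, Rmult_1_r. apply le_INR. assert (H := Nat.mod_upper_bound N q). lia.
Qed.

(** No prime is at most 1, so sieving up to 1 leaves the whole series. *)
Lemma dseries_near_1 s : 1 < Re s -> Cmod (dseries chi s - 1) <= / (Re s - 1).
Proof.
  intros Hs. assert (H := sieved_near_1 (Re s) _ Hs (twist_cmult_bounded chi s cubic_bounded_mult) O).
  rewrite npowR_0 in H. unfold Rdiv in H. rewrite Rmult_1_l in H. exact H.
Qed.

Lemma psum_split b z K : psum b z (S K) = (b O + psum1 (fun k => b (S k)) z K)%C.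
Proof. unfold psum, psum1. rewrite csum_shift. simpl Cpow at 1. ring. Qed.

(** The disc of radius [A + 1/2 - delta] around [1 + A] stays in [Re s > 1/2], where GRH excludes
    zeros, and contains [s = 1]. The 12 is 3 * 2 * 2: the coefficients are bounded by [3 q], the
    factor [1 / (1 - r / (1 + A))] is at most [2 (1 + A)], and the value at the centre has modulus
    at least 1/2 because [A >= 2]. *)
Theorem cubic_L1_approximation (A delta : R) (K : nat) : GRH -> 2 <= A -> 0 < delta < / 2 ->
  Lfun chi 1 <> RtoC 0 /\
  Rabs (ln (Cmod (Lfun chi 1)) - Re (psum (logseries_coeff A chi) (- A)%C (S K)))
   <= 2 * ln (12 * (1 + A) * INR q) * ((A / (A + / 2 - delta)) ^ S K / (1 - A / (A + / 2 - delta))).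
Proof.
  intros HG HA Hdel.
  set (f := fun n => chi (S n)). set (r := A + / 2 - delta).
  assert (Hf : forall n, Cmod (f n) <= 1) by (intros; apply (proj2 (proj2 cubic_bounded_mult))).
  assert (Hq1 : 1 <= INR q) by (change 1 with (INR 1); apply le_INR; lia).
  destruct (dirichlet_power_series (1 + A) (INR q) f ltac:(lra) ltac:(lra) Hf cubic_partial_sums) as [Hps Hlim].
  set (g := fun z => cseries (fun k => dcoef (1 + A) f k * z ^ k)%C) in *.
  assert (HgL : forall z, Cmod z < 1 + A -> g z = Lfun chi (1 + A + z)).
  { intros z Hz. symmetry. apply Clim_cseries. rewrite <- RtoC_plus. apply Hlim, Hz. }
  assert (Hnz : forall s, 1 / 2 < Re s -> Lfun chi s <> RtoC 0).
  { apply (proj2 HG q chi); [lia|auto|apply cubic_not_principal]. }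
  assert (E1 : Lfun chi 1 = g (- A)%C).
  { rewrite HgL; [f_equal; ring|]. rewrite Cmod_opp, Cmod_R, Rabs_pos_eq; lra. }
  split; [apply Hnz; simpl; lra|].
  assert (Hb0 : dcoef (1 + A) f 0 = dseries chi (1 + A)).
  { apply cseries_ext; intros n. unfold f. rewrite <- RtoC_plus, npowC_R. f_equal. f_equal.
    unfold altsgn, hk, npowR. simpl pow. simpl fact. simpl INR.
    replace (- ((1 + A) * lnS n)) with (- (1 + A) * lnS n) by ring. field. }
  assert (Hnear := dseries_near_1 (1 + A)%C ltac:(simpl; lra)).
  assert (Hb0m : / 2 <= Cmod (dcoef (1 + A) f 0)).
  { rewrite Hb0. simpl Re in Hnear. replace (1 + A - 1) with A in Hnear by ring.
    assert (/ A <= / 2) by (apply Rinv_le_contravar; lra).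
    assert (T := Cmod_triangle_minus (dseries chi (1 + A)) 1). rewrite Cmod_1 in T.
    apply Rabs_le_between in T. lra. }
  rewrite E1.
  replace (Re (psum (logseries_coeff A chi) (- A)%C (S K))) with
     (ln (Cmod (dcoef (1 + A) f 0)) + Re (psum1 (fun k => logseries_coeff A chi (S k)) (- A)%C K)).
  2:{ rewrite psum_split, Hb0. rewrite <- (Re_logseries_coeff_0 A chi ltac:(lra) cubic_bounded_mult).
      destruct (logseries_coeff A chi 0), (psum1 (fun k => logseries_coeff A chi (S k)) (- A)%C K); reflexivity. }
  rewrite Rminus_plus_distr.
  eapply Rle_trans.
  { refine (log_taylor_remainder (dcoef (1 + A) f) (fun k => logseries_coeff A chi (S k)) (3 * INR q) (1 + A) r (A / 6) g
             Hps _ _ _ _ A (- A)%C K _ _).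
    - unfold r; lra.
    - unfold r; lra.
    - intros z Hz. rewrite HgL by (unfold r in Hz; lra). apply Hnz.
      assert (H := re_le_Cmod z). apply Rabs_le_between in H. unfold r in Hz. destruct z; simpl in *. lra.
    - intros eta He.
      destruct (geom_eventually_small (lnzeta (1 + A / 2)) (/ 2) eta ltac:(lra) He) as [K0 HK0].
      exists K0; intros K' HK' z Hz.
      assert (H := log_dseries_expansion A chi ltac:(lra) cubic_bounded_mult z (S K') ltac:(lra)).
      eapply Rle_trans; [|apply (HK0 (S K')); lia].
      eapply Rle_trans; [|exact H]. right. f_equal.
      rewrite psum_split, Hb0, <- (Re_logseries_coeff_0 A chi ltac:(lra) cubic_bounded_mult), HgL by lra.
      change (Lfun chi (1 + A + z)) with (dseries chi (1 + A + z)).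
      assert (RR : forall x y, Re (x + y)%C = Re x + Re y) by (intros [] []; reflexivity).
      rewrite RR. ring.
    - unfold r; lra.
    - rewrite Cmod_opp, Cmod_R, Rabs_pos_eq; lra. }
  assert (Hq' := ratio_bounds A r ltac:(unfold r; lra) ltac:(unfold r; lra)).
  apply Rmult_le_compat_r.
  { apply Rmult_le_pos; [apply pow_le; lra|left; apply Rinv_0_lt_compat; lra]. }
  apply Rmult_le_compat_l; [lra|].
  assert (Hr1 : 1 - r / (1 + A) = (/ 2 + delta) / (1 + A)) by (unfold r; field; lra).
  rewrite Hr1.
  assert (Hpos : 0 < (/ 2 + delta) / (1 + A)) by (apply Rdiv_lt_0_compat; lra).
  apply ln_le.
  - repeat apply Rdiv_lt_0_compat; lra.
  - apply Rmult_le_reg_r with (Cmod (dcoef (1 + A) f 0)); [lra|].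
    unfold Rdiv at 1. rewrite Rmult_assoc, Rinv_l, Rmult_1_r by lra.
    apply Rle_trans with (12 * (1 + A) * INR q * / 2); [|apply Rmult_le_compat_l; [nra|auto]].
    apply Rmult_le_reg_r with (/ 2 + delta); [lra|].
    replace (3 * INR q / ((/ 2 + delta) / (1 + A)) * (/ 2 + delta)) with (3 * INR q * (1 + A)) by (field; lra).
    assert (0 <= (1 + A) * INR q) by nra. nra.
Qed.
End Cubic.

(** * The zeta function at its pole *)

Lemma Clim_incr u l : Clim (fun n => u (S n)) l -> Clim u l.
Proof.
  intros H eps He. destruct (H eps He) as [N HN]. exists (S N); intros [|n] Hn; [lia|]. apply HN; lia.
Qed.

Lemma Re_plus (x y : C) : Re (x + y)%C = Re x + Re y.
Proof. destruct x, y; reflexivity. Qed.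

Section Zeta.
Variable A : R.
Hypothesis HA : 0 < A.

(** Lowering the index corresponds, up to sign, to multiplying the Taylor series by [z]. *)
Definition prevh (k : nat) (y : R) : R := match k with O => 0 | S k' => hk (1 + A) k' y end.
Definition dH (k : nat) (y : R) : R := prevh k y - A * hk (1 + A) k y.
(* Up to sign, the k-th Taylor coefficient of [(m+1)^(1-s) - m^(1-s) + (s-1) m^(-s)] at [s = 1 + A],
   where [m = n + 1]; [dH k (ln x)] is the derivative of [hk A k (ln x)] in [x]. *)
Definition delta_term (k n : nat) : R := hk A k (lnS (S n)) - hk A k (lnS n) - dH k (lnS n).

Lemma hk_shift s k y : hk (1 + s) k y = hk s k y * exp (- y).
Proof.
  unfold hk. replace (- ((1 + s) * y)) with (- (s * y) + - y) by ring. rewrite exp_plus. ring.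
Qed.

Lemma is_derive_hk_ln k x : 0 < x -> is_derive (fun x => hk A k (ln x)) x (dH k (ln x)).
Proof.
  intros Hx.
  assert (E : exp (- ln x) = / x) by (rewrite exp_Ropp, exp_ln; auto).
  assert (Hf := INR_fact_pos k).
  destruct k as [|k]; unfold dH, prevh; rewrite !hk_shift, E; unfold hk.
  - auto_derive; [auto|]. simpl. field. lra.
  - evar_last.
    { apply (is_derive_mult (fun x => ln x ^ S k / INR (fact (S k))) (fun x => exp (- (A * ln x)))).
      - apply (is_derive_ext (fun x => / INR (fact (S k)) * ln x ^ S k)); [intros t; apply Rmult_comm|].
        apply is_derive_scal. apply is_derive_pow. auto_derive; [auto|reflexivity].
      - auto_derive; [auto|reflexivity].
      - intros; apply Rmult_comm. }
    change (/ INR (fact (S k)) * (INR (S k) * (1 * / x) * ln x ^ k) * exp (- (A * ln x)) +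
      ln x ^ S k / INR (fact (S k)) * (- (A * (1 * / x)) * exp (- (A * ln x))) =
      ln x ^ k / INR (fact k) * exp (- (A * ln x)) * / x -
      A * (ln x ^ S k / INR (fact (S k)) * exp (- (A * ln x)) * / x)).
    rewrite fact_simpl, mult_INR. assert (Hf' := INR_fact_pos k).
    field. repeat split; try lra. apply not_0_INR; lia.
Qed.

(** The increment of [hk A k (ln x)] over a unit interval is its derivative at an inner point. The
    total size of the [delta_term]s thus becomes a variation of [dH], bounded uniformly by
    [hk_variation]. *)
Lemma delta_term_mvt k n : exists y', lnS n <= y' <= lnS (S n) /\ delta_term k n = dH k y' - dH k (lnS n).
Proof.
  assert (H1 := INR_S_ge_1 n).
  assert (HS : INR (S (S n)) = INR (S n) + 1) by (rewrite (S_INR (S n)); ring).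
  destruct (MVT_gen (fun x => hk A k (ln x)) (INR (S n)) (INR (S (S n))) (fun x => dH k (ln x))) as [c [Hc E]].
  { intros x Hx. rewrite Rmin_left, Rmax_right in Hx by lra. apply is_derive_hk_ln; lra. }
  { intros x Hx. rewrite Rmin_left, Rmax_right in Hx by lra.
    apply derivable_continuous_pt. exists (dH k (ln x)). apply is_derive_Reals, is_derive_hk_ln; lra. }
  rewrite Rmin_left, Rmax_right in Hc by lra.
  exists (ln c). split.
  - split; apply ln_le; lra.
  - unfold delta_term, lnS. rewrite HS in *. rewrite E. ring.
Qed.

Lemma delta_variation k N : (1 + A) ^ k * rsum (fun n => Rabs (delta_term k n)) N <= 4 * (1 + A).
Proof.
  set (y' := fun n => proj1_sig (constructive_indefinite_description _ (delta_term_mvt k n))).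
  assert (Hy' : forall n, lnS n <= y' n <= lnS (S n) /\ delta_term k n = dH k (y' n) - dH k (lnS n)).
  { intros n. unfold y'. apply proj2_sig. }
  assert (V := fun k => hk_variation (1 + A) k lnS y' N ltac:(lra) lnS_nonneg (fun n => proj1 (Hy' n))).
  assert (Hk : 0 < (1 + A) ^ k) by (apply pow_lt; lra).
  apply Rle_trans with ((1 + A) ^ k * rsum (fun n => Rabs (prevh k (y' n) - prevh k (lnS n)) +
       A * Rabs (hk (1 + A) k (y' n) - hk (1 + A) k (lnS n))) N).
  - apply Rmult_le_compat_l; [lra|]. apply rsum_le; intros n _. rewrite (proj2 (Hy' n)). unfold dH.
    replace (prevh k (y' n) - A * hk (1 + A) k (y' n) - (prevh k (lnS n) - A * hk (1 + A) k (lnS n))) with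
      ((prevh k (y' n) - prevh k (lnS n)) + - (A * (hk (1 + A) k (y' n) - hk (1 + A) k (lnS n)))) by ring.
    eapply Rle_trans; [apply Rabs_triang|]. rewrite Rabs_Ropp, Rabs_mult, (Rabs_pos_eq A) by lra. lra.
  - rewrite rsum_plus, rsum_scal, Rmult_plus_distr_l.
    assert (V1 := V k).
    assert (V2 : (1 + A) ^ k * rsum (fun n => Rabs (prevh k (y' n) - prevh k (lnS n))) N <= 2 * (1 + A)).
    { destruct k as [|k]; unfold prevh.
      - rewrite rsum_zero; [lra|]. intros; rewrite Rminus_diag; apply Rabs_R0.
      - assert (V2 := V k). simpl pow. nra. }
    nra.
Qed.

Definition zcoefN (k N : nat) : C :=
  ((if Nat.eqb k 0 then RtoC 1 else RtoC 0) + csum (fun n => RtoC (altsgn k * delta_term k n)) N)%C.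
Definition zcoef (k : nat) : C :=
  ((if Nat.eqb k 0 then RtoC 1 else RtoC 0) + cseries (fun n => RtoC (altsgn k * delta_term k n)))%C.

Lemma zcoefN_lim k : Clim (zcoefN k) (zcoef k).
Proof.
  apply Clim_plus; [apply Clim_const|].
  apply (cseries_converges _ (4 * (1 + A) / (1 + A) ^ k)). intros N.
  assert (Hk : 0 < (1 + A) ^ k) by (apply pow_lt; lra).
  apply Rmult_le_reg_l with ((1 + A) ^ k); [auto|].
  replace ((1 + A) ^ k * (4 * (1 + A) / (1 + A) ^ k)) with (4 * (1 + A)) by (field; lra).
  eapply Rle_trans; [|apply (delta_variation k N)]. right. f_equal.
  apply rsum_ext; intros n _. rewrite Cmod_R, Rabs_mult, Rabs_altsgn. ring.
Qed.

Lemma zcoefN_bound k N : Cmod (zcoefN k N) * (1 + A) ^ k <= 5 * (1 + A).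
Proof.
  assert (Hk : 0 < (1 + A) ^ k) by (apply pow_lt; lra).
  apply Rle_trans with ((Cmod (if Nat.eqb k 0 then RtoC 1 else RtoC 0) + rsum (fun n => Rabs (delta_term k n)) N) * (1 + A) ^ k).
  - apply Rmult_le_compat_r; [lra|]. eapply Rle_trans; [apply Cmod_triangle|].
    apply Rplus_le_compat_l. eapply Rle_trans; [apply csum_Cmod|]. right.
    apply rsum_ext; intros n _. rewrite Cmod_R, Rabs_mult, Rabs_altsgn. ring.
  - assert (V := delta_variation k N).
    assert (Cmod (if Nat.eqb k 0 then RtoC 1 else RtoC 0) * (1 + A) ^ k <= 1 + A).
    { destruct k; simpl; [rewrite Cmod_1|rewrite Cmod_0]; lra. }
    lra.
Qed.

(* [(s - 1) zeta(s)] at [s = 1 + A + z]. *)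
Definition regzeta (z : C) : C := cseries (fun k => zcoef k * z ^ k)%C.
(** What the telescoping of the first [N] [delta_term]s, started from 1, adds up to. The boundary
    term [(N+1)^(1-s)] vanishes in the limit for [Re s > 1], and at [s = 1] the whole expression is
    1 for every [N], which gives the value at the pole. *)
Definition regzetaN (z : C) (N : nat) : C := (npowC (A + z) N + (A + z) * csum (npowC (1 + A + z)) N)%C.

Lemma psum_prevh_lim z y :
  Clim (psum (fun k => RtoC (- (altsgn k * prevh k y))) z) (z * cexp (- (1 + A + z) * y))%C.
Proof.
  apply Clim_incr.
  apply (Clim_ext (fun M => z * psum (fun k => RtoC (altsgn k * hk (1 + A) k y)) z M)%C).
  - intros M. unfold psum. rewrite csum_shift, <- csum_scal. simpl prevh at 1.
    rewrite Rmult_0_r, Ropp_0, Cmult_0_l, Cplus_0_l. apply csum_ext; intros k _.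
    rewrite Cpow_S. simpl prevh. replace (- (altsgn (S k) * hk (1 + A) k y)) with (altsgn k * hk (1 + A) k y) by (unfold altsgn; simpl; ring).
    ring.
  - rewrite <- RtoC_plus. apply Clim_scal, psum_hk_lim.
Qed.

Lemma zcoefN_psum_lim z N : Clim (psum (fun k => zcoefN k N) z) (regzetaN z N).
Proof.
  induction N as [|N IH].
  - apply Clim_incr. apply (Clim_ext (fun _ => RtoC 1)).
    + intros M. unfold psum. rewrite csum_shift, csum_zero.
      * unfold zcoefN; simpl. ring.
      * intros k _. unfold zcoefN; simpl. ring.
    + replace (regzetaN z 0) with (RtoC 1); [apply Clim_const|].
      unfold regzetaN. simpl csum. rewrite npowC_cexp. unfold lnS. simpl INR. rewrite ln_1.
      replace (- (A + z) * 0)%C with (RtoC 0) by ring. rewrite cexp_R, exp_0. ring.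
  - apply (Clim_ext (fun M => psum (fun k => zcoefN k N) z M +
       ((psum (fun k => RtoC (altsgn k * hk A k (lnS (S N)))) z M + RtoC (-1) * psum (fun k => RtoC (altsgn k * hk A k (lnS N))) z M) +
        (psum (fun k => RtoC (- (altsgn k * prevh k (lnS N)))) z M + A * psum (fun k => RtoC (altsgn k * hk (1 + A) k (lnS N))) z M)))%C).
    { intros M. unfold psum. rewrite <- !csum_scal, <- !csum_plus. apply csum_ext; intros k _.
      unfold zcoefN. rewrite csum_S. unfold delta_term, dH.
      replace (RtoC (altsgn k * (hk A k (lnS (S N)) - hk A k (lnS N) - (prevh k (lnS N) - A * hk (1 + A) k (lnS N)))))
       with (RtoC (altsgn k * hk A k (lnS (S N))) + RtoC (-1) * RtoC (altsgn k * hk A k (lnS N)) +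
             (RtoC (- (altsgn k * prevh k (lnS N))) + A * RtoC (altsgn k * hk (1 + A) k (lnS N))))%C.
      - ring.
      - rewrite <- !RtoC_mult, <- !RtoC_plus. f_equal. ring. }
    replace (regzetaN z (S N)) with (regzetaN z N + ((cexp (- (A + z) * lnS (S N)) + RtoC (-1) * cexp (- (A + z) * lnS N)) +
       (z * cexp (- (1 + A + z) * lnS N) + A * cexp (- (1 + A + z) * lnS N))))%C.
    2:{ unfold regzetaN. rewrite csum_S, !npowC_cexp.
        replace (RtoC (-1)) with (- RtoC 1)%C by (rewrite <- RtoC_opp; f_equal; lra). ring. }
    apply Clim_plus; [exact IH|]. apply Clim_plus; apply Clim_plus.
    + apply psum_hk_lim.
    + apply Clim_scal, psum_hk_lim.
    + apply psum_prevh_lim.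
    + rewrite <- RtoC_plus. apply Clim_scal, psum_hk_lim.
Qed.

Lemma zcoef_bound k : Cmod (zcoef k) * (1 + A) ^ k <= 5 * (1 + A).
Proof.
  assert (Hk : 0 < (1 + A) ^ k) by (apply pow_lt; lra).
  apply Rmult_le_reg_r with (/ (1 + A) ^ k); [apply Rinv_0_lt_compat; auto|].
  rewrite Rmult_assoc, Rinv_r, Rmult_1_r by lra.
  replace (zcoef k) with (zcoef k - 0)%C by ring.
  apply (Clim_Cmod_le _ _ _ _ (zcoefN_lim k)). exists O; intros n _.
  replace (zcoefN k n - 0)%C with (zcoefN k n) by ring.
  apply Rmult_le_reg_r with ((1 + A) ^ k); [auto|]. rewrite Rmult_assoc, Rinv_l, Rmult_1_r by lra.
  apply zcoefN_bound.
Qed.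

Lemma regzeta_power_sum : power_sum_on zcoef (5 * (1 + A)) (1 + A) regzeta.
Proof. apply power_sum_on_cseries; [lra|lra|apply zcoef_bound]. Qed.

Lemma regzeta_lim z : Cmod z < 1 + A -> Clim (regzetaN z) (regzeta z).
Proof.
  intros Hz. apply (power_series_tannery zcoefN zcoef _ (5 * (1 + A)) (1 + A) z); try lra.
  - apply zcoefN_lim.
  - apply zcoefN_bound.
  - apply zcoefN_psum_lim.
Qed.

Lemma regzeta_pole : regzeta (- A)%C = RtoC 1.
Proof.
  symmetry. apply (Clim_unique (regzetaN (- A)%C)).
  - apply (Clim_ext (fun _ => RtoC 1)); [|apply Clim_const].
    intros N. unfold regzetaN. rewrite npowC_cexp. replace (A + - A)%C with (RtoC 0) by ring.
    replace (- 0 * lnS N)%C with (RtoC 0) by ring. rewrite cexp_R, exp_0. ring.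
  - apply regzeta_lim. rewrite Cmod_opp, Cmod_R, Rabs_pos_eq; lra.
Qed.

Lemma regzeta_zeta z : Cmod z < 1 + A -> - A < Re z -> regzeta z = ((A + z) * dseries (fun _ => 1) (1 + A + z))%C.
Proof.
  intros Hz Hre. apply (Clim_unique (regzetaN z)); [apply regzeta_lim, Hz|].
  replace ((A + z) * dseries (fun _ => 1) (1 + A + z))%C with (0 + (A + z) * dseries (fun _ => 1) (1 + A + z))%C by ring.
  apply Clim_plus.
  - intros eps He.
    assert (Hp : 0 < Re (A + z)%C) by (destruct z; simpl in *; lra).
    destruct (is_lim_seq_eps _ _ (npowR_lim_0 _ Hp) eps He) as [N HN]. exists N; intros n Hn.
    specialize (HN n Hn). rewrite Rminus_0_r, Rabs_pos_eq in HN by (left; apply npowR_pos).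
    replace (npowC (A + z) n - 0)%C with (npowC (A + z) n) by ring. rewrite Cmod_npowC. exact HN.
  - apply Clim_scal.
    assert (Hp : 1 < Re (1 + A + z)%C) by (destruct z; simpl in *; lra).
    apply (Clim_ext (csum (fun n => 1 * npowC (1 + A + z) n)%C)).
    { intros N; apply csum_ext; intros; ring. }
    apply (cseries_converges _ (1 + / (Re (1 + A + z)%C - 1))). intros N.
    eapply Rle_trans; [|apply (npowR_sum_bound _ N Hp)]. apply rsum_le; intros n _.
    rewrite Cmult_1_l, Cmod_npowC. lra.
Qed.

(** The closed disc meets [Re s <= 1] only at [s = 1], where the value is 1; elsewhere the Euler
    product excludes zeros. *)
Lemma regzeta_nonzero_closed z : Cmod z <= A -> regzeta z <> RtoC 0.
Proof.
  intros Hz. destruct (Rle_lt_dec (Re z) (- A)) as [H|H].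
  - assert (E : z = (- A)%C).
    { assert (E := Cmod2_alt z). assert (H0 := Cmod_ge_0 z).
      assert (Hi : Im z = 0) by nra. assert (Hr : Re z = - A) by nra.
      destruct z as [a b]; simpl in *. subst. unfold RtoC, Copp; simpl. f_equal; ring. }
    rewrite E, regzeta_pole. intros E1; injection E1; lra.
  - rewrite regzeta_zeta by (auto; lra). apply Cmult_neq_0.
    + intros E. apply (f_equal Re) in E. destruct z; simpl in *. lra.
    + apply dseries_nonzero; [apply trivial_bounded_mult|]. destruct z; simpl in *; lra.
Qed.

(** By compactness the modulus is at least some [m > 0] on the closed disc, and uniform continuity
    carries this a little further, through the radial projection [z'] onto the circle of radius [A].
    No explicit [r] is required, as [A] is fixed independently of [q]. *)
Lemma regzeta_nonzero_larger : exists r, A < r < 1 + A /\ forall z, Cmod z <= r -> regzeta z <> RtoC 0.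
Proof.
  destruct (disc_lower_bound _ _ _ _ A regzeta_power_sum ltac:(lra) regzeta_nonzero_closed) as [m [Hm Hmz]].
  destruct (power_sum_continuous _ _ _ _ (A + / 2) regzeta_power_sum ltac:(lra) (m / 2) ltac:(lra)) as [d [Hd Hcont]].
  exists (A + Rmin (/ 2) d). 
  assert (H1 := Rmin_l (/ 2) d). assert (H2 := Rmin_r (/ 2) d).
  assert (H3 : 0 < Rmin (/ 2) d) by (apply Rmin_pos; lra).
  split; [lra|]. intros z Hz.
  destruct (Rle_lt_dec (Cmod z) A) as [H|H]; [apply regzeta_nonzero_closed, H|].
  set (z' := (RtoC (A / Cmod z) * z)%C).
  assert (Hq : 0 < A / Cmod z) by (apply Rdiv_lt_0_compat; lra).
  assert (Hz' : Cmod z' = A).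
  { unfold z'. rewrite Cmod_mult, Cmod_R, Rabs_pos_eq by lra. field. lra. }
  assert (Hzz : Cmod (z - z') = Cmod z - A).
  { replace (z - z')%C with (RtoC (1 - A / Cmod z) * z)%C by (unfold z'; rewrite RtoC_minus; ring).
    rewrite Cmod_mult, Cmod_R, Rabs_pos_eq.
    - field; lra.
    - assert (A / Cmod z < 1); [|lra]. apply Rmult_lt_reg_r with (Cmod z); [lra|].
      unfold Rdiv. rewrite Rmult_assoc, Rinv_l by lra. lra. }
  specialize (Hcont z z' ltac:(lra) ltac:(lra) ltac:(lra)). specialize (Hmz z' ltac:(lra)).
  intros E. rewrite E in Hcont. replace (0 - regzeta z')%C with (- regzeta z')%C in Hcont by ring.
  rewrite Cmod_opp in Hcont. lra.
Qed.

Definition harmonic (K : nat) : R := rsum (fun k => / INR (S k)) K.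

(** At [z = - A] the function [(s - 1) zeta(s)] is 1, so its logarithm is 0 and the Taylor
    polynomials of that logarithm tend to 0. They consist of the weighted prime power sum, of
    [ln A], and of the expansion of [log (1 + z / A)], which at this point is minus a harmonic
    sum. *)
Theorem zeta_weighted_sum :
  is_lim_seq (fun K => Re (psum (logseries_coeff A (fun _ => 1%C)) (- A)%C (S K)) - (harmonic K - ln A)) 0.
Proof.
  destruct regzeta_nonzero_larger as [r [Hr Hnz]].
  set (one := fun _ : nat => RtoC 1).
  assert (Hone : bounded_mult one) by apply trivial_bounded_mult.
  (* The coefficients of log zeta plus those of [log (1 + z / A)], where [s - 1 = A (1 + z / A)];
     the constant [ln A] is kept apart. *)
  set (a := fun k => (logseries_coeff A one (S k) - RtoC ((- / A) ^ S k / INR (S k)))%C).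
  assert (Hb0 : zcoef 0 = (A * dseries one (1 + A))%C).
  { transitivity (regzeta 0).
    - destruct regzeta_power_sum as [_ [_ [_ H]]]. specialize (H (RtoC 0) 1%nat ltac:(rewrite Cmod_0; lra)).
      rewrite Cmod_0 in H. replace (5 * (1 + A) * (0 / (1 + A)) ^ 1 / (1 - 0 / (1 + A))) with 0 in H by (simpl; field; lra).
      assert (E : (regzeta 0 - psum zcoef 0 1)%C = RtoC 0).
      { apply Cmod_eq_0. assert (H0 := Cmod_ge_0 (regzeta 0 - psum zcoef 0 1)); lra. }
      replace (regzeta 0) with ((regzeta 0 - psum zcoef 0 1) + psum zcoef 0 1)%C by ring. rewrite E.
      unfold psum; simpl. ring.
    - rewrite regzeta_zeta by (rewrite ?Cmod_0; simpl; lra).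
      replace (A + 0)%C with (RtoC A) by ring. replace (1 + A + 0)%C with (1 + A)%C by ring. reflexivity. }
  assert (Hdz : forall z, Cmod z <= A / 6 -> dseries one (1 + A + z) <> RtoC 0 /\ (A + z)%C <> RtoC 0 /\
     regzeta z = ((A + z) * dseries one (1 + A + z))%C).
  { intros z Hz. assert (H := re_le_Cmod z). apply Rabs_le_between in H.
    split; [|split].
    - apply dseries_nonzero; auto. destruct z; simpl in *; lra.
    - intros E. apply (f_equal Re) in E. destruct z; simpl in *. lra.
    - apply regzeta_zeta; lra. }
  assert (Hlnb0 : ln (Cmod (zcoef 0)) = ln A + Re (logseries_coeff A one 0)).
  { rewrite Hb0, (Re_logseries_coeff_0 A one HA Hone).
    destruct (Hdz (RtoC 0) ltac:(rewrite Cmod_0; lra)) as [H1 _].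
    replace (1 + A + 0)%C with (1 + A)%C in H1 by ring.
    rewrite ln_Cmod_mult; [|intros E; apply RtoC_inj in E; lra|exact H1].
    rewrite Cmod_R, Rabs_pos_eq by lra. reflexivity. }
  assert (Htl : forall z K, Re (psum1 a z K) = Re (psum1 (fun k => logseries_coeff A one (S k)) z K) -
      rsum (fun k => Re ((- z * / A) ^ S k)%C / INR (S k)) K).
  { intros z K. unfold a. rewrite psum1_minus, Re_minus. f_equal. unfold psum1. rewrite csum_Re.
    apply rsum_ext; intros k _.
    replace (RtoC ((- / A) ^ S k / INR (S k)) * z ^ S k)%C with (RtoC (/ INR (S k)) * (- z * / A) ^ S k)%C.
    - rewrite Re_mult_scal. unfold Rdiv; ring.
    - unfold Rdiv. rewrite RtoC_mult, (RtoC_pow (- / A)), RtoC_opp, (RtoC_inv A) by lra.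
      replace (- z * / A)%C with (- / A * z)%C by ring. rewrite Cpow_mult_l. ring. }
  assert (HT := log_taylor_remainder zcoef a (5 * (1 + A)) (1 + A) r (A / 6) regzeta regzeta_power_sum ltac:(lra) ltac:(lra) Hnz).
  assert (Hcirc : forall eta, 0 < eta -> exists K0, forall K, (K0 <= K)%nat -> forall z, Cmod z = A / 6 ->
     Rabs (ln (Cmod (regzeta z)) - ln (Cmod (zcoef 0)) - Re (psum1 a z K)) <= eta).
  { intros eta He.
    destruct (geom_eventually_small (lnzeta (1 + A / 2)) (/ 2) (eta / 2) ltac:(lra) ltac:(lra)) as [K1 HK1].
    (* On the circle [|z| = A / 6] the point [- z / A] has modulus 1/6, and
       [6/5 = 1 / (1 - 1/6)]. *)
    destruct (geom_eventually_small (6 / 5) (/ 6) (eta / 2) ltac:(lra) ltac:(lra)) as [K2 HK2].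
    exists (max K1 K2); intros K HK z Hz.
    assert (H1 := log_dseries_expansion A one HA Hone z (S K) ltac:(lra)).
    specialize (HK1 (S K) ltac:(lia)). specialize (HK2 (S K) ltac:(lia)).
    destruct (Hdz z ltac:(lra)) as [D1 [D2 D3]].
    assert (Hw : Cmod (- z * / A)%C = / 6).
    { rewrite Cmod_mult, Cmod_opp, Hz, Cmod_inv, Cmod_R, Rabs_pos_eq; [field; lra|lra|].
      intros E; apply RtoC_inj in E; lra. }
    assert (H2 := ln_Cmod_one_minus_expansion (- z * / A)%C K ltac:(rewrite Hw; lra)). rewrite Hw in H2.
    assert (EAz : ln (Cmod (A + z)) = ln A + ln (Cmod (1 - - z * / A))).
    { replace (A + z)%C with (A * (1 - - z * / A))%C by (field; intros E; apply RtoC_inj in E; lra).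
      rewrite ln_Cmod_mult, Cmod_R, Rabs_pos_eq; try lra.
      - intros E; apply RtoC_inj in E; lra.
      - apply one_minus_neq_0. rewrite Hw; lra. }
    rewrite D3, ln_Cmod_mult, EAz, Hlnb0, Htl by auto.
    rewrite psum_split, Re_plus in H1.
    set (T := rsum (fun k => Re ((- z * / A) ^ S k)%C / INR (S k)) K) in *.
    replace ((/ 6) ^ S K / (1 - / 6)) with (6 / 5 * (/ 6) ^ S K) in H2 by field.
    match goal with |- Rabs ?X <= _ => replace X with
     ((ln (Cmod (dseries one (1 + A + z))) - (Re (logseries_coeff A one 0) + Re (psum1 (fun k => logseries_coeff A one (S k)) z K))) +
      (ln (Cmod (1 - - z * / A)) + T)) by ring end.
    eapply Rle_trans; [apply Rabs_triang|]. lra. }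
  specialize (HT Hcirc).
  assert (Hq := ratio_bounds A r ltac:(lra) ltac:(lra)).
  apply is_lim_seq_of_eps. intros eps He.
  set (M := 2 * ln (5 * (1 + A) / (1 - r / (1 + A)) / Cmod (zcoef 0))) in *.
  destruct (geom_eventually_small (M / (1 - A / r)) (A / r) eps Hq He) as [K0 HK0].
  exists K0; intros K HK. specialize (HK0 (S K) ltac:(lia)).
  specialize (HT A (- A)%C K ltac:(lra) ltac:(rewrite Cmod_opp, Cmod_R, Rabs_pos_eq; lra)).
  rewrite regzeta_pole, Cmod_1, ln_1, Hlnb0, Htl in HT.
  rewrite (rsum_ext _ (fun k => / INR (S k))) in HT.
  2:{ intros k _. replace (- - A * / A)%C with (RtoC 1) by (field; intros E; apply RtoC_inj in E; lra).
      rewrite Cpow_1_l. unfold Rdiv. simpl Re. ring. }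
  fold (harmonic K) in HT. rewrite psum_split, Re_plus. fold one.
  rewrite Rminus_0_r, Rabs_minus_sym.
  eapply Rle_trans; [|exact HK0].
  replace (M / (1 - A / r) * (A / r) ^ S K) with (M * ((A / r) ^ S K / (1 - A / r))) by (unfold Rdiv; ring).
  eapply Rle_trans; [|exact HT]. right. f_equal. ring.
Qed.
End Zeta.

(** * The two bounds *)

Lemma ln_le_minus_1 x : 0 < x -> ln x <= x - 1.
Proof. intros Hx. assert (H := exp_ineq1_le (ln x)). rewrite exp_ln in H; lra. Qed.

Lemma ln_ge_1_minus_inv x : 0 < x -> 1 - / x <= ln x.
Proof.
  intros Hx. assert (H := ln_le_minus_1 (/ x) (Rinv_0_lt_compat _ Hx)). rewrite ln_Rinv in H by auto. lra.
Qed.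

Lemma exp_pow x n : exp x ^ n = exp (INR n * x).
Proof.
  induction n as [|n IH]; [simpl; rewrite Rmult_0_l, exp_0; reflexivity|].
  rewrite S_INR, Rmult_plus_distr_r, exp_plus, <- IH, Rmult_1_l. simpl. ring.
Qed.

(** As [euler_gamma] is the real part of a [Lim_seq], existence of a finite limit has to be shown:
    [1 - 1/x <= ln x] makes the sequence decrease, and [ln x <= x - 1] keeps it nonnegative. *)
Lemma euler_gamma_lim : is_lim_seq (fun K => harmonic K - ln (INR K)) euler_gamma.
Proof.
  apply is_lim_seq_incr_1.
  set (u := fun n => harmonic (S n) - ln (INR (S n))).
  assert (E : forall n, u n = sum_f_R0 (fun k => / INR (S k)) n - ln (INR (S n))).
  { intros n. unfold u, harmonic. f_equal. rewrite <- rsum_sum_n. apply sum_n_Reals. }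
  assert (Hstep : forall n, 0 < INR (S n) /\ INR (S (S n)) = INR (S n) + 1).
  { intros n. split; [assert (H := INR_S_ge_1 n); lra|rewrite (S_INR (S n)); ring]. }
  assert (Hex : ex_finite_lim_seq u).
  { apply (ex_finite_lim_seq_decr u 0).
    - intros n. unfold u, harmonic. change (rsum (fun k => / INR (S k)) (S (S n))) with
        (rsum (fun k => / INR (S k)) (S n) + / INR (S (S n))).
      destruct (Hstep n) as [H1 H2]. rewrite H2.
      assert (H := ln_ge_1_minus_inv ((INR (S n) + 1) / INR (S n)) ltac:(apply Rdiv_lt_0_compat; lra)).
      rewrite ln_div in H by lra.
      replace (1 - / ((INR (S n) + 1) / INR (S n))) with (/ (INR (S n) + 1)) in H by (field; lra). lra.
    - assert (G : forall n, ln (INR (S n)) <= harmonic n).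
      { induction n as [|n IH]; [simpl; rewrite ln_1; unfold harmonic; simpl; lra|].
        unfold harmonic in *. change (rsum (fun k => / INR (S k)) (S n)) with (rsum (fun k => / INR (S k)) n + / INR (S n)).
        destruct (Hstep n) as [H1 H2]. rewrite H2.
        assert (H := ln_le_minus_1 ((INR (S n) + 1) / INR (S n)) ltac:(apply Rdiv_lt_0_compat; lra)).
        rewrite ln_div in H by lra.
        replace ((INR (S n) + 1) / INR (S n) - 1) with (/ INR (S n)) in H by (field; lra). lra. }
      intros n. unfold u. specialize (G (S n)). destruct (Hstep n) as [H1 H2].
      assert (ln (INR (S n)) <= ln (INR (S (S n)))) by (apply ln_le; lra). lra. }
  apply Lim_seq_correct' in Hex.
  unfold euler_gamma. rewrite <- (Lim_seq_ext u _ E). exact Hex.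
Qed.

Lemma npowR_3 n : npowR 3 n = / INR (S n) ^ 3.
Proof.
  unfold npowR, lnS. assert (H := INR_S_ge_1 n).
  replace (- (3) * ln (INR (S n))) with (- (INR 3 * ln (INR (S n)))) by (simpl; ring).
  rewrite exp_Ropp, <- ln_pow, exp_ln by (try apply pow_lt; lra). reflexivity.
Qed.

Lemma zeta3_lnzeta : 0 < zeta3 /\ lnzeta 3 = ln zeta3.
Proof.
  assert (Hex : ex_series (fun n => / INR (S n) ^ 3)).
  { apply (ex_series_ext (npowR 3)); [intros; apply npowR_3|].
    apply (ex_series_of_bounded _ (1 + / (3 - 1))); [intros; left; apply npowR_pos|].
    intros; apply npowR_sum_bound; lra. }
  assert (L := Series_lim _ Hex). fold zeta3 in L.
  assert (H0 : 0 <= zeta3).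
  { apply (is_lim_seq_le (fun _ => 0) (rsum (fun n => / INR (S n) ^ 3)) 0 zeta3); [|apply is_lim_seq_const|exact L].
    intros N. apply rsum_nonneg; intros n _. rewrite <- npowR_3. left; apply npowR_pos. }
  assert (E : dseries (fun _ => RtoC 1) 3 = RtoC zeta3).
  { apply Clim_cseries. apply (Clim_ext (fun N => RtoC (rsum (fun n => / INR (S n) ^ 3) N))).
    - intros N. rewrite <- csum_RtoC. apply csum_ext; intros n _. rewrite npowC_R, npowR_3. ring.
    - intros eps He. destruct (is_lim_seq_eps _ _ L eps He) as [N HN]. exists N; intros n Hn.
      rewrite <- RtoC_minus, Cmod_R. auto. }
  assert (Hnz := dseries_nonzero (fun _ => RtoC 1) 3 trivial_bounded_mult ltac:(simpl; lra)).
  rewrite E in Hnz.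
  assert (Hne : zeta3 <> 0) by (intros E1; apply Hnz; rewrite E1; reflexivity).
  split; [lra|]. unfold lnzeta. rewrite E, Cmod_R, Rabs_pos_eq by lra. reflexivity.
Qed.

(** * Comparison of the weighted sums of chi and of the trivial character *)

Section CubicBounds.
Variables (q : nat) (chi : nat -> C) (A : R).
Hypothesis Hd : dirichlet_char q chi.
Hypothesis Ho : char_order q chi 3.
Hypothesis HA : 0 < A.

Notation S1 K := (Re (psum (logseries_coeff A (fun _ => RtoC 1)) (- A)%C K)).
Notation Schi K := (Re (psum (logseries_coeff A chi) (- A)%C K)).

Lemma pweight_nonneg K n : 0 <= pweight A K n.
Proof.
  apply Rmult_le_pos; [left; apply npowR_pos|]. apply pois_nonneg. apply Rmult_le_pos; [lra|apply lnS_nonneg].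
Qed.

Lemma weighted_sum_le K : Schi K <= S1 K.
Proof.
  apply (is_lim_seq_le _ _ _ _) with
    (2 := psum_logseries_at_minus_A A chi HA (cubic_bounded_mult q chi Hd Ho) K)
    (3 := psum_logseries_at_minus_A A (fun _ => RtoC 1) HA trivial_bounded_mult K).
  intros N. apply rsum_le; intros n _.
  assert (H1 := proj2 (proj2 (cubic_bounded_mult q chi Hd Ho)) (S n)). assert (H2 := Re_le_Cmod (chi (S n))).
  apply Rmult_le_compat_r; [apply pweight_nonneg|]. apply Rmult_le_compat_l; [apply lam_nonneg|]. simpl; lra.
Qed.

Definition cubeweight (K j : nat) : R := npowR 3 j * pois K (A * (3 * lnS j)).

Lemma cube_index j : S (S j ^ 3 - 1) = (S j ^ 3)%nat.
Proof. assert (H : (S j ^ 3 <> 0)%nat) by (apply Nat.pow_nonzero; lia). lia. Qed.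

Lemma pweight_cube K j : pweight A K (S j ^ 3 - 1) = cubeweight K j.
Proof.
  unfold pweight, cubeweight, npowR.
  assert (E : lnS (S j ^ 3 - 1) = 3 * lnS j).
  { unfold lnS. rewrite cube_index, pow_INR, ln_pow by (assert (H := INR_S_ge_1 j); lra). simpl INR. ring. }
  rewrite E. f_equal. f_equal. ring.
Qed.

(** The weight decreases with the integer, and a cube is at least its root. *)
Lemma cubeweight_le_pweight K j : cubeweight K j <= pweight A K j.
Proof.
  assert (Hy := lnS_nonneg j). unfold cubeweight, pweight. apply Rmult_le_compat.
  - left; apply npowR_pos.
  - apply pois_nonneg. nra.
  - apply npowR_mono; lra.
  - apply pois_decr; nra.
Qed.

Lemma rsum_cubes (U : nat -> R) J : (forall n, 0 <= U n) -> rsum (fun j => U (S j ^ 3 - 1)%nat) J <= rsum U (J ^ 3).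
Proof.
  intros HU. induction J as [|J IH]; [simpl; lra|].
  change (rsum (fun j => U (S j ^ 3 - 1)%nat) (S J)) with (rsum (fun j => U (S j ^ 3 - 1)%nat) J + U (S J ^ 3 - 1)%nat).
  assert (E : rsum U (S J ^ 3) = rsum U (S J ^ 3 - 1) + U (S J ^ 3 - 1)%nat) by (rewrite <- (cube_index J) at 1; reflexivity).
  rewrite E.
  assert (H : rsum U (J ^ 3) <= rsum U (S J ^ 3 - 1)).
  { apply rsum_mono; [|auto]. simpl; nia. }
  lra.
Qed.

(* The prime power [j] contributes through [j^3] when [chi j <> 0] (then [chi (j^3) = 1]),
   and through [j] itself when [chi j = 0]. *)
Lemma weighted_sum_ge K J : / 2 * rsum (fun j => lam (S j) * cubeweight K j) J <= Schi K + / 2 * S1 K.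
Proof.
  assert (Hu := cubic_bounded_mult q chi Hd Ho).
  assert (L1 := psum_logseries_at_minus_A A chi HA Hu K).
  assert (L2 := psum_logseries_at_minus_A A (fun _ => RtoC 1) HA trivial_bounded_mult K).
  assert (L := is_lim_seq_plus' _ _ _ _ L1 (is_lim_seq_scal_l _ (/ 2) _ L2)).
  set (T := fun n => lam (S n) * (Re (chi (S n)) + / 2) * pweight A K n).
  (* Separating the terms by the vanishing of [chi] prevents double counting: cubes are taken from
     [U], the integers themselves from [V]. A cube gives [(3/2) lam(j^3) >= lam(j) / 2], an integer
     with [chi j = 0] gives [lam(j) / 2]. *)
  set (U := fun n => if Ceq_dec (chi (S n)) 0 then 0 else T n).
  set (V := fun n => if Ceq_dec (chi (S n)) 0 then T n else 0).
  assert (HT : forall n, 0 <= T n).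
  { intros n. unfold T. apply Rmult_le_pos; [|apply pweight_nonneg]. apply Rmult_le_pos; [apply lam_nonneg|].
    destruct (Ceq_dec (chi (S n)) 0) as [E|E]; [rewrite E; simpl; lra|].
    assert (H := cubic_Re_ge q chi Hd Ho (S n) E). lra. }
  assert (HU : forall n, 0 <= U n) by (intros n; unfold U; destruct (Ceq_dec _ _); [lra|auto]).
  assert (HV : forall n, 0 <= V n) by (intros n; unfold V; destruct (Ceq_dec _ _); [auto|lra]).
  assert (HUV : forall n, T n = U n + V n) by (intros n; unfold U, V; destruct (Ceq_dec _ _); ring).
  apply (is_lim_seq_le_loc (fun _ => / 2 * rsum (fun j => lam (S j) * cubeweight K j) J) _ _ _) with
    (2 := is_lim_seq_const _) (3 := L).
  (* Large enough to contain both the integers up to [J] and their cubes. *)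
  exists (J ^ 3 + J)%nat. intros N HN.
  apply Rle_trans with (rsum T N).
  - rewrite (rsum_ext T (fun n => U n + V n)) by (intros; apply HUV). rewrite rsum_plus.
    apply Rle_trans with (rsum (fun j => U (S j ^ 3 - 1)%nat) J + rsum V J).
    + rewrite <- rsum_plus, <- rsum_scal. apply rsum_le; intros j _.
      unfold V. destruct (Ceq_dec (chi (S j)) 0) as [E|E].
      * assert (H1 := HU (S j ^ 3 - 1)%nat). unfold T. rewrite E. simpl Re.
        assert (H2 := cubeweight_le_pweight K j). assert (H3 := lam_nonneg (S j)). nra.
      * unfold U. rewrite cube_index.
        assert (E3 : chi (S j ^ 3)%nat = RtoC 1).
        { transitivity (chi (S j) ^ 3)%C; [|apply (cubic_cube q chi Hd Ho (S j) E)].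
          change (S j ^ 3)%nat with (S j * (S j * (S j * 1)))%nat. rewrite Nat.mul_1_r.
          rewrite !(proj1 (proj2 Hu)). ring. }
        destruct (Ceq_dec (chi (S j ^ 3)%nat) 0) as [E0|E0].
        { rewrite E3 in E0. apply RtoC_inj in E0. lra. }
        unfold T. rewrite cube_index, E3, pweight_cube. simpl Re.
        assert (H1 := lam_cube (S j)).
        assert (H2 : 0 <= cubeweight K j) by (rewrite <- pweight_cube; apply pweight_nonneg). nra.
    + apply Rplus_le_compat.
      * eapply Rle_trans; [apply rsum_cubes, HU|]. apply rsum_mono; [lia|auto].
      * apply rsum_mono; [lia|auto].
  - right. rewrite <- rsum_scal, <- rsum_plus. apply rsum_ext; intros n _. unfold T. simpl Re. ring.
Qed.
End CubicBounds.

Lemma is_lim_seq_rsum (u : nat -> nat -> R) (l : nat -> R) J :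
  (forall j, is_lim_seq (fun K => u K j) (l j)) -> is_lim_seq (fun K => rsum (u K) J) (rsum l J).
Proof.
  intros H. induction J as [|J IH]; [apply is_lim_seq_const|]. simpl.
  apply is_lim_seq_plus'; auto.
Qed.

(** First [J] is chosen so that the unweighted sum is close to log zeta(3); with [J] fixed, the
    finitely many Poisson factors tend to 1 as [K] grows. *)
Lemma cubeweight_sum_large A eta : 0 < A -> 0 < eta ->
  exists J K0, forall K, (K0 <= K)%nat -> ln zeta3 - eta <= rsum (fun j => lam (S j) * cubeweight A K j) J.
Proof.
  intros HA He. destruct zeta3_lnzeta as [_ Hz].
  destruct (is_lim_seq_eps _ _ (lnzeta_lim 3 ltac:(lra)) (eta / 2) ltac:(lra)) as [J HJ].
  specialize (HJ J ltac:(lia)). rewrite Hz in HJ. apply Rabs_le_between in HJ.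
  assert (L : is_lim_seq (fun K => rsum (fun j => lam (S j) * cubeweight A K j) J) (rsum (fun j => lam (S j) * npowR 3 j) J)).
  { apply is_lim_seq_rsum. intros j. unfold cubeweight.
    apply (is_lim_seq_ext (fun K => (lam (S j) * npowR 3 j) * pois K (A * (3 * lnS j)))); [intros; ring|].
    replace (Finite (lam (S j) * npowR 3 j)) with (Rbar_mult (lam (S j) * npowR 3 j) 1) by (simpl; f_equal; ring).
    apply is_lim_seq_scal_l. apply pois_lim_1. assert (H := lnS_nonneg j). nra. }
  destruct (is_lim_seq_eps _ _ L (eta / 2) ltac:(lra)) as [K0 HK0].
  exists J, K0; intros K HK. specialize (HK0 K HK). apply Rabs_le_between in HK0. lra.
Qed.

Lemma S1_upper A eta : 0 < A -> 0 < eta -> exists K0, forall K, (K0 <= K)%nat ->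
  Re (psum (logseries_coeff A (fun _ => RtoC 1)) (- A)%C (S K)) <= ln (INR K) - ln A + euler_gamma + eta.
Proof.
  intros HA He.
  destruct (is_lim_seq_eps _ _ (zeta_weighted_sum A HA) (eta / 2) ltac:(lra)) as [K1 HK1].
  destruct (is_lim_seq_eps _ _ euler_gamma_lim (eta / 2) ltac:(lra)) as [K2 HK2].
  exists (max K1 K2); intros K HK. specialize (HK1 K ltac:(lia)). specialize (HK2 K ltac:(lia)).
  apply Rabs_le_between in HK1. apply Rabs_le_between in HK2. lra.
Qed.

(** * Choice of the parameters and size of the error *)

Section Truncation.
Variable eta : R.
Hypothesis Heta : 0 < eta <= 1.
(** The truncation will be [K] about [kappa * A * log log q]. The excess of [kappa] over 2 must
    outweigh the loss from [delta] and from a finite [A], each a factor about [1 - eta / 8]. *)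
Let A := 2 + 8 / eta.
Let delta := eta / 16.
Let r := A + / 2 - delta.
Let kappa := 2 * exp eta.

Lemma A_large : 2 <= A /\ 8 / eta <= A.
Proof. assert (0 < 8 / eta) by (apply Rdiv_lt_0_compat; lra). unfold A; lra. Qed.

(** From [ln (r / A) >= (r - A) / r], [A / r >= 1 - eta / 8] and [exp eta >= 1 + eta], it reduces to
    [(1 + eta) (1 - eta/8)^2 >= 1 + eta/2] on (0,1]. *)
Lemma rate_bound : 1 + eta / 2 <= kappa * A * ln (r / A).
Proof.
  destruct A_large as [HA2 HA8].
  assert (Hr : A < r) by (unfold r, delta; lra).
  assert (H1 := ln_ge_1_minus_inv (r / A) ltac:(apply Rdiv_lt_0_compat; lra)).
  replace (1 - / (r / A)) with ((r - A) / r) in H1 by (field; lra).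
  assert (He := exp_ineq1_le eta).
  set (h := / 2 - delta). assert (Hh : r - A = h) by (unfold r, h; ring).
  assert (Hh2 : h = / 2 - eta / 16) by reflexivity.
  assert (H2 : (1 - eta / 8) <= A / r).
  { apply Rmult_le_reg_r with r; [lra|]. unfold Rdiv at 2. rewrite Rmult_assoc, Rinv_l by lra.
    assert (H8 : 8 <= A * eta).
    { apply Rmult_le_reg_r with (/ eta); [apply Rinv_0_lt_compat; lra|].
      rewrite Rmult_assoc, Rinv_r by lra. unfold Rdiv in HA8. lra. }
    nra. }
  assert (H3 : (1 - eta / 8) * h <= A * ln (r / A)).
  { apply Rle_trans with (A / r * h); [apply Rmult_le_compat_r; lra|].
    apply Rle_trans with (A * ((r - A) / r)); [right; rewrite Hh; field; lra|].
    apply Rmult_le_compat_l; lra. }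
  apply Rle_trans with (2 * (1 + eta) * ((1 - eta / 8) * h)); [rewrite Hh2; nra|].
  replace (kappa * A * ln (r / A)) with (2 * exp eta * (A * ln (r / A))) by (unfold kappa; ring).
  apply Rmult_le_compat; [lra|apply Rmult_le_pos; lra|lra|exact H3].
Qed.

(** Here [Y] is log log q and [L] is log q. By [rate_bound] the geometric factor is at most
    [L^(-1 - eta/2)], which beats the factor [L]; what is left decays like [exp (- eta Y / 2)], and
    [exp t >= t] gives the explicit threshold. *)
Lemma error_bound : exists Y0, forall Y L, Y0 <= Y -> L = exp Y -> forall K, kappa * A * Y <= INR K ->
  2 * (ln (12 * (1 + A)) + L) * ((A / r) ^ S K / (1 - A / r)) <= eta.
Proof.
  destruct A_large as [HA2 HA8].
  assert (Hr : A < r) by (unfold r, delta; lra).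
  assert (Hq := ratio_bounds A r ltac:(lra) ltac:(lra)).
  set (c1 := ln (12 * (1 + A))).
  assert (Hc1 : 0 <= c1) by (unfold c1; rewrite <- ln_1; apply ln_le; lra).
  set (c2 := 2 * (c1 + 1) / (1 - A / r)).
  assert (Hc2 : 0 < c2) by (unfold c2; apply Rdiv_lt_0_compat; lra).
  set (nu := eta / 2).
  exists (c2 / (eta * nu)).
  intros Y L HY HL K HK.
  assert (Hnu : 0 < nu) by (unfold nu; lra).
  assert (HYpos : 0 < Y) by (eapply Rlt_le_trans; [|exact HY]; apply Rdiv_lt_0_compat; [auto|apply Rmult_lt_0_compat; lra]).
  assert (Hp : (A / r) ^ S K <= exp (- ((1 + nu) * Y))).
  { apply Rle_trans with ((A / r) ^ K).
    { simpl. assert (0 <= (A / r) ^ K) by (apply pow_le; lra). nra. }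
    rewrite <- (exp_ln (A / r)) by (apply Rdiv_lt_0_compat; lra).
    rewrite exp_pow. apply exp_le.
    assert (E : ln (A / r) = - ln (r / A)) by (rewrite !ln_div by lra; ring). rewrite E.
    assert (Hrb := rate_bound). fold nu in Hrb.
    assert (Hl : 0 <= ln (r / A)).
    { rewrite <- ln_1. apply ln_le; [lra|]. apply Rmult_le_reg_r with A; [lra|]. unfold Rdiv.
      rewrite Rmult_assoc, Rinv_l by lra. lra. }
    assert (H1 : kappa * A * Y * ln (r / A) <= INR K * ln (r / A)) by (apply Rmult_le_compat_r; auto).
    assert (H2 : (1 + nu) * Y <= kappa * A * ln (r / A) * Y) by (apply Rmult_le_compat_r; lra). nra. }
  assert (HL1 : 1 <= L) by (rewrite HL; rewrite <- exp_0; apply exp_le; lra).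
  assert (Hinv : 0 < / (1 - A / r)) by (apply Rinv_0_lt_compat; lra).
  apply Rle_trans with (2 * ((c1 + 1) * L) * (exp (- ((1 + nu) * Y)) / (1 - A / r))).
  { apply Rmult_le_compat.
    - lra.
    - apply Rmult_le_pos; [apply pow_le; lra|lra].
    - nra.
    - apply Rmult_le_compat_r; lra. }
  rewrite HL. replace (- ((1 + nu) * Y)) with (- Y + - (nu * Y)) by ring.
  rewrite exp_plus, !exp_Ropp. assert (HeY := exp_pos Y). assert (HenY := exp_pos (nu * Y)).
  replace (2 * ((c1 + 1) * exp Y) * (/ exp Y * / exp (nu * Y) / (1 - A / r))) with (c2 / exp (nu * Y))
    by (unfold c2; field; repeat split; lra).
  apply Rmult_le_reg_r with (exp (nu * Y)); [auto|].
  unfold Rdiv. rewrite Rmult_assoc, Rinv_l by lra.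
  assert (H1 := exp_ineq1_le (nu * Y)).
  apply Rle_trans with (eta * (nu * Y)); [|apply Rmult_le_compat_l; lra].
  apply Rmult_le_compat_r with (r := eta * nu) in HY; [|apply Rmult_le_pos; lra].
  unfold Rdiv in HY. rewrite Rmult_assoc, Rinv_l in HY; [lra|]. apply Rgt_not_eq, Rmult_lt_0_compat; lra.
Qed.

Lemma log_L1_bounds : GRH -> exists Y0, 1 <= Y0 /\ forall (q : nat) (chi : nat -> C),
  (0 < q)%nat -> Y0 <= ln (ln (INR q)) -> 0 < ln (INR q) ->
  dirichlet_char q chi -> char_order q chi 3 ->
  0 < Cmod (Lfun chi 1) /\
  ln (Cmod (Lfun chi 1)) <= ln 2 + ln (ln (ln (INR q))) + euler_gamma + 4 * eta /\
  / 2 * (ln zeta3 - (ln 2 + ln (ln (ln (INR q))) + euler_gamma)) - 4 * eta <= ln (Cmod (Lfun chi 1)).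
Proof.
  intros HG. destruct A_large as [HA2 HA8].
  destruct error_bound as [Y1 HY1].
  destruct (S1_upper A eta ltac:(lra) ltac:(lra)) as [K1 HK1].
  destruct (cubeweight_sum_large A eta ltac:(lra) ltac:(lra)) as [J [K2 HK2]].
  assert (Hk2 : 2 <= kappa) by (unfold kappa; assert (H := exp_ineq1_le eta); lra).
  (* [Y1] controls the Taylor error, [max K1 K2] makes [K] large enough for the limits, and the last
     entry makes rounding [K] up to an integer cost at most a factor [exp eta]. *)
  exists (Rmax (Rmax 1 Y1) (Rmax (INR (max K1 K2)) (/ (A * kappa * eta)))).
  assert (M1 := Rmax_l (Rmax 1 Y1) (Rmax (INR (max K1 K2)) (/ (A * kappa * eta)))).
  assert (M2 := Rmax_r (Rmax 1 Y1) (Rmax (INR (max K1 K2)) (/ (A * kappa * eta)))).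
  assert (M3 := Rmax_l 1 Y1). assert (M4 := Rmax_r 1 Y1).
  assert (M5 := Rmax_l (INR (max K1 K2)) (/ (A * kappa * eta))).
  assert (M6 := Rmax_r (INR (max K1 K2)) (/ (A * kappa * eta))).
  split; [lra|]. intros q chi Hq HY Hlq Hd Ho.
  set (Y := ln (ln (INR q))) in *.
  assert (HkA : 4 <= kappa * A) by nra.
  destruct (nfloor_ex (kappa * A * Y)) as [n Hn]; [nra|].
  set (K := S n). assert (HK : kappa * A * Y <= INR K <= kappa * A * Y + 1) by (unfold K; rewrite S_INR; lra).
  assert (HKbig : (max K1 K2 <= K)%nat) by (apply INR_le; nra).
  assert (Hq1 : 1 <= INR q) by (change 1 with (INR 1); apply le_INR; lia).
  destruct (cubic_L1_approximation q chi Hq Hd Ho A delta K HG HA2 ltac:(unfold delta; lra)) as [Hnz Happ].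
  fold r in Happ.
  rewrite ln_mult in Happ by lra.
  assert (Herr := HY1 Y (ln (INR q)) ltac:(lra) ltac:(unfold Y; rewrite exp_ln; auto) K ltac:(lra)).
  assert (HS1 := HK1 K ltac:(lia)).
  assert (HJ := HK2 (S K) ltac:(lia)).
  assert (Hup := weighted_sum_le q chi A Hd Ho ltac:(lra) (S K)).
  assert (Hlow := weighted_sum_ge q chi A Hd Ho ltac:(lra) (S K) J).
  (* One [eta] comes from [kappa = 2 exp eta], the other from the rounding. With the error terms of
     [error_bound] and [S1_upper] the upper bound uses up [4 eta]; the lower bound uses [3 eta]. *)
  assert (HKln : ln (INR K) - ln A <= ln 2 + ln Y + 2 * eta).
  { assert (HKp : 0 < INR K) by (unfold K; assert (H := INR_S_ge_1 n); lra).
    rewrite <- ln_div by lra.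
    apply Rle_trans with (ln (2 * Y * exp (2 * eta))).
    - apply ln_le; [apply Rdiv_lt_0_compat; lra|].
      apply Rmult_le_reg_r with A; [lra|]. unfold Rdiv. rewrite Rmult_assoc, Rinv_l, Rmult_1_r by lra.
      apply Rle_trans with (kappa * A * Y * exp eta).
      2:{ right. unfold kappa. replace (2 * eta) with (eta + eta) by ring. rewrite exp_plus. ring. }
      assert (H1 : 1 <= kappa * A * Y * eta).
      { assert (Hp : 0 < A * kappa * eta) by (apply Rmult_lt_0_compat; [apply Rmult_lt_0_compat; lra|lra]).
        apply Rmult_le_reg_r with (/ (A * kappa * eta)); [apply Rinv_0_lt_compat; auto|].
        replace (kappa * A * Y * eta * / (A * kappa * eta)) with Y by (field; repeat split; lra). lra. }
      assert (H2 := exp_ineq1_le eta).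
      assert (H3 : kappa * A * Y * (1 + eta) <= kappa * A * Y * exp eta) by (apply Rmult_le_compat_l; nra).
      lra.
    - rewrite !ln_mult by (try apply exp_pos; lra). rewrite ln_exp. lra. }
  apply Rabs_le_between in Happ.
  split; [apply Cmod_gt_0, Hnz|]. split; lra.
Qed.
End Truncation.

Theorem theorem1p1 :
  GRH ->
  forall eps : R, 0 < eps ->
  exists Q : nat, forall (q : nat) (chi : nat -> C),
    (Q <= q)%nat ->
    dirichlet_char q chi -> primitive_char q chi -> char_order q chi 3 ->
    (1 / sqrt 2 - eps) * sqrt (zeta3 / (exp euler_gamma * ln (ln (INR q))))
      <= Cmod (Lfun chi (RtoC 1)) /\
    Cmod (Lfun chi (RtoC 1)) <= (2 + eps) * exp euler_gamma * ln (ln (INR q)).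
Proof.
  intros HG eps Heps.
  (* Chosen so that [exp (4 eta) <= 1 + eps / 2], whence [2 exp (4 eta) <= 2 + eps]. *)
  set (eta := Rmin 1 (ln (1 + eps / 2) / 4)).
  assert (Hl : 0 < ln (1 + eps / 2)) by (rewrite <- ln_1; apply ln_increasing; lra).
  assert (Heta : 0 < eta <= 1) by (split; [apply Rmin_pos; lra|apply Rmin_l]).
  assert (Heta2 : 4 * eta <= ln (1 + eps / 2)) by (assert (H := Rmin_r 1 (ln (1 + eps / 2) / 4)); fold eta in H; lra).
  destruct (log_L1_bounds eta Heta HG) as [Y0 [HY0 HY]].
  destruct (nfloor_ex (exp (exp Y0))) as [n Hn]; [left; apply exp_pos|].
  exists (S n). intros q chi HQ Hd _ Ho.
  assert (Hqbig : exp (exp Y0) <= INR q).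
  { apply Rle_trans with (INR (S n)); [rewrite S_INR; lra|apply le_INR; auto]. }
  assert (Hlnq : exp Y0 <= ln (INR q)).
  { rewrite <- (ln_exp (exp Y0)). apply ln_le; [apply exp_pos|auto]. }
  assert (HeY := exp_pos Y0).
  assert (Hlnlnq : Y0 <= ln (ln (INR q))).
  { rewrite <- (ln_exp Y0). apply ln_le; [apply exp_pos|auto]. }
  destruct (HY q chi ltac:(lia) Hlnlnq ltac:(lra) Hd Ho) as [Hpos [Hup Hlow]].
  destruct zeta3_lnzeta as [Hz3 _].
  set (Y := ln (ln (INR q))) in *. set (g := exp euler_gamma).
  assert (Hg : 0 < g) by apply exp_pos. assert (HYp : 0 < Y) by lra.
  split.
  - set (X := zeta3 / (g * Y)).
    assert (HX : 0 < X) by (apply Rdiv_lt_0_compat; [auto|apply Rmult_lt_0_compat; auto]).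
    assert (HsX : 0 < sqrt X) by (apply sqrt_lt_R0; auto).
    assert (Hs2 : 0 < sqrt 2) by (apply sqrt_lt_R0; lra).
    assert (Hsq : forall x, 0 < x -> sqrt x = exp (/ 2 * ln x)).
    { intros x Hx. apply sqrt_lem_1; [lra|left; apply exp_pos|].
      rewrite <- exp_plus. replace (/ 2 * ln x + / 2 * ln x) with (ln x) by field. apply exp_ln; auto. }
    (* Since [exp (- 4 eta) >= 1 - 4 eta >= 1 - eps / 2] and [1 / sqrt 2 <= 1], the loss is at most
       [eps]. *)
    apply Rle_trans with (1 / sqrt 2 * exp (- (4 * eta)) * sqrt X).
    + apply Rmult_le_compat_r; [lra|].
      assert (H1 := exp_ineq1_le (- (4 * eta))).
      assert (H2 := ln_le_minus_1 (1 + eps / 2) ltac:(lra)).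
      assert (H3 : 1 / sqrt 2 <= 1).
      { assert (1 <= sqrt 2) by (rewrite <- sqrt_1; apply sqrt_le_1_alt; lra).
        apply Rmult_le_reg_r with (sqrt 2); [lra|]. unfold Rdiv. rewrite Rmult_assoc, Rinv_l by lra. lra. }
      assert (H4 : 0 < 1 / sqrt 2) by (apply Rdiv_lt_0_compat; lra).
      nra.
    + rewrite <- (exp_ln (Cmod (Lfun chi 1))) by auto.
      unfold Rdiv. rewrite Rmult_1_l, (Hsq 2), (Hsq X), <- exp_Ropp, <- !exp_plus by lra.
      apply exp_le.
      assert (ElnX : ln X = ln zeta3 - (euler_gamma + ln Y)).
      { unfold X. rewrite ln_div, ln_mult by (try apply Rmult_lt_0_compat; auto). unfold g. rewrite ln_exp. reflexivity. }
      rewrite ElnX. lra.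
  - rewrite <- (exp_ln (Cmod (Lfun chi 1))) by auto.
    apply Rle_trans with (exp (ln 2 + ln Y + euler_gamma + ln (1 + eps / 2))).
    + apply exp_le. lra.
    + rewrite !exp_plus, !exp_ln by lra. fold g. right; field.
Qed.
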